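(* Let $\rho_{0,h}\in V_p$ be deterministic, $T>0$, $N\in\mathbb N$, and let $(\Omega,\mathcal G,(\mathcal G_t)_{t\ge0},\mathbb P)$, $\boldsymbol B=(B_1,\dots,B_{n_G})$, $\rho_h$ be a probabilistically weak solution on $[0,T]$, as defined in the context, of the discontinuous Galerkin Dean--Kawasaki scheme with initial datum $\rho_{0,h}$, satisfying $\mathbb E[\sup_{t\in[0,T]}\|\rho_h(t)\|^q]<\infty$ for every $q\ge2$. For $v_h\in V_p$ define the process $\mathcal W(\rho_h^+(t),v_h)$, started from $0$ at $t=0$, by $$\mathrm d\mathcal W(\rho_h^+(t),v_h):=\sum_{j=1}^{n_G}(\boldsymbol g_j(\rho_h(t)),G_hv_h)\,\mathrm dB_j(t).$$ Then $\mathcal W(\rho_h^+(t),v_h)$ is a continuous, square-integrable martingale, and $$\mathrm d\langle \mathcal W(\rho_h^+(\cdot),v_{1,h}),\mathcal W(\rho_h^+(\cdot),v_{2,h})\rangle_t=(\rho_h^+(t),\,G_hv_{1,h}\cdot G_hv_{2,h})\,\mathrm dt$$ for any $v_{1,h},v_{2,h}\in V_p$.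
   Context: Let $d\in\{1,2,3\}$, $p\ge1$ an integer, $\mathbb T^d$ the flat torus; $(\cdot,\cdot)$, $\|\cdot\|$ are the $L^2(\mathbb T^d)$ inner product and norm. $\mathcal T_h$ is a shape-regular, quasi-uniform affine simplicial mesh of $\mathbb T^d$ with facet set $\mathcal F_h$ (all facets interior by periodicity); $h_F>0$ is the diameter of $F$ (for $d=1$, a positive local length scale comparable to the adjacent element diameters). $V_p$ (resp. $\boldsymbol V_\ell^d$) is the space of $L^2$ functions (resp. $\mathbb R^d$-valued functions) that are polynomials of degree at most $p$ (resp. $\ell$) on each element, with no continuity imposed. On $F=\partial K_\ell\cap\partial K_r$: average $\{\!\{\boldsymbol v\}\!\}:=\frac12(\boldsymbol v|_{K_\ell}+\boldsymbol v|_{K_r})$, jump $[\![v]\!]:=v|_{K_\ell}\boldsymbol n_{K_\ell}+v|_{K_r}\boldsymbol n_{K_r}$. Local lifting $\boldsymbol{\mathcal L}_F(\boldsymbol u)\in\boldsymbol V_{p-1}^d$: $\int_{\mathbb T^d}\boldsymbol{\mathcal L}_F(\boldsymbol u)\cdot\boldsymbol v_h=\int_F\{\!\{\boldsymbol v_h\}\!\}\cdot\boldsymbol u\,\mathrm dS$ for all $\boldsymbol v_h\in\boldsymbol V_{p-1}^d$. Discrete gradient: $G_hv_h:=\nabla_hv_h-\sum_{F\in\mathcal F_h}\boldsymbol{\mathcal L}_F([\![v_h]\!])$, with $\nabla_h$ the elementwise gradient. $u_h^+:=\max\{u_h,0\}$. Noise coefficients: let $n_G:=\dim\boldsymbol V_{p-1}^d$,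 $\{\boldsymbol f_i\}$ a basis of $\boldsymbol V_{p-1}^d$, $(M_{\mathrm G})_{ij}=(\boldsymbol f_i,\boldsymbol f_j)$, $P(u_h)_{ij}=\int u_h^+\boldsymbol f_i\cdot\boldsymbol f_j\,\mathrm d\boldsymbol x$, $R(u_h)=P(u_h)^{1/2}$ the symmetric positive semi-definite square root, and $\boldsymbol g_j(u_h):=\sum_i(M_{\mathrm G}^{-1}R(u_h))_{ij}\boldsymbol f_i$ for $u_h\in V_p$. Symmetric interior penalty form, with penalty $\eta>0$: $$a_h(w_h,v_h):=\tfrac12(\nabla_hw_h,\nabla_hv_h)-\tfrac12\sum_{F}\int_F\big([\![w_h]\!]\cdot\{\!\{\nabla_hv_h\}\!\}+\{\!\{\nabla_hw_h\}\!\}\cdot[\![v_h]\!]\big)\mathrm dS+\tfrac\eta2\sum_Fh_F^{-1}\int_F[\![w_h]\!]\cdot[\![v_h]\!]\,\mathrm dS.$$ Weak solution of the scheme: a filtered probability space satisfying the usual conditions, an $n_G$-dimensional standard $(\mathcal G_t)$-Brownian motion $\boldsymbol B$, and a continuous, adapted, $V_p$-valued process $\rho_h$ such that $\mathbb P$-a.s., for all $v_h\in V_p$ and $t\in[0,T]$, $(\rho_h(t),v_h)=(\rho_{0,h},v_h)-\int_0^ta_h(\rho_h(s),v_h)\,\mathrm ds+N^{-1/2}\sum_{j=1}^{n_G}\int_0^t(\boldsymbol g_j(\rho_h(s)),G_hv_h)\,\mathrm dB_j(s)$. *)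

(* Defs.v *)
From HB Require Import structures.
From mathcomp Require Import all_boot all_order all_algebra.
From mathcomp Require Import all_classical all_reals all_analysis.
Set Implicit Arguments.
Unset Strict Implicit.
Unset Printing Implicit Defensive.
Import Order.TTheory GRing.Theory Num.Theory.
Import numFieldNormedType.Exports.
Local Open Scope classical_set_scope.
Local Open Scope ring_scope.

(** * Euclidean geometry of R^d *)

Section euclidean.
Context {R : realType} {d : nat}.
Implicit Types (x y : 'rV[R]_d) (A : set 'rV[R]_d).

Definition dot x y : R := \sum_(i < d) x 0 i * y 0 i.

(* The library norm of a row vector is the sup norm. *)
Definition enorm x : R := Num.sqrt (dot x x).

Definition eball x (r : R) : set 'rV[R]_d := [set y | enorm (y - x) <= r].

Definition diam A : R := sup [set enorm (x - y) | x in A & y in A].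

(* The diameter of the largest ball inscribed in [A]. *)
Definition inball_diam A : R :=
  sup [set 2 * r | r in [set r | 0 <= r /\ exists x, eball x r `<=` A]].

Definition translate A x : set 'rV[R]_d := [set y + x | y in A].

Definition lattice (z : 'rV[int]_d) : 'rV[R]_d := map_mx intr z.

Implicit Types v : 'I_d.+1 -> 'rV[R]_d.

(* The face of the simplex with vertices [v] spanned by the vertices in [J];
   it is empty if [J] is. *)
Definition face v (J : {set 'I_d.+1}) : set 'rV[R]_d :=
  [set x | exists a : 'I_d.+1 -> R,
     [/\ forall i, 0 <= a i, forall i, i \notin J -> a i = 0,
         \sum_i a i = 1 & x = \sum_i a i *: v i]].

Definition simplex v : set 'rV[R]_d := face v [set: 'I_d.+1]%SET.

(* The facets of a simplex are labelled by the opposite vertex. *)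
Definition opp_facet v (i : 'I_d.+1) : set 'rV[R]_d := face v [set~ i]%SET.

Definition affinely_independent v : Prop :=
  \det (\matrix_(j < d) (v (lift ord0 j) - v ord0)) != 0.

Definition outward_unit_normal v (i : 'I_d.+1) : 'rV[R]_d :=
  xget 0 [set n | [/\ enorm n = 1,
    forall j k, j != i -> k != i -> dot n (v j - v k) = 0 &
    forall j, j != i -> dot n (v i - v j) < 0]].

End euclidean.

(** * Integration over R^d and over facets *)

(* The integral with respect to the Lebesgue measure of R^n, as the iterated
   integral; for n = 0 it is the value at the only point. *)
Fixpoint lebesgue_int {R : realType} (n : nat) : ('rV[R]_n -> \bar R) -> \bar R :=
  match n with
  | 0 => fun f => f 0
  | m.+1 => fun f =>
      (\int[@lebesgue_measure R]_x
         lebesgue_int (fun y : 'rV[R]_m => f (row_mx (\row_(_ < 1) x) y)))%E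
  end.

Definition int_over {R : realType} {n : nat} (A : set 'rV[R]_n)
    (f : 'rV[R]_n -> R) : R :=
  fine (lebesgue_int (fun x => ((f \_ A) x)%:E)).

Definition ref_simplex {R : realType} (n : nat) : set 'rV[R]_n :=
  [set t | (forall j, 0 <= t 0 j) /\ \sum_j t 0 j <= 1].

(* Surface integral over the facet opposite to vertex [i], through its affine
   parametrization t |-> a_0 + sum_j t_j (a_j.+1 - a_0) by the reference
   (d-1)-simplex, with a_0, ..., a_(d-1) its vertices; the surface element is
   the square root of the Gram determinant of the edges. For d = 1 this is the
   value at the point. *)
Section facet_integral.
Context {R : realType} {d : nat}.
Variables (v : 'I_d.+1 -> 'rV[R]_d) (i : 'I_d.+1).

Definition facet_vertex (k : nat) : 'rV[R]_d :=
  nth 0 [seq v j | j <- enum 'I_d.+1 & j != i] k.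

Definition facet_edges : 'M[R]_(d.-1, d) :=
  \matrix_(j < d.-1) (facet_vertex j.+1 - facet_vertex 0).

Definition facet_int (f : 'rV[R]_d -> R) : R :=
  Num.sqrt (\det (facet_edges *m facet_edges^T)) *
  int_over (@ref_simplex R d.-1) (fun t => f (facet_vertex 0 + t *m facet_edges)).

End facet_integral.

(** * Simplicial meshes of the torus R^d / Z^d *)

(* A mesh of the torus is given by one lifted simplex in R^d for each element;
   the Z^d-translates of these form a conforming simplicial tiling of R^d.
   Every facet of the torus is a facet of exactly two elements [K_l], [K_r]:
   [fct_l F] and [fct_r F] are these elements, with the vertex opposite to [F],
   and the lift of [F] in [K_l] is the lift in [K_r] translated by [fct_z F]. *)
Record mesh (R : realType) (d : nat) := Mesh {
  elt : finType;
  vtx : elt -> 'I_d.+1 -> 'rV[R]_d;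
  fct : finType;
  fct_l : fct -> elt * 'I_d.+1;
  fct_r : fct -> elt * 'I_d.+1;
  fct_z : fct -> 'rV[int]_d;
  mesh_affine : forall K, affinely_independent (vtx K);
  mesh_cover : forall x, exists K z,
    translate (simplex (vtx K)) (lattice z) x;
  mesh_disjoint : forall K K' z z',
    (translate (simplex (vtx K)) (lattice z))° `&`
    (translate (simplex (vtx K')) (lattice z'))° !=set0 -> K = K' /\ z = z';
  mesh_conforming : forall K K' z z', exists J J',
    let S := translate (simplex (vtx K)) (lattice z) `&`
             translate (simplex (vtx K')) (lattice z') in
    S = translate (face (vtx K) J) (lattice z) /\
    S = translate (face (vtx K') J') (lattice z');
  mesh_facets : bijective (fun s : fct + fct =>
    match s with inl F => fct_l F | inr F => fct_r F end);
  mesh_match : forall F,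
    opp_facet (vtx (fct_l F).1) (fct_l F).2 =
    translate (opp_facet (vtx (fct_r F).1) (fct_r F).2) (lattice (fct_z F))
}.

Section mesh_families.
Context {R : realType} {d : nat}.

Definition elt_diam (M : mesh R d) (K : elt M) : R := diam (simplex (vtx K)).

Definition shape_regular (I : Type) (Th : I -> mesh R d) : Prop :=
  exists sigma : R, 0 < sigma /\ forall h (K : elt (Th h)),
    elt_diam K <= sigma * inball_diam (simplex (vtx K)).

Definition quasi_uniform (I : Type) (Th : I -> mesh R d) : Prop :=
  exists c : R, 0 < c /\ forall h (K K' : elt (Th h)),
    elt_diam K <= c * elt_diam K'.

(* h_F is the diameter of F if d > 1. *)
Definition facet_length_scale (I : Type) (Th : I -> mesh R d)
    (hF : forall h, fct (Th h) -> R) : Prop :=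
  (forall h (F : fct (Th h)), 0 < hF h F) /\
  if d == 1%N then
    exists c C : R, [/\ 0 < c, 0 < C & forall h (F : fct (Th h)) (K : elt (Th h)),
      K = (fct_l F).1 \/ K = (fct_r F).1 ->
      c * elt_diam K <= hF h F <= C * elt_diam K]
  else
    forall h (F : fct (Th h)),
      hF h F = diam (opp_facet (vtx (fct_l F).1) (fct_l F).2).

End mesh_families.

(** * Discontinuous Galerkin spaces *)

(* Exponents of the monomials of total degree at most [l] in [d] variables. *)
Definition monomial (d l : nat) : finType :=
  {m : {ffun 'I_d -> 'I_l.+1} | (\sum_i m i <= l)%N}.

Section broken_spaces.
Context {R : realType} {d : nat} (M : mesh R d).

(* Fields on the torus without continuity across the facets, each element being
   identified with its lifted simplex. *)
Definition broken := elt M -> 'rV[R]_d -> R.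
Definition vbroken := elt M -> 'rV[R]_d -> 'rV[R]_d.

Definition inner (f g : broken) : R :=
  \sum_K int_over (simplex (vtx K)) (fun x => f K x * g K x).

Definition vinner (f g : vbroken) : R :=
  \sum_K int_over (simplex (vtx K)) (fun x => dot (f K x) (g K x)).

Definition L2norm (f : broken) : R := Num.sqrt (inner f f).

(* Traces at the point [x] of the lift of [F] in [K_l]. *)
Definition tr_l (E : Type) (F : fct M) (f : elt M -> 'rV[R]_d -> E)
    (x : 'rV[R]_d) : E := f (fct_l F).1 x.
Definition tr_r (E : Type) (F : fct M) (f : elt M -> 'rV[R]_d -> E)
    (x : 'rV[R]_d) : E := f (fct_r F).1 (x - lattice (fct_z F)).

Definition average (F : fct M) (f : vbroken) (x : 'rV[R]_d) : 'rV[R]_d :=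
  2^-1 *: (tr_l F f x + tr_r F f x).

Definition jump (F : fct M) (f : broken) (x : 'rV[R]_d) : 'rV[R]_d :=
  tr_l F f x *: outward_unit_normal (vtx (fct_l F).1) (fct_l F).2 +
  tr_r F f x *: outward_unit_normal (vtx (fct_r F).1) (fct_r F).2.

Definition int_facet (F : fct M) (f : 'rV[R]_d -> R) : R :=
  facet_int (vtx (fct_l F).1) (fct_l F).2 f.

Definition grad (f : broken) : vbroken :=
  fun K x => \row_i 'D_(delta_mx 0 i) (f K) x.

(* An element of V_l, represented by the coefficients of its polynomials: one
   row for each element, one column for each monomial. *)
Definition dG (l : nat) := 'M[R]_(#|elt M|, #|monomial d l|).
Definition vdG (l : nat) := {ffun 'I_d -> dG l}.

Definition ev (l : nat) (v : dG l) : broken := fun K x =>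
  \sum_(m : monomial d l)
    v (enum_rank K) (enum_rank m) * \prod_(i < d) x 0 i ^+ val m i.

Definition vev (l : nat) (w : vdG l) : vbroken := fun K x =>
  \row_i ev (w i) K x.

Definition pos_part (f : broken) : broken := fun K x => Num.max (f K x) 0.

Variable p : nat.

Definition lifting (F : fct M) (u : 'rV[R]_d -> 'rV[R]_d) : vdG p.-1 :=
  xget 0 [set w | forall v : vdG p.-1, vinner (vev w) (vev v) =
    int_facet F (fun x => dot (average F (vev v) x) (u x))].

Definition dgrad (v : dG p) : vbroken := fun K x =>
  grad (ev v) K x - \sum_(F : fct M) vev (lifting F (jump F (ev v))) K x.

Definition sip_form (eta : R) (hF : fct M -> R) (w v : dG p) : R :=
  2^-1 * vinner (grad (ev w)) (grad (ev v))
  - 2^-1 * (\sum_(F : fct M) int_facet F (fun x =>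
      dot (jump F (ev w) x) (average F (grad (ev v)) x) +
      dot (average F (grad (ev w)) x) (jump F (ev v) x)))
  + eta / 2 * (\sum_(F : fct M) (hF F)^-1 *
      int_facet F (fun x => dot (jump F (ev w) x) (jump F (ev v) x))).

End broken_spaces.

(** * Noise coefficients *)

Definition psd_sqrt {R : realType} {n : nat} (A : 'M[R]_n) : 'M[R]_n :=
  xget 0 [set S | [/\ S^T = S,
    forall x : 'rV[R]_n, 0 <= (x *m S *m x^T) 0 0 & S *m S = A]].

Section noise.
Context {R : realType} {d : nat} (M : mesh R d) (p : nat).

Definition n_G : nat := \dim (@fullv R (vdG M p.-1)).

Variable f : n_G.-tuple (vdG M p.-1).

Definition mass_G : 'M[R]_n_G :=
  \matrix_(i, j) vinner (vev (tnth f i)) (vev (tnth f j)).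

Definition weighted_mass (u : dG M p) : 'M[R]_n_G :=
  \matrix_(i, j) \sum_K int_over (simplex (vtx K)) (fun x =>
    pos_part (ev u) K x * dot (vev (tnth f i) K x) (vev (tnth f j) K x)).

Definition noise_coef (u : dG M p) (j : 'I_n_G) : vdG M p.-1 :=
  \sum_i (invmx mass_G *m psd_sqrt (weighted_mass u)) i j *: tnth f i.

End noise.

(** * Stochastic processes on [0, T] *)

Section processes.
Context {R : realType} {disp : measure_display} {Omega : measurableType disp}.
Variables (P : probability Omega R) (G : R -> set (set Omega)).

Definition usual_conditions : Prop :=
  [/\ forall t, 0 <= t -> sigma_algebra setT (G t) /\ G t `<=` measurable,
      forall s t, 0 <= s -> s <= t -> G s `<=` G t,
      forall t, 0 <= t -> \bigcap_(s in [set s | t < s]) G s `<=` G t &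
      forall N, P.-negligible N -> G 0 N].

(* [I] is the set of times at which the process is considered. *)
Definition adapted (I : set R) (X : R -> Omega -> R) : Prop :=
  forall t, I t -> 0 <= t ->
  forall U : set R, measurable U -> G t (X t @^-1` U).

Definition continuous_process (E : topologicalType) (I : set R)
    (X : R -> Omega -> E) : Prop :=
  {ae P, forall w, {within I, continuous (fun t => X t w)}}.

(* The increments B(t) - B(s) are independent of G_s with law N(0, (t-s) I_n):
   both properties are expressed on products of Borel sets. *)
Definition brownian_motion (n : nat) (B : 'I_n -> R -> Omega -> R) : Prop :=
  [/\ forall j, {ae P, forall w, B j 0 w = 0},
      forall j, adapted `[0, +oo[ (B j),
      forall j, continuous_process `[0, +oo[ (B j) &
      forall s t, 0 <= s -> s < t -> forall A, G s A ->
      forall U : 'I_n -> set R, (forall j, measurable (U j)) ->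
      P [set w | A w /\ forall j, U j (B j t w - B j s w)] =
      (P A * \prod_j normal_prob 0 (Num.sqrt (t - s)) (U j))%E].

Variable T : R.

(* H = sum_(i < n) xi_i 1_(t_i, t_(i+1)] *)
Record simple_process := SimpleProcess {
  sp_size : nat;
  sp_time : nat -> R;
  sp_xi : nat -> Omega -> R;
  sp_time_ge0 : 0 <= sp_time 0;
  sp_time_le : forall i, (i < sp_size)%N -> sp_time i <= sp_time i.+1;
  sp_time_leT : sp_time sp_size <= T;
  sp_adapted : forall i, (i < sp_size)%N ->
    forall U : set R, measurable U -> G (sp_time i) (sp_xi i @^-1` U);
  sp_bounded : exists c : R, forall i, (i < sp_size)%N ->
    forall w, `|sp_xi i w| <= c
}.

Definition sp_val (H : simple_process) (s : R) (w : Omega) : R :=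
  \sum_(i < sp_size H)
    sp_xi H i w * (sp_time H i < s <= sp_time H i.+1)%R%:R.

Definition sp_int (H : simple_process) (b : R -> Omega -> R) (t : R)
    (w : Omega) : R :=
  \sum_(i < sp_size H) sp_xi H i w *
    (b (Num.min t (sp_time H i.+1)) w - b (Num.min t (sp_time H i)) w).

(* Convergence to 0 in (outer) probability of nonnegative functions. *)
Definition cvg0_in_probability (X : nat -> Omega -> \bar R) : Prop :=
  forall eps del : R, 0 < eps -> 0 < del -> \forall n \near \oo,
    exists2 A, measurable A &
      [set w | (eps%:E < X n w)%E] `<=` A /\ (P A <= del%:E)%E.

(* [Y] is the stochastic integral of [H] with respect to [b] on [0, T]: the
   limit, uniformly on [0, T] in probability, of the integrals of simple
   processes converging to [H] in L^2(0, T), in probability. This determines [Y]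
   up to indistinguishability. *)
Definition ito_integral (b H Y : R -> Omega -> R) : Prop :=
  {ae P, forall w, measurable_fun `[0, T] (fun s => H s w)} /\
  exists S : nat -> simple_process,
    cvg0_in_probability (fun n w =>
      (\int[@lebesgue_measure R]_(s in `[0%R, T])
         ((sp_val (S n) s w - H s w) ^+ 2)%:E)%E) /\
    cvg0_in_probability (fun n w =>
      ereal_sup [set `|sp_int (S n) b t w - Y t w|%:E | t in `[0%R, T]]).

(* Y(t) = sum_j int_0^t H_j(s) dB_j(s) for t in [0, T], up to
   indistinguishability. *)
Definition ito_integral_sum (n : nat) (B H : 'I_n -> R -> Omega -> R)
    (Y : R -> Omega -> R) : Prop :=
  exists Z : 'I_n -> R -> Omega -> R,
    (forall j, ito_integral (B j) (H j) (Z j)) /\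
    {ae P, forall w, forall t, 0 <= t <= T -> Y t w = \sum_j Z j t w}.

Definition martingale (X : R -> Omega -> R) : Prop :=
  [/\ adapted `[0, T] X,
      forall t, 0 <= t <= T -> P.-integrable setT (EFin \o X t) &
      forall s t, 0 <= s -> s <= t -> t <= T -> forall A, G s A ->
        (\int[P]_(w in A) (X t w)%:E = \int[P]_(w in A) (X s w)%:E)%E].

Definition square_integrable (X : R -> Omega -> R) : Prop :=
  forall t, 0 <= t <= T -> ('E_P[fun w => (X t w ^+ 2)%R] < +oo)%E.

Definition continuous_square_integrable_martingale (X : R -> Omega -> R) :=
  [/\ continuous_process `[0, T] X, square_integrable X & martingale X].

(* [A] is the bracket <X, Y> of two continuous square-integrable martingales. *)
Definition is_bracket (X Y A : R -> Omega -> R) : Prop :=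
  [/\ adapted `[0, T] A, {ae P, forall w, A 0 w = 0},
      continuous_process `[0, T] A,
      {ae P, forall w, bounded_variation 0 T (fun t => A t w)} &
      martingale (fun t w => X t w * Y t w - A t w)].

End processes.

(** * The discontinuous Galerkin Dean-Kawasaki scheme *)

Section scheme.
Context {R : realType} {d : nat} (M : mesh R d) (p : nat).
Variable f : (n_G M p).-tuple (vdG M p.-1).
Context {disp : measure_display} {Omega : measurableType disp}.
Variables (P : probability Omega R) (G : R -> set (set Omega)).
Variables (B : 'I_(n_G M p) -> R -> Omega -> R) (rho : R -> Omega -> dG M p).

Definition noise_integrand (v : dG M p) (j : 'I_(n_G M p)) (t : R)
    (w : Omega) : R :=
  vinner (vev (noise_coef f (rho t w) j)) (dgrad v).

Definition weak_solution (T : R) (N : nat) (eta : R) (hF : fct M -> R)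
    (rho0 : dG M p) : Prop :=
  [/\ usual_conditions P G,
      brownian_motion P G B,
      continuous_process P `[0, T] rho,
      forall K m, adapted G `[0, T] (fun t w => rho t w K m) &
      exists Z : dG M p -> R -> Omega -> R,
        (forall v, ito_integral_sum P G T B (noise_integrand v) (Z v)) /\
        {ae P, forall w, forall v t, 0 <= t <= T ->
          inner (ev (rho t w)) (ev v) =
            inner (ev rho0) (ev v)
            - \int[@lebesgue_measure R]_(s in `[0, t])
                 sip_form eta hF (rho s w) v
            + (Num.sqrt N%:R)^-1 * Z v t w}].

End scheme.

(* Main.v *)
(** The stochastic part is an Ito theory for integrands that are only controlled
    by a function [q] with finite lower integral.  Truncating the approximating
    simple processes when their energy exceeds [k] and passing to a subsequence
    (Borel-Cantelli) gives simple processes whose energies are dominated by one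
    integrable function; the martingale property and the bracket
    [int_0^t sum_j H_j H'_j] then follow from the elementary Ito isometry by
    dominated convergence.

    The algebraic part identifies [sum_j (g_j, G v_1) (g_j, G v_2)].  As the
    discrete gradient is a broken polynomial field, it has coordinates [c] in
    the basis [f]; the Gram matrix [M] of the basis cancels against [M^-1], so
    [(g_j, G v)] is the [j]-th entry of [P^(1/2) c] and the sum is [c_1 P c_2^T],
    which is the weighted inner product.  Invertibility of [M] is the fact that a
    polynomial with vanishing L^2 norm on a simplex is zero. *)

Require Import Defs.
From HB Require Import structures.
From mathcomp Require Import all_boot all_order all_algebra.
From mathcomp Require Import all_classical all_reals all_analysis measurable_realfun.
From mathcomp Require Import complex.
From mathcomp Require Import ring lra.
Set Implicit Arguments.
Unset Strict Implicit.
Unset Printing Implicit Defensive.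
Import Order.TTheory GRing.Theory Num.Theory.
Import numFieldNormedType.Exports.
Local Open Scope classical_set_scope.
Local Open Scope ring_scope.

(** * Square roots of positive semi-definite matrices *)

(** Three obstacles shape the work. The stochastic integral is known only as a limit in probability,
    and its integrands are known to be measurable only along almost every path, so that neither an
    isometry nor the measurability of the energy of [H] is available at the start. Both come from
    the simple processes: the energy of [H] is an almost sure limit of their energies, and mean
    square convergence follows from Fatou's lemma once covariations converge in expectation. The
    moment hypothesis involves a supremum over uncountably many times, which need not be measurable;
    hence the lower integrals. Finally, the integral over R^n is an iterated one-dimensional
    integral rather than an integral for a measure on row vectors: additivity and positivity are
    carried through the coordinates one by one, with finite and measurable inner integrals at each
    stage. The matrix square root is obtained over the reals by functional calculus with an
    interpolating polynomial, although the diagonalization takes place over the complex numbers. *)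

Lemma poly_interpolation (F : fieldType) (s : seq F) (g : F -> F) :
  exists q : {poly F}, forall a, a \in s -> q.[a] = g a.
Proof.
elim: s => [|a s [q qP]]; first by exists 0.
have [as_|as_] := boolP (a \in s).
  by exists q => b; rewrite inE => /orP[/eqP->|]; exact: qP.
pose w := \prod_(b <- s) ('X - b%:P).
have wa : w.[a] != 0.
  by rewrite -rootE; rewrite root_prod_XsubC.
exists (q + ((g a - q.[a]) / w.[a]) *: w) => b.
rewrite inE hornerD hornerZ => /orP[/eqP->|bs].
  by rewrite divfK// addrC subrK.
have -> : w.[b] = 0 by apply/rootP; rewrite root_prod_XsubC.
by rewrite mulr0 addr0 qP.
Qed.

Lemma trmx_horner (R : comNzRingType) n (A : 'M[R]_n.+1) (q : {poly R}) :
  A^T = A -> (horner_mx A q)^T = horner_mx A q.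
Proof.
move=> AT; elim/poly_ind: q => [|q c IH]; first by rewrite rmorph0 trmx0.
rewrite rmorphD rmorphM /= horner_mx_X horner_mx_C linearD /= tr_scalar_mx.
congr (_ + _); rewrite -[_ * _]/(_ *m _) trmx_mul IH AT.
by have /= := comm_horner_mx q (comm_mx_refl A).
Qed.

Lemma psd_eigenvalue_ge0 (R : rcfType) n (A : 'M[R]_n) (a : R) :
  (forall x : 'rV[R]_n, 0 <= (x *m A *m x^T) 0 0) -> eigenvalue A a -> 0 <= a.
Proof.
move=> Apsd /eigenvalueP[v vA v0].
have := Apsd v; rewrite vA -scalemxAl mxE pmulr_lge0//.
have -> : (v *m v^T) 0 0 = \sum_j v 0 j ^+ 2.
  by rewrite mxE; apply: eq_bigr => j _; rewrite mxE expr2.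
rewrite lt_neqAle sumr_ge0 ?andbT; last by move=> j _; exact: sqr_ge0.
apply: contraNneq v0 => /esym/eqP.
rewrite psumr_eq0; last by move=> j _; exact: sqr_ge0.
move=> /allP vj; apply/eqP/rowP => j; rewrite mxE.
by have := vj j (mem_index_enum _); rewrite sqrf_eq0 => /eqP.
Qed.

Section spectral_square_root.
Local Open Scope complex_scope.
Local Open Scope sesquilinear_scope.

(** A real symmetric matrix is hermitian over the complex numbers, where the spectral theorem for
    normal matrices applies. The transition matrix may be complex; only the spectrum is claimed to
    be real. *)
Lemma symmetric_diag (R : rcfType) n (A : 'M[R]_n) : A^T = A ->
  exists (U : 'M[R[i]]_n) (l : 'rV[R]_n), U \in unitmx /\
    map_mx (real_complex R) A =
    invmx U *m diag_mx (map_mx (real_complex R) l) *m U.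
Proof.
move=> AT; set AC := map_mx _ A.
have ACh : AC \is hermsymmx.
  apply/is_hermitianmxP; rewrite expr0 scale1r.
  apply/matrixP => i j; rewrite !mxE.
  have -> : A j i = A i j by rewrite -[in LHS]AT mxE.
  by apply/esym/CrealP; apply/complex_realP; exists (A i j).
have /hermitian_normalmx/orthomx_spectralP ACE := ACh.
have dr := hermitian_spectral_diag_real ACh.
exists (spectralmx AC), (map_mx (@complex.Re R) (spectral_diag AC)).
split; first exact: spectral_unit.
rewrite {1}ACE; congr (_ *m diag_mx _ *m _).
apply/rowP => i; rewrite !mxE.
have /mxOverP/(_ 0 i)/complex_realP[x ->] := dr.
by [].
Qed.

(** A real polynomial [q] that equals the fourth root at each eigenvalue gives a real symmetric
    matrix [T], namely [q] at [A]. The square of [T] is positive semi-definite because [T] equals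
    its transpose, and that the fourth power of [T] is [A] is checked on the complex diagonal
    form. *)
Lemma psd_sqrt_exists (R : rcfType) n (A : 'M[R]_n) : A^T = A ->
  (forall x : 'rV[R]_n, 0 <= (x *m A *m x^T) 0 0) ->
  exists S : 'M[R]_n, [/\ S^T = S,
    forall x : 'rV[R]_n, 0 <= (x *m S *m x^T) 0 0 & S *m S = A].
Proof.
case: n A => [|n] A AT Apsd.
  exists 0; split; first by rewrite trmx0.
    by move=> x; rewrite mulmx0 mul0mx mxE.
  by apply/matrixP => -[].
have [U [l [Uu AE]]] := symmetric_diag AT.
have l0 i : 0 <= l 0 i.
  apply: (psd_eigenvalue_ge0 Apsd).
  have : eigenvalue (map_mx (real_complex R) A) (real_complex R (l 0 i)).
    apply/eigenvalueP; exists (row i U).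
      rewrite AE -row_mul !mulmxA mulmxV// mul1mx.
      by rewrite row_mul row_diag_mx -scalemxAl -rowE mxE.
    by move: Uu; rewrite -row_free_unit => /row_freeP[V UV]; apply/eqP => Ui;
      move: (congr1 (row i) UV); rewrite row_mul Ui mul0mx => /rowP/(_ i)/eqP;
      rewrite !mxE eqxx eq_sym oner_eq0.
  (* The complexified matrix has the same characteristic polynomial, so its real eigenvalues are
     eigenvalues of [A]. *)
  by rewrite !eigenvalue_root_char -map_char_poly fmorph_root.
have [q qP] := poly_interpolation [seq l 0 i | i <- enum 'I_n.+1]
  (fun a => Num.sqrt (Num.sqrt a)).
have q4 i : q.[l 0 i] ^+ 4 = l 0 i.
  rewrite qP; last by apply: map_f; rewrite mem_enum.
  by rewrite (exprM _ 2 2) sqr_sqrtr ?sqrtr_ge0// sqr_sqrtr.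
pose T := horner_mx A q.
have TT : T^T = T by exact: trmx_horner.
exists (T *m T); split; first by rewrite trmx_mul TT.
  move=> x; rewrite mulmxA -[_ *m T *m _]mulmxA -{2}TT -trmx_mul mxE.
  by apply: sumr_ge0 => j _; rewrite [_^T _ _]mxE -expr2 sqr_ge0.
apply: (map_mx_inj (f := real_complex R)).
have -> : T *m T *m (T *m T) = horner_mx A (q ^+ 4).
  by rewrite rmorphXn /= -/T !exprS expr0 mulr1 mulrA.
rewrite map_horner_mx AE horner_mx_uconjC ?unitmxE// horner_mx_diag.
congr (_ *m diag_mx _ *m _); apply/rowP => i; rewrite !mxE.
by rewrite -[in RHS](q4 i) horner_map /= horner_exp.
Qed.

End spectral_square_root.

(** * Brownian increments and elementary stochastic integrals *)

Section normal_moments.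
Context {R : realType}.
Variable s : R.
Hypothesis s0 : 0 < s.
Local Notation mu := (@lebesgue_measure R).
Local Notation nu := (normal_prob 0 s).

(** The Radon-Nikodym derivative of [normal_prob] agrees almost everywhere with [normal_pdf], which
    moves integrals to the Lebesgue measure. *)
Lemma integral_normal_prob U f : measurable U ->
  measurable_fun U f -> (\int[nu]_(x in U) `|f x| < +oo)%E ->
  (\int[nu]_(x in U) f x = \int[mu]_(x in U) (f x * (normal_pdf 0 s x)%:E))%E.
Proof.
move=> mU mf finf.
rewrite -(Radon_Nikodym_change_of_variables (normal_prob_dominates 0 s))//=;
  last by apply/integrableP; split.
apply: ae_eq_integral => //.
- apply: emeasurable_funM => //; apply: (measurable_int mu).
  apply: (integrableS _ _ (@subsetT _ _)) => //=.
  by apply: Radon_Nikodym_integrable; exact: normal_prob_dominates.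
- apply: emeasurable_funM => //=; apply/measurableT_comp => //=.
  by apply/measurable_funTS; exact: measurable_normal_pdf.
- apply: ae_eqe_mul2l => /=.
  rewrite Radon_NikodymE//=; first exact: normal_prob_dominates.
  move=> dom; case: cid => /= h [h1 h2 h3].
  apply: integral_ae_eq => //=.
  + exact: integrableS h2.
  + by apply/measurable_funTS/measurableT_comp =>//; exact: measurable_normal_pdf.
  + by move=> E EU mE; rewrite -h3.
Qed.

Local Notation phi := (normal_pdf 0 s).

(** The antiderivative behind the variance: it turns the second moment over [J n] into [s ^+ 2]
    times the mass of [J n] and a boundary term. *)
Lemma derive_normal_pdf (x : R) :
  is_derive x 1 (fun y => - s ^+ 2 * (y * phi y)) ((x ^+ 2 - s ^+ 2) * phi x).
Proof.
rewrite normal_pdfE ?gt_eqF//.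
have s2 : s ^+ 2 *+ 2 != 0 by rewrite mulrn_eq0/= expf_neq0 ?gt_eqF.
have -> : (fun y => - s ^+ 2 * (y * (normal_peak s * normal_fun 0 s y))) =
    (- s ^+ 2 * normal_peak s) \*: (id * (expR \o
       (fun y => - (s ^+ 2 *+ 2)^-1 * y ^+ 2))) :> (R -> R).
  apply/funext => y /=; rewrite /normal_fun subr0 /GRing.scale/= fctE /=.
  have -> : - y ^+ 2 / (s ^+ 2 *+ 2) = - (s ^+ 2 *+ 2)^-1 * y ^+ 2 by ring.
  ring.
apply: is_derive_eq; rewrite /= /normal_fun subr0.
have -> : - x ^+ 2 / (s ^+ 2 *+ 2) = - (s ^+ 2 *+ 2)^-1 * x ^+ 2 by ring.
rewrite /GRing.scale/=.
have sn0 : s != 0 by rewrite gt_eqF.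
set e := expR _.
rewrite -mulr_natr.
by field.
Qed.

Local Notation J n := (`[(- n%:R)%R, n%:R%R]%classic : set R).

Lemma integral_sqr_normal_pdf (n : nat) : (0 < n)%N ->
  (\int[mu]_(x in J n) ((x ^+ 2) * phi x)%:E =
   (s ^+ 2)%:E * \int[mu]_(x in J n) (phi x)%:E
   - (2 * s ^+ 2 * (n%:R * phi n%:R))%:E)%E.
Proof.
move=> n0; have cphi : continuous phi by apply: continuous_normal_pdf; rewrite gt_eqF.
have cF : continuous (fun y : R => (y ^+ 2 - s ^+ 2) * phi y).
  move=> x; apply: cvgM; last exact: cphi.
  by apply: cvgB; [exact: exprn_continuous|exact: cvg_cst].
have cG : continuous (fun y : R => - s ^+ 2 * (y * phi y)).
  by move=> x; apply: cvgM; [exact: cvg_cst|apply: cvgM; [exact: cvg_id|exact: cphi]].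
have itg (g : R -> R) : continuous g ->
    mu.-integrable (J n) (EFin \o g).
  by move=> cg; apply: continuous_compact_integrable;
    [exact: segment_compact|exact: continuous_subspaceT].
have := @continuous_FTC2 R (fun y : R => (y ^+ 2 - s ^+ 2) * phi y)
   (fun y : R => - s ^+ 2 * (y * phi y)) (- n%:R) n%:R.
have nn : - n%:R < n%:R :> R by rewrite -subr_gt0 opprK addr_gt0 ?ltr0n.
have dF x := derive_normal_pdf x.
move=> /(_ nn (continuous_subspaceT cF)) => H.
have {}H : (\int[mu]_(x in J n) ((x ^+ 2 - s ^+ 2) * phi x)%:E =
   (- s ^+ 2 * (n%:R * phi n%:R))%:E - (- s ^+ 2 * (- n%:R * phi (- n%:R)))%:E)%E.
  apply: H.
    split => [x _||].
    - exact: ex_derive.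
    - by apply: cvg_at_right_filter; exact: cG.
    - by apply: cvg_at_left_filter; exact: cG.
  by move=> x _; rewrite derive1E derive_val.
have E2 : (\int[mu]_(x in J n) (x ^+ 2 * phi x)%:E =
   \int[mu]_(x in J n) ((x ^+ 2 - s ^+ 2) * phi x)%:E +
   (s ^+ 2)%:E * \int[mu]_(x in J n) (phi x)%:E)%E.
  rewrite -integralZl//; last exact: itg.
  rewrite -integralD//=; last 2 first.
  - exact: (itg _ cF).
  - by apply: integrableZl => //; exact: itg.
  by apply: eq_integral => x _; rewrite -EFinM -EFinD; congr EFin; ring.
rewrite E2 H addeC; congr (_ + _)%E; rewrite -EFinB -EFinN; congr EFin.
have -> : phi (- n%:R) = phi n%:R.
  by rewrite normal_pdfE ?gt_eqF// /normal_fun !subr0 sqrrN.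
ring.
Qed.

(** From 1 + y <= exp y with y = n^2 / (2 s^2), the factor exp (- y) is at most 2 s^2 / n^2, so that
    the sequence is at most [c] divided by n. *)
Lemma cvg_n_normal_pdf : n%:R * phi n%:R @[n --> \oo] --> (0 : R).
Proof.
pose c := normal_peak s * (2 * s ^+ 2).
have c0 : 0 <= c by rewrite mulr_ge0 ?normal_peak_ge0// mulr_ge0 ?sqr_ge0.
apply: (@squeeze_cvgr _ _ _ _ (fun=> 0) (fun n => c * n%:R^-1)); last 2 first.
- exact: cvg_cst.
- rewrite -[X in _ --> X](mulr0 c); apply: cvgM; first exact: cvg_cst.
  apply/gtr0_cvgV0; last by apply/cvgrnyP; exact: cvg_id.
  by exists 1%N => // k /=; rewrite ltr0n.
exists 1%N => // n /= n1; rewrite mulr_ge0 ?normal_pdf_ge0//=.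
rewrite normal_pdfE ?gt_eqF// /c -mulrA mulrCA ler_wpM2l ?normal_peak_ge0//.
rewrite /normal_fun subr0 mulNr expRN.
have n0 : (0 : R) < n%:R by rewrite ltr0n.
rewrite ler_pdivlMr// mulrAC -expr2 ler_pdivrMr ?expR_gt0//.
have s2 : 0 < s ^+ 2 *+ 2 by rewrite pmulrn_rgt0// exprn_gt0.
have := expR_ge1Dx (n%:R ^+ 2 / (s ^+ 2 *+ 2)).
rewrite -(ler_pM2l s2) mulrDr mulrCA divff ?gt_eqF// !mulr1 => h.
rewrite mulr_natl; apply: le_trans h; rewrite lerDr; exact: ltW.
Qed.

(** The truncated identity is followed along the intervals [J n]: monotone convergence gives the
    second moment on the left and total mass 1 on the right, while the boundary term vanishes. *)
Lemma normal_prob_second_moment : (\int[nu]_x (x ^+ 2)%:E = (s ^+ 2)%:E)%E.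
Proof.
have pdf0 x : (0 <= (phi x)%:E)%E by rewrite lee_fin normal_pdf_ge0.
have UT : \bigcup_n J n = setT.
  apply/seteqP; split => // x _; exists (Num.trunc `|x|).+1 => //=.
  by rewrite in_itv/= -ler_norml ltW// truncnS_gt.
have ndI : nondecreasing_seq (fun n => J n).
  move=> m n mn; rewrite subsetEset => x; rewrite /= !in_itv/= -!ler_norml.
  by move=> /le_trans; apply; rewrite ler_nat.
have L1 : (\int[nu]_(x in J n) (x ^+ 2)%:E @[n --> \oo] -->
           \int[nu]_x (x ^+ 2)%:E)%E.
  rewrite -UT; apply: ge0_nondecreasing_set_cvg_integral => //.
  - by move=> i; apply/measurable_EFinP/measurable_funTS; exact: measurable_funX.
  - by move=> i x _; rewrite lee_fin sqr_ge0.
have L2 : ((s ^+ 2)%:E * (\int[mu]_(x in J n) (phi x)%:E)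
   - (2 * s ^+ 2 * (n%:R * phi n%:R))%:E @[n --> \oo] --> (s ^+ 2)%:E)%E.
  rewrite -[X in _ --> X]sube0 -[X in _ --> (X - _)%E]mule1; apply: cvgeB => //.
  - apply: cvgeM => //; first exact: cvg_cst.
    rewrite -(integral_normal_pdf 0 s) -UT.
    apply: ge0_nondecreasing_set_cvg_integral => //.
    move=> i; apply/measurable_EFinP/measurable_funTS.
    exact: measurable_normal_pdf.
  - apply: cvg_EFin; first exact: nearW.
    rewrite -[X in _ --> X](mulr0 (2 * s ^+ 2)).
    by apply: cvgM; [exact: cvg_cst|exact: cvg_n_normal_pdf].
have E n : (0 < n)%N -> (\int[nu]_(x in J n) (x ^+ 2)%:E =
   (s ^+ 2)%:E * \int[mu]_(x in J n) (phi x)%:E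
   - (2 * s ^+ 2 * (n%:R * phi n%:R))%:E)%E.
  move=> n0; rewrite -integral_sqr_normal_pdf// integral_normal_prob//.
    by apply/measurable_EFinP/measurable_funTS; exact: measurable_funX.
  apply: (@le_lt_trans _ _ (\int[nu]_(x in J n) (n%:R ^+ 2)%:E)%E).
    apply: ge0_le_integral => //.
    - by apply: measurableT_comp => //; apply/measurable_EFinP/measurable_funTS;
        exact: measurable_funX.
    - move=> x; rewrite /= in_itv/= -ler_norml => xn.
      by rewrite lee_fin ger0_norm ?sqr_ge0// -real_normK ?num_real// lerXn2r// nnegrE.
  rewrite integral_cst//; apply: lte_mul_pinfty; rewrite ?lee_fin ?sqr_ge0//.
  by rewrite (le_lt_trans (probability_le1 _ _))// ltry.
apply: cvg_unique L1 _ => //.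
apply: cvg_trans L2; apply: near_eq_cvg; near=> n.
rewrite E//; near: n; exact: nbhs_infty_gt.
Unshelve. all: by end_near.
Qed.

Lemma normal_prob_oppr (A : set R) : measurable A -> nu (-%R @^-1` A) = nu A.
Proof.
move=> mA; rewrite /normal_prob.
transitivity (\int[pushforward mu (-%R : _ -> measurableTypeR R)]_(x in A) (phi x)%:E)%E.
  rewrite ge0_integral_pushforward//=; last 2 first.
  - by apply/measurable_EFinP/measurable_funTS; exact: measurable_normal_pdf.
  - by move=> x _; rewrite lee_fin normal_pdf_ge0.
  apply: eq_integral => x _ /=; congr EFin.
  by rewrite normal_pdfE ?gt_eqF// /normal_fun !subr0 sqrrN.
by apply: eq_measure_integral => B mB _; exact: lebesgue_measureN.
Qed.

Lemma integrable_normal_prob_sqr : nu.-integrable setT (fun x => (x ^+ 2)%:E).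
Proof.
apply/integrableP; split; first by apply/measurable_EFinP; exact: measurable_funX.
under eq_integral do rewrite gee0_abs ?lee_fin ?sqr_ge0//.
by rewrite normal_prob_second_moment ltry.
Qed.

Lemma integrable_normal_prob_id : nu.-integrable setT (fun x => x%:E).
Proof.
apply: (le_integrable measurableT
  (g := (fun x => (1 + x ^+ 2)%:E) : measurableTypeR R -> \bar R)).
- exact/measurable_EFinP.
- move=> x _ /=; rewrite lee_fin [leRHS]ger0_norm; last first.
    by rewrite addr_ge0 ?sqr_ge0.
  rewrite -real_normK ?num_real//; have := sqr_ge0 (`|x| - 1).
  by rewrite sqrrB mulr1 expr1n; have := normr_ge0 x; lra.
- have i1 := finite_measure_integrable_cst nu 1 measurableT.
  have := integrableD measurableT i1 integrable_normal_prob_sqr.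
  by apply: eq_integrable.
Qed.

(** The law is symmetric, so the mean equals its opposite; integrability of the identity makes the
    change of variables legitimate. *)
Lemma normal_prob_mean : \int[nu]_x x = 0.
Proof.
have i1 := integrable_normal_prob_id.
suff : \int[nu]_x x = - \int[nu]_x x by lra.
rewrite -[in RHS]mulN1r -RintegralZl// /Rintegral; congr fine.
transitivity (\int[pushforward nu (-%R : _ -> measurableTypeR R)]_x x%:E)%E.
  by apply: eq_measure_integral => A mA _; exact: esym (normal_prob_oppr mA).
rewrite integral_pushforward//=.
- by apply: eq_integral => x _ /=; rewrite mulN1r.
have := integrableZl measurableT (-1) i1.
by rewrite preimage_setT; apply: eq_integrable => // x _ /=; rewrite -EFinM mulN1r.
Qed.

End normal_moments.

(** * Square-integrable functions and the Cauchy-Schwarz inequality *)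

Section square_integrable_functions.
Context d (T : measurableType d) (R : realType).
Variables (mu : {measure set T -> \bar R}) (D : set T).
Hypothesis mD : measurable D.
Implicit Types f g : T -> R.

(** Measurability of [f] is a separate clause since it does not follow from that of its square. The
    same notion serves for [P] on the sample space and for the Lebesgue measure on time
    intervals. *)
Definition sqintegrable f : Prop :=
  measurable_fun D f /\ mu.-integrable D (fun x => (f x ^+ 2)%:E).

Lemma sqintegrable_mul f g : sqintegrable f -> sqintegrable g ->
  mu.-integrable D (fun x => (f x * g x)%:E).
Proof.
move=> [mf if2] [mg ig2].
apply: (@le_integrable _ _ _ _ _ mD _
    ((fun x => (f x ^+ 2)%:E) \+ (fun x => (g x ^+ 2)%:E))%E).
- exact/measurable_EFinP/measurable_funM.
- move=> x Dx /=; rewrite lee_fin.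
  rewrite [leRHS]ger0_norm ?addr_ge0 ?sqr_ge0// normrM.
  have := sqr_ge0 (`|f x| - `|g x|); rewrite sqrrB !real_normK ?num_real//.
  have := sqr_ge0 (f x); have := sqr_ge0 (g x).
  set a := `|f x| * `|g x|; have : 0 <= a by rewrite mulr_ge0.
  lra.
- exact: integrableD.
Qed.

Lemma sqintegrableZ (a : R) f :
  sqintegrable f -> sqintegrable (fun x => a * f x).
Proof.
move=> [mf if2]; split; first exact: measurable_funM.
apply: (eq_integrable mD (fun x => (a ^+ 2)%:E * (f x ^+ 2)%:E)%E).
  by move=> x _; rewrite -EFinM exprMn.
exact: integrableZl.
Qed.

Lemma sqintegrableD f g : sqintegrable f -> sqintegrable g ->
  sqintegrable (fun x => f x + g x).
Proof.
move=> sf sg; split; first by apply: measurable_funD; [case: sf|case: sg].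
apply: (eq_integrable mD ((fun x => (f x ^+ 2)%:E) \+
    ((fun x => (f x * g x)%:E) \+ (fun x => (f x * g x)%:E)) \+
    (fun x => (g x ^+ 2)%:E))%E).
  by move=> x _ /=; rewrite -!EFinD; congr EFin; ring.
have ifg := sqintegrable_mul sf sg.
apply: integrableD => //; last by case: sg.
apply: integrableD => //; first by case: sf.
exact: integrableD.
Qed.

Lemma sqintegrableB f g : sqintegrable f -> sqintegrable g ->
  sqintegrable (fun x => f x - g x).
Proof.
move=> sf sg; have := sqintegrableD sf (sqintegrableZ (-1) sg).
by under eq_fun do rewrite mulN1r.
Qed.

Lemma sqintegrable0 : sqintegrable (fun=> 0).
Proof. by split => //; under eq_fun do rewrite expr0n/=; exact: integrable0. Qed.

Lemma sqintegrable_sum (I : Type) (s : seq I) (f : I -> T -> R) :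
  (forall i, sqintegrable (f i)) -> sqintegrable (fun x => \sum_(i <- s) f i x).
Proof.
move=> sf; elim: s => [|i s IH].
  by under eq_fun do rewrite big_nil; exact: sqintegrable0.
by under eq_fun do rewrite big_cons; exact: sqintegrableD.
Qed.

Lemma sqintegrable_bounded_mul (c : R) f g : measurable_fun D g ->
  (forall x, D x -> `|g x| <= c) -> sqintegrable f ->
  sqintegrable (fun x => g x * f x).
Proof.
move=> mg gc [mf if2]; split; first exact: measurable_funM.
apply: (le_integrable mD (g := fun x => (c ^+ 2)%:E * (f x ^+ 2)%:E)%E).
- by apply/measurable_EFinP/measurable_funX/measurable_funM.
- move=> x Dx; rewrite -EFinM !abse_EFin lee_fin exprMn.
  rewrite !ger0_norm; do ?[exact: mulr_ge0 (sqr_ge0 _) (sqr_ge0 _)].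
  rewrite ler_wpM2r ?sqr_ge0//.
  have c0 : 0 <= c := le_trans (normr_ge0 _) (gc _ Dx).
  by rewrite -(real_normK (num_real (g x))) lerXn2r ?nnegrE ?gc.
- exact: (integrableZl mD (c ^+ 2) if2).
Qed.

Lemma Rintegral_sum (I : Type) (s : seq I) (f : I -> T -> R) :
  (forall i, mu.-integrable D (EFin \o f i)) ->
  \int[mu]_(x in D) (\sum_(i <- s) f i x) =
  \sum_(i <- s) \int[mu]_(x in D) f i x.
Proof.
move=> intf; elim: s => [|i s IH].
  under eq_Rintegral do rewrite big_nil.
  by rewrite big_nil /Rintegral integral0.
under eq_Rintegral do rewrite big_cons.
rewrite big_cons RintegralD// ?IH//.
apply: (eq_integrable mD (fun x => \sum_(i <- s) (f i x)%:E)%E).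
  by move=> x _; rewrite /= sumEFin.
by apply: (integrable_sum mD s (P := xpredT) (h := fun i => EFin \o f i)) => k _; exact: intf.
Qed.

(** The integral of (f + t g)^2 is a nonnegative quadratic in t. For V > 0 it is evaluated at its
    minimum - W / V; for V = 0 it is affine, and unless W = 0 the choice t = - (U + 1) / (2 W) would
    make it - 1. *)
Lemma cauchy_schwarz_Rintegral f g : sqintegrable f -> sqintegrable g ->
  (\int[mu]_(x in D) (f x * g x)) ^+ 2 <=
  \int[mu]_(x in D) (f x ^+ 2) * \int[mu]_(x in D) (g x ^+ 2).
Proof.
move=> sf sg; set W := (X in X ^+ 2 <= _); set U := (X in _ <= X * _).
set V := (X in _ <= _ * X).
have Q (t : R) : 0 <= U + (2 * t) * W + t ^+ 2 * V.
  have : 0 <= \int[mu]_(x in D) ((f x + t * g x) ^+ 2).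
    by apply: Rintegral_ge0 => x _; exact: sqr_ge0.
  under eq_Rintegral.
    move=> x _; have -> : (f x + t * g x) ^+ 2 =
      f x ^+ 2 + (2 * t) * (f x * g x) + t ^+ 2 * g x ^+ 2 by ring.
    over.
  have i1 : mu.-integrable D (EFin \o (fun x => (2 * t) * (f x * g x))).
    exact: (integrableZl mD (2 * t) (sqintegrable_mul sf sg)).
  have i2 : mu.-integrable D (EFin \o (fun x => t ^+ 2 * g x ^+ 2)).
    by case: sg => _ ig; exact: (integrableZl mD (t ^+ 2) ig).
  have i0 : mu.-integrable D (EFin \o (fun x => f x ^+ 2)) by case: sf.
  rewrite RintegralD//; last exact: (integrableD mD i0 i1).
  rewrite RintegralD// !RintegralZl//; first by case: sg.
  exact: (sqintegrable_mul sf sg).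
have V0 : 0 <= V by apply: Rintegral_ge0 => x _; exact: sqr_ge0.
have [V00|Vn0] := eqVneq V 0; last first.
  have := Q (- W / V); have Vp : 0 < V by rewrite lt_neqAle eq_sym Vn0.
  have -> : U + 2 * (- W / V) * W + (- W / V) ^+ 2 * V = U - W ^+ 2 / V by field.
  by rewrite subr_ge0 ler_pdivrMr.
rewrite V00 mulr0; have [->|Wn0] := eqVneq W 0; first by rewrite expr0n.
have := Q (- (U + 1) / (2 * W)); rewrite V00.
have -> : U + 2 * (- (U + 1) / (2 * W)) * W + (- (U + 1) / (2 * W)) ^+ 2 * 0 = -1.
  by field.
by lra.
Qed.

(** The error splits as (f_n - f) g + (g_n - g) f + (f_n - f) (g_n - g). Cauchy-Schwarz bounds each
    term by the fixed norms of f and g and the norms of the differences. *)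
Lemma cvg_Rintegral_mul (f_ g_ : nat -> T -> R) f g :
  (forall n, sqintegrable (f_ n)) -> (forall n, sqintegrable (g_ n)) ->
  sqintegrable f -> sqintegrable g ->
  \int[mu]_(x in D) ((f_ n x - f x) ^+ 2) @[n --> \oo] --> 0 ->
  \int[mu]_(x in D) ((g_ n x - g x) ^+ 2) @[n --> \oo] --> 0 ->
  \int[mu]_(x in D) (f_ n x * g_ n x) @[n --> \oo] -->
  \int[mu]_(x in D) (f x * g x).
Proof.
move=> sf_ sg_ sf sg F G.
have sqrt0 (a_ : nat -> R) (c : R) : a_ n @[n --> \oo] --> 0 ->
    Num.sqrt (a_ n * c) @[n --> \oo] --> (0 : R).
  move=> a0; rewrite -[X in _ --> X](sqrtr0 R); apply: continuous_cvg.
    exact: sqrt_continuous.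
  by rewrite -[X in _ --> X](mul0r c); apply: cvgM => //; exact: cvg_cst.
have CS u v : sqintegrable u -> sqintegrable v ->
    `|\int[mu]_(x in D) (u x * v x)| <=
    Num.sqrt (\int[mu]_(x in D) (u x ^+ 2) * \int[mu]_(x in D) (v x ^+ 2)).
  by move=> su sv; rewrite -sqrtr_sqr ler_wsqrtr// cauchy_schwarz_Rintegral.
pose A n := \int[mu]_(x in D) ((f_ n x - f x) ^+ 2).
pose C n := \int[mu]_(x in D) ((g_ n x - g x) ^+ 2).
apply/cvgrPdist_le => e e0.
have H : Num.sqrt (A n * \int[mu]_(x in D) (g x ^+ 2)) +
   Num.sqrt (C n * \int[mu]_(x in D) (f x ^+ 2)) +
   Num.sqrt (A n * C n) @[n --> \oo] --> (0 : R).
  rewrite -[X in _ --> X]addr0 -[X in _ --> X + _]addr0.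
  apply: cvgD; first by apply: cvgD; exact: sqrt0.
  rewrite -[X in _ --> X](sqrtr0 R); apply: continuous_cvg.
    exact: sqrt_continuous.
  by rewrite -[X in _ --> X](mulr0 0); exact: cvgM.
move/cvgrPdist_le : H => /(_ _ e0); apply: filterS => n.
rewrite sub0r normrN => /(le_trans (ler_norm _)); apply: le_trans.
have sF := sqintegrableB (sf_ n) sf; have sG := sqintegrableB (sg_ n) sg.
rewrite distrC -RintegralB//; [|exact: sqintegrable_mul..].
under eq_Rintegral.
  move=> x _; have -> : f_ n x * g_ n x - f x * g x =
    (f_ n x - f x) * g x + (g_ n x - g x) * f x +
    (f_ n x - f x) * (g_ n x - g x) by ring.
  over.
have i1 := sqintegrable_mul sF sg; have i2 := sqintegrable_mul sG sf.
have i3 := sqintegrable_mul sF sG.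
rewrite RintegralD//; last exact: (integrableD mD i1 i2).
rewrite RintegralD//.
apply: le_trans (ler_normD _ _) _; apply: lerD; last exact: CS.
by apply: le_trans (ler_normD _ _) _; apply: lerD; exact: CS.
Qed.

End square_integrable_functions.

(** * Independence tested on rectangles *)

Section independence.
Context d1 d2 (T1 : measurableType d1) (T2 : measurableType d2).
Context d (Omega : measurableType d) (R : realType).
Variable P : probability Omega R.
Variables (X : Omega -> T1) (Z : Omega -> T2).
Hypotheses (mX : measurable_fun setT X) (mZ : measurable_fun setT Z).
Variable nu : probability T2 R.

Let XM := isMeasurableFun.Build _ _ _ _ X mX.
Let X' : {mfun Omega >-> T1} := HB.pack X XM.
Let mXZ : measurable_fun setT (fun w => (X w, Z w)).
Proof. exact/measurable_fun_pair. Qed.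
Let XZM := isMeasurableFun.Build _ _ _ _ _ mXZ.
Let XZ : {mfun Omega >-> (T1 * T2)%type} := HB.pack (fun w => (X w, Z w)) XZM.

Hypothesis XZ_indep : forall U V, measurable U -> measurable V ->
  P (X @^-1` U `&` Z @^-1` V) = (P (X @^-1` U) * nu V)%E.

(** Rectangles determine the joint law, by uniqueness of the product measure. The independence
    hypothesis with [U] the whole space also identifies [nu] as the law of [Z]. *)
Lemma joint_law (C : set (T1 * T2)) : measurable C ->
  (distribution P X' \x nu)%E C = P ((fun w => (X w, Z w)) @^-1` C).
Proof.
move=> mC.
rewrite (@product_measure_unique _ _ _ _ _ _ _ (distribution P XZ))//.
Qed.

(** Restricted to [E] and divided by [c], the law of the pair is still the product measure on
    rectangles, hence everywhere; for [c = 0] the event [E] is null. This upgrades the independence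
    of three variables, known on boxes, to independence of a pair from the third. *)
Lemma independent_of_rectangles (E : set Omega) (c : R) : measurable E -> 0 <= c ->
  (forall U V, measurable U -> measurable V ->
    P (X @^-1` U `&` Z @^-1` V `&` E) = (P (X @^-1` U) * nu V * c%:E)%E) ->
  forall C, measurable C ->
    P ((fun w => (X w, Z w)) @^-1` C `&` E) =
    (P ((fun w => (X w, Z w)) @^-1` C) * c%:E)%E.
Proof.
move=> mE c0 H C mC.
have mC' : measurable ((fun w => (X w, Z w)) @^-1` C).
  by rewrite -[X in measurable X]setTI; exact: mXZ.
have [c00|cn0] := eqVneq c 0.
  rewrite c00 mule0; apply/eqP; rewrite -measure_le0.
  have PE : P E = 0%E.
    have := H setT setT measurableT measurableT.
    by rewrite !preimage_setT !setTI c00 mule0.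
  by rewrite -PE le_measure// ?inE//; exact: measurableI.
pose k : {nonneg R} := NngNum (ltac:(rewrite invr_ge0; exact: c0) : 0 <= c^-1).
pose m' := mscale k (measure_function_pushforward__canonical__measure_function_Measure
  (mrestr P mE) mXZ).
have -> : P ((fun w => (X w, Z w)) @^-1` C `&` E) = (c%:E * m' C)%E.
  by rewrite /m' /mscale/= muleA -EFinM mulfV// mul1e.
have <- : (distribution P X' \x nu)%E C = m' C; last by rewrite joint_law// muleC.
apply: product_measure_unique => //.
move=> A B mA mB.
transitivity ((c^-1)%:E * P (X @^-1` A `&` Z @^-1` B `&` E))%E; first by [].
by rewrite H// muleC -muleA -EFinM mulfV// mule1.
Qed.

Lemma integrable_indep_mul (f : T1 -> R) (g : T2 -> R) :
  measurable_fun setT f -> measurable_fun setT g ->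
  P.-integrable setT (EFin \o (f \o X)) -> nu.-integrable setT (EFin \o g) ->
  P.-integrable setT (fun w => (f (X w) * g (Z w))%:E).
Proof.
move=> mf mg ifX ig.
have ifd : (distribution P X').-integrable setT (EFin \o f).
  apply: integrable_pushforward => //; exact/measurable_EFinP.
have mfg : measurable_fun setT (fun z : T1 * T2 => f z.1 * g z.2).
  apply: measurable_funM; first exact: measurableT_comp mf measurable_fst.
  exact: measurableT_comp mg measurable_snd.
apply/integrableP; split.
  apply/measurable_EFinP/measurable_funM; first exact: measurableT_comp.
  exact: measurableT_comp.
have E1 : (\int[P]_w `|(f (X w) * g (Z w))%:E| =
    \int[distribution P X' \x nu]_z `|(f z.1 * g z.2)%:E|)%E.
  rewrite (eq_measure_integral (distribution P XZ)); last first.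
    by move=> A mA _; exact: joint_law.
  rewrite ge0_integral_distribution//.
  by apply/measurable_EFinP; exact: measurableT_comp.
rewrite E1 fubini_tonelli1//=; last first.
  by apply/measurable_EFinP; exact: measurableT_comp.
rewrite /fubini_F/=.
have ag0 y : (0 <= `|(g y)%:E|)%E by [].
under eq_integral.
  move=> x _; under eq_integral do rewrite normrM EFinM.
  rewrite ge0_integralZl//; last first.
    by apply/measurable_EFinP; exact: measurableT_comp.
  over.
move/integrableP : ig => [_ ig]; move/integrableP : ifd => [_ ifd].
rewrite ge0_integralZr//; last 2 first.
- by apply/measurable_EFinP; exact: measurableT_comp.
- exact: integral_ge0.
apply: lte_mul_pinfty => //; first exact: integral_ge0.
rewrite ge0_fin_numE//; exact: integral_ge0.
Qed.

Lemma Rintegral_indep_mul (f : T1 -> R) (g : T2 -> R) :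
  measurable_fun setT f -> measurable_fun setT g ->
  P.-integrable setT (EFin \o (f \o X)) -> nu.-integrable setT (EFin \o g) ->
  \int[P]_w (f (X w) * g (Z w)) = \int[P]_w f (X w) * \int[nu]_y g y.
Proof.
move=> mf mg ifX ig.
have ifd : (distribution P X').-integrable setT (EFin \o f).
  apply: integrable_pushforward => //; exact/measurable_EFinP.
have mfg : measurable_fun setT (fun z : T1 * T2 => f z.1 * g z.2).
  apply: measurable_funM; first exact: measurableT_comp mf measurable_fst.
  exact: measurableT_comp mg measurable_snd.
have ifg : (distribution P XZ).-integrable setT (fun z => (f z.1 * g z.2)%:E).
  apply: integrable_pushforward => //; first exact/measurable_EFinP.
  exact: integrable_indep_mul.
have ifg' : (distribution P X' \x nu)%E.-integrable setT (fun z => (f z.1 * g z.2)%:E).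
  move/integrableP : ifg => [m lt]; apply/integrableP; split => //.
  rewrite (eq_measure_integral (distribution P XZ))// => A mA _.
  exact: joint_law.
rewrite /Rintegral.
have -> : (\int[P]_w (f (X w) * g (Z w))%:E =
    \int[distribution P X' \x nu]_z (f z.1 * g z.2)%:E)%E.
  rewrite (eq_measure_integral (distribution P XZ)); last first.
    by move=> A mA _; exact: joint_law.
  rewrite integral_distribution//; first exact/measurable_EFinP.
  exact: integrable_indep_mul.
rewrite -integral12_prod_meas1// /fubini_F/=.
have igf : (\int[nu]_y (g y)%:E)%E \is a fin_num by exact: integrable_fin_num.
under eq_integral.
  move=> x _; under eq_integral do rewrite EFinM.
  rewrite integralZl//; over.
rewrite -(fineK igf) integralZr//.
have -> : (\int[distribution P X']_x (f x)%:E = \int[P]_w (f (X w))%:E)%E.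
  rewrite integral_distribution//; exact/measurable_EFinP.
by rewrite fineM//; exact: integrable_fin_num.
Qed.

End independence.

(** * Expectations of Brownian increments *)

Section brownian_increments.
Context {R : realType} {disp : measure_display} {Omega : measurableType disp}.
Variables (P : probability Omega R) (G : R -> set (set Omega)).
Variables (n : nat) (B : 'I_n -> R -> Omega -> R).
Hypothesis GP : usual_conditions P G.

(** Phrased as measurability for the sigma-algebra generated by [G t], so that sums, products and
    limits are covered by general measurability facts. Under [usual_conditions] and for nonnegative
    [t] the generated sigma-algebra is [G t] itself. *)
Definition adapted_at (t : R) (X : Omega -> R) : Prop :=
  @measurable_fun _ _ (g_sigma_algebraType (G t)) R setT X.

Lemma filtration_sigma_algebra t : 0 <= t -> sigma_algebra setT (G t).
Proof. by case: GP => + _ _ _ t0 => /(_ t t0)[]. Qed.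

Lemma filtration_measurable t A : 0 <= t -> G t A -> measurable A.
Proof. by case: GP => + _ _ _ t0 => /(_ t t0)[_ ] GM /GM. Qed.

Lemma filtration_le s t A : 0 <= s -> s <= t -> G s A -> G t A.
Proof. by case: GP => _ + _ _ s0 st => /(_ s t s0 st)/[apply]. Qed.

Lemma measurable_filtration t (A : set Omega) : 0 <= t ->
  (G t).-sigma.-measurable A = G t A.
Proof.
move=> t0; rewrite measurable_g_measurableTypeE//.
exact: filtration_sigma_algebra.
Qed.

Lemma adapted_atP t X : 0 <= t ->
  adapted_at t X <-> (forall U, measurable U -> G t (X @^-1` U)).
Proof.
move=> t0; split => [mX U mU|H _ U mU].
  by rewrite -measurable_filtration// -[X in measurable X]setTI; exact: mX.
by rewrite setTI measurable_filtration//; exact: H.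
Qed.

Lemma adapted_at_measurable t X : 0 <= t -> adapted_at t X ->
  measurable_fun setT X.
Proof.
move=> t0 /(adapted_atP _ t0) H _ U mU; rewrite setTI.
exact: filtration_measurable t0 (H _ mU).
Qed.

Lemma adapted_at_le s t X : 0 <= s -> s <= t -> adapted_at s X -> adapted_at t X.
Proof.
move=> s0 st /(adapted_atP _ s0) H; apply/adapted_atP; first exact: le_trans st.
by move=> U mU; apply: filtration_le (H _ mU).
Qed.

Lemma adapted_at_indic t A : 0 <= t -> G t A -> adapted_at t (\1_A).
Proof.
by move=> t0 GA; apply: measurable_indic; rewrite measurable_filtration.
Qed.

Hypothesis BP : brownian_motion P G B.

Lemma brownian_adapted_at j t : 0 <= t -> adapted_at t (B j t).
Proof.
case: BP => _ + _ _ t0 => /(_ j t) H; apply/adapted_atP => // U mU.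
by apply: H => //=; rewrite in_itv/= t0.
Qed.

Lemma brownian_increment_adapted_at j s t : 0 <= s -> s <= t ->
  adapted_at t (fun w => B j t w - B j s w).
Proof.
move=> s0 st; have t0 := le_trans s0 st; apply: measurable_funB.
  exact: brownian_adapted_at.
by apply: adapted_at_le st _ => //; exact: brownian_adapted_at.
Qed.

Local Notation law s t := (normal_prob 0 (Num.sqrt (t - s))).

(** The product formula of [brownian_motion], with the whole line for every component other than
    [j], each contributing mass 1. *)
Lemma brownian_increment_indep j s t X (U V : set R) : 0 <= s -> s < t ->
  adapted_at s X -> measurable U -> measurable V ->
  P (X @^-1` U `&` (fun w => B j t w - B j s w) @^-1` V) =
  (P (X @^-1` U) * law s t V)%E.
Proof.
move=> s0 st /(adapted_atP _ s0) aX mU mV.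
case: BP => _ _ _ /(_ s t s0 st _ (aX _ mU) (fun k => if k == j then V else setT)).
rewrite (bigD1 j)//= eqxx big1 ?mule1; last first.
  by move=> k /negPf->; rewrite -[LHS]/(normal_prob _ _ _) probability_setT.
move=> <-; last by move=> k; case: ifP.
congr (P _); apply/seteqP; split => w /= [Uw].
  by move=> Vw; split => // k; case: ifPn => // /eqP ->.
by move=> /(_ j); rewrite eqxx.
Qed.

Lemma brownian_increment_indep2 i j s t X (U V V' : set R) : i != j ->
  0 <= s -> s < t -> adapted_at s X ->
  measurable U -> measurable V -> measurable V' ->
  P (X @^-1` U `&` (fun w => B i t w - B i s w) @^-1` V `&`
     (fun w => B j t w - B j s w) @^-1` V') =
  (P (X @^-1` U) * law s t V * law s t V')%E.
Proof.
move=> ij s0 st /(adapted_atP _ s0) aX mU mV mV'.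
case: BP => _ _ _ /(_ s t s0 st _ (aX _ mU)
  (fun k => if k == i then V else if k == j then V' else setT)).
rewrite (bigD1 i)//= eqxx (bigD1 j)/= ?(eq_sym j)// (negPf ij) eqxx.
rewrite big1 ?mule1; last first.
  by move=> k /andP[/negPf-> /negPf->]; rewrite probability_setT.
rewrite muleA.
move=> <-; last by move=> k; case: ifP => //; case: ifP.
congr (P _); apply/seteqP; split => w /=.
  move=> [[Uw Vw] Vw']; split => // k.
  by case: ifPn => [/eqP ->//|_]; case: ifPn => // /eqP ->.
move=> [Uw H]; split; first by split => //; have := H i; rewrite eqxx.
by have := H j; rewrite eq_sym (negPf ij) eqxx.
Qed.

Lemma sqrt_gap (s t : R) : s < t ->
  0 < Num.sqrt (t - s) /\ Num.sqrt (t - s) ^+ 2 = t - s.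
Proof. by move=> st; rewrite sqrtr_gt0 sqr_sqrtr ?subr_gt0 ?subr_ge0// ltW. Qed.

(** Equal times are treated apart here and in the next lemmas, since the law of an increment is
    prescribed for [s < t] only. *)
Lemma integrable_mul_increment_sqr j s t X : 0 <= s -> s <= t ->
  adapted_at s X -> P.-integrable setT (EFin \o X) ->
  P.-integrable setT (fun w => (X w * (B j t w - B j s w) ^+ 2)%:E).
Proof.
move=> s0; rewrite le_eqVlt => /orP[/eqP <- _ _|st aX iX].
  by under eq_fun do rewrite subrr expr0n mulr0; exact: integrable0.
have [ss ssq] := sqrt_gap st.
apply: (@integrable_indep_mul _ _ R (measurableTypeR R) _ _ _ P X
  (fun w => B j t w - B j s w) _ _ (law s t) _ id (fun x => x ^+ 2)) => //.
- exact: adapted_at_measurable aX.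
- by apply: adapted_at_measurable (le_trans s0 (ltW st)) _;
    apply: brownian_increment_adapted_at => //; exact: ltW.
- by move=> U V mU mV; exact: brownian_increment_indep.
- exact: (integrable_normal_prob_sqr ss).
Qed.

Lemma expectation_mul_increment_sqr j s t X : 0 <= s -> s <= t ->
  adapted_at s X -> P.-integrable setT (EFin \o X) ->
  \int[P]_w (X w * (B j t w - B j s w) ^+ 2) = (\int[P]_w X w) * (t - s).
Proof.
move=> s0; rewrite le_eqVlt => /orP[/eqP <- _ _|st aX iX].
  under eq_Rintegral do rewrite subrr expr0n mulr0.
  by rewrite subrr mulr0 /Rintegral integral0.
have [ss ssq] := sqrt_gap st.
rewrite (@Rintegral_indep_mul _ _ R (measurableTypeR R) _ _ _ P X (fun w => B j t w - B j s w)
  _ _ (law s t) _ id (fun x => x ^+ 2))//.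
- by rewrite /Rintegral normal_prob_second_moment//= ssq.
- exact: adapted_at_measurable aX.
- by apply: adapted_at_measurable (le_trans s0 (ltW st)) _;
    apply: brownian_increment_adapted_at => //; exact: ltW.
- by move=> U V mU mV; exact: brownian_increment_indep.
- exact: (integrable_normal_prob_sqr ss).
Qed.

Lemma expectation_mul_increment j s t X : 0 <= s -> s <= t ->
  adapted_at s X -> P.-integrable setT (EFin \o X) ->
  \int[P]_w (X w * (B j t w - B j s w)) = 0.
Proof.
move=> s0; rewrite le_eqVlt => /orP[/eqP <- _ _|st aX iX].
  under eq_Rintegral do rewrite subrr mulr0.
  by rewrite /Rintegral integral0.
have [ss ssq] := sqrt_gap st.
rewrite (@Rintegral_indep_mul _ _ R (measurableTypeR R) _ _ _ P X (fun w => B j t w - B j s w)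
  _ _ (law s t) _ id id)//.
- by rewrite normal_prob_mean// mulr0.
- exact: adapted_at_measurable aX.
- by apply: adapted_at_measurable (le_trans s0 (ltW st)) _;
    apply: brownian_increment_adapted_at => //; exact: ltW.
- by move=> U V mU mV; exact: brownian_increment_indep.
- exact: (integrable_normal_prob_id ss).
Qed.

(** The pair formed by [X] and the increment of [B i] is independent of the increment of [B j],
    whose mean is zero. The hypothesis speaks of boxes only; [independent_of_rectangles] extends it
    to all measurable sets of values of the pair. *)
Lemma expectation_mul_increment2 i j s t X : i != j -> 0 <= s -> s <= t ->
  adapted_at s X -> P.-integrable setT (EFin \o X) ->
  \int[P]_w (X w * (B i t w - B i s w) * (B j t w - B j s w)) = 0.
Proof.
move=> ij s0; rewrite le_eqVlt => /orP[/eqP <- _ _|st aX iX].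
  under eq_Rintegral do rewrite subrr mulr0 mul0r.
  by rewrite /Rintegral integral0.
have [ss ssq] := sqrt_gap st.
have mX := adapted_at_measurable s0 aX.
have mB k : measurable_fun setT (fun w => B k t w - B k s w).
  by apply: adapted_at_measurable (le_trans s0 (ltW st)) _;
    apply: brownian_increment_adapted_at => //; exact: ltW.
rewrite (@Rintegral_indep_mul _ _ (R * measurableTypeR R)%type (measurableTypeR R) _ _ _ P
   (fun w => (X w, B i t w - B i s w)) (fun w => B j t w - B j s w)
  _ _ (law s t) _ (fun z => z.1 * z.2) id)//.
- by rewrite normal_prob_mean// mulr0.
- exact: (measurable_fun_pair mX (mB i)).
- exact: mB.
- move=> C V mC mV.
  transitivity (P ((fun w => (X w, (B i t w - B i s w)%R)) @^-1` C) *
    (fine (law s t V))%:E)%E; last by rewrite fineK// fin_num_measure.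
  apply: (@independent_of_rectangles _ _ R (measurableTypeR R) _ _ _ _ _ _ _ _ (law s t)) => //.
  + exact: mB.
  + by move=> U V1 mU mV1; exact: brownian_increment_indep.
  + by rewrite -[X in measurable X]setTI; exact: mB.
  + exact: fine_ge0.
  + move=> U V1 mU mV1; rewrite fineK ?fin_num_measure//.
    exact: brownian_increment_indep2.
- by apply: measurable_funM; [exact: measurable_fst|exact: measurable_snd].
- apply: (@integrable_indep_mul _ _ R (measurableTypeR R) _ _ _ P X (fun w => B i t w - B i s w)
    _ _ (law s t) _ id id) => //.
  + exact: mB.
  + by move=> U V mU mV; exact: brownian_increment_indep.
  + exact: (integrable_normal_prob_id ss).
- exact: (integrable_normal_prob_id ss).
Qed.

End brownian_increments.

(** * Covariances of weighted increments *)

Section elementary_integrals.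
Context {R : realType} {disp : measure_display} {Omega : measurableType disp}.
Variables (P : probability Omega R) (G : R -> set (set Omega)).
Variables (n : nat) (B : 'I_n -> R -> Omega -> R).
Hypothesis GP : usual_conditions P G.
Hypothesis BP : brownian_motion P G B.

Local Notation L2 := (sqintegrable P setT).
Local Notation mu := (@lebesgue_measure R).

Definition bounded_rv (X : Omega -> R) : Prop :=
  exists c : R, forall w, `|X w| <= c.

Lemma bounded_rvM X Y : bounded_rv X -> bounded_rv Y ->
  bounded_rv (fun w => X w * Y w).
Proof.
move=> [c Xc] [c' Yc]; exists (c * c') => w; rewrite normrM.
by apply: ler_pM => //; rewrite normr_ge0.
Qed.

Lemma sqintegrable_cst (c : R) : L2 (fun=> c).
Proof. by split => //; exact: finite_measure_integrable_cst. Qed.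

Lemma bounded_sqintegrable X : measurable_fun setT X -> bounded_rv X -> L2 X.
Proof.
move=> mX [c Xc].
have := sqintegrable_bounded_mul measurableT mX (fun w _ => Xc w) (sqintegrable_cst 1).
by under eq_fun do rewrite mulr1.
Qed.

Lemma bounded_mul_sqintegrable X Y : measurable_fun setT X -> bounded_rv X ->
  L2 Y -> L2 (fun w => X w * Y w).
Proof. by move=> mX [c Xc]; exact: (sqintegrable_bounded_mul measurableT mX (fun w _ => Xc w)). Qed.

Lemma sqintegrable_integrable X : L2 X -> P.-integrable setT (EFin \o X).
Proof.
move=> sX; have := sqintegrable_mul measurableT sX (sqintegrable_cst 1).
by apply: eq_integrable => // w _ /=; rewrite mulr1.
Qed.

Lemma sqintegrable_mul_increment j s t X : 0 <= s -> s <= t ->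
  adapted_at G s X -> L2 X -> L2 (fun w => X w * (B j t w - B j s w)).
Proof.
move=> s0 st aX [mX iX]; split.
  apply: measurable_funM => //; apply: (adapted_at_measurable GP (le_trans s0 st)).
  exact: (brownian_increment_adapted_at GP BP).
have := @integrable_mul_increment_sqr _ _ _ _ _ _ _ GP BP j s t
  (fun w => X w ^+ 2) s0 st (measurable_funX 2 aX) iX.
by under eq_fun do rewrite -exprMn.
Qed.

Local Notation overlap u v u' v' :=
  (Num.max 0 (Num.min v v' - Num.max u u')).

(** For disjoint intervals the later increment has mean zero given the past. Otherwise both
    increments are cut at [u'] and at the minimum [m] of [v] and [v']: products over disjoint pieces
    have mean zero, the common piece from [u'] to [m] gives the overlap, and at least one of the two
    pieces after [m] is empty. *)
Lemma expectation_increment_mul_le i j (u v u' v' : R) (X Y : Omega -> R) :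
  0 <= u -> u < v -> u <= u' -> u' < v' ->
  adapted_at G u X -> adapted_at G u' Y -> bounded_rv X -> bounded_rv Y ->
  \int[P]_w (X w * (B i v w - B i u w) * (Y w * (B j v' w - B j u' w))) =
  (i == j)%:R * (\int[P]_w (X w * Y w) * overlap u v u' v').
Proof.
move=> u0 uv uu' uv' aX aY bX bY.
have u'0 := le_trans u0 uu'; have v0 := ltW (le_lt_trans u0 uv).
have v'0 := ltW (le_lt_trans u'0 uv').
have aX' : adapted_at G u' X by exact: (adapted_at_le GP u0 uu').
have aXY : adapted_at G u' (fun w => X w * Y w) by exact: measurable_funM.
have bXY := bounded_rvM bX bY.
have mXY := adapted_at_measurable GP u'0 aXY.
have sXY := bounded_sqintegrable mXY bXY.
pose D k s t w := B k t w - B k s w.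
have aD k s t : 0 <= s -> s <= t -> adapted_at G t (D k s t).
  by move=> s0 st; exact: (brownian_increment_adapted_at GP BP).
have s1 : L2 (fun=> 1) := sqintegrable_cst 1.
have sD k s t : 0 <= s -> s <= t -> L2 (D k s t).
  move=> s0 st.
  have := @sqintegrable_mul_increment k s t (fun=> 1) s0 st (@measurable_cst _ _ _ _ _ _) s1.
  by under eq_fun do rewrite mul1r.
have sXYD k s t : 0 <= s -> s <= t -> L2 (fun w => X w * Y w * D k s t w).
  by move=> s0 st; apply: bounded_mul_sqintegrable => //; exact: sD.
have aXYD k s t : 0 <= s -> s <= t -> u' <= t -> adapted_at G t (fun w => X w * Y w * D k s t w).
  move=> s0 st ut; apply: measurable_funM; last exact: aD.
  exact: (adapted_at_le GP u'0 ut).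
have orth Z k s t : 0 <= s -> s <= t -> adapted_at G s Z -> L2 Z ->
    P.-integrable setT (fun w => (Z w * D k s t w)%:E) /\
    \int[P]_w (Z w * D k s t w) = 0.
  move=> s0 st aZ sZ; split; first by apply: sqintegrable_mul => //; exact: sD.
  apply: (expectation_mul_increment GP BP) => //.
  exact: sqintegrable_integrable.
have [vu'|u'v] := leP v u'.
  have -> : overlap u v u' v' = 0.
    apply/max_idPl; rewrite subr_le0; apply: le_trans (_ : v <= _).
      by rewrite ge_min lexx.
    by rewrite le_max vu' orbT.
  rewrite !mulr0.
  have aZ : adapted_at G u' (fun w => X w * Y w * D i u v w).
    apply: measurable_funM => //; apply: (adapted_at_le GP v0 vu').
    exact: aD (ltW uv).
  have [_ E] := orth _ j u' v' u'0 (ltW uv') aZ (sXYD i u v u0 (ltW uv)).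
  by rewrite -[RHS]E; apply: eq_Rintegral => w _; rewrite /D; ring.
pose m := Num.min v v'.
have um : u' <= m by rewrite le_min (ltW u'v) ltW.
have mv : m <= v by rewrite ge_min lexx.
have mv' : m <= v' by rewrite ge_min lexx orbT.
have m0 := le_trans u'0 um.
have ov : overlap u v u' v' = m - u'.
  by rewrite (max_idPr uu'); apply/max_idPr; rewrite subr_ge0.
rewrite ov.
have uu'0 := ltW uv.
have aZ1 : adapted_at G u' (fun w => X w * Y w * D i u u' w) by exact: aXYD.
have [i1 E1] := orth _ j u' v' u'0 (ltW uv') aZ1 (sXYD i u u' u0 uu').
have aZ2 : adapted_at G m (fun w => X w * Y w * D i u' m w) by exact: aXYD.
have [i2 E2] := orth _ j m v' m0 mv' aZ2 (sXYD i u' m u'0 um).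
have aZ3 : adapted_at G m (fun w => X w * Y w * D j u' m w) by exact: aXYD.
have [i3 E3] := orth _ i m v m0 mv aZ3 (sXYD j u' m u'0 um).
have i4 : P.-integrable setT (fun w => (X w * Y w * D i u' m w * D j u' m w)%:E).
  by apply: sqintegrable_mul => //; [exact: sXYD|exact: sD].
have E4 : \int[P]_w (X w * Y w * D i u' m w * D j u' m w) =
    (i == j)%:R * (\int[P]_w (X w * Y w) * (m - u')).
  have iXY := sqintegrable_integrable sXY.
  have [<-|ij] := eqVneq i j; last first.
    by rewrite mul0r; exact: (expectation_mul_increment2 GP BP).
  rewrite mul1r -(expectation_mul_increment_sqr GP BP i)//.
  by apply: eq_Rintegral => w _; rewrite /D expr2 mulrA.
transitivity (\int[P]_w
    (X w * Y w * D i u u' w * D j u' v' w +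
     X w * Y w * D i u' m w * D j m v' w +
     X w * Y w * D j u' m w * D i m v w +
     X w * Y w * D i u' m w * D j u' m w)).
  apply: eq_Rintegral => w _; rewrite /D.
  suff : (B i v w - B i m w) * (B j v' w - B j m w) = 0.
    move: (X w) (Y w) (B i v w) (B i m w) (B i u w) (B i u' w) (B j v' w)
      (B j m w) (B j u' w) => x y a b c d' e f' g H.
    have -> : x * (a - c) * (y * (e - g)) =
      x * y * (d' - c) * (e - g) + x * y * (b - d') * (e - f') +
      x * y * (f' - g) * (a - b) + x * y * (b - d') * (f' - g) +
      x * y * ((a - b) * (e - f')) by ring.
    by rewrite H mulr0 addr0.
  rewrite /m; case: (leP v v') => _; first by rewrite subrr mul0r.
  by rewrite subrr mulr0.
rewrite RintegralD//; last first.
  exact: (integrableD measurableT (integrableD measurableT i1 i2) i3).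
rewrite RintegralD//; last exact: (integrableD measurableT i1 i2).
by rewrite RintegralD// E1 E2 E3 E4 !add0r.
Qed.

(** Adaptedness is asked of nondegenerate intervals only: a term clipped to an empty interval may
    have a coefficient that is not yet known at that time. The order of the left end points is
    settled by symmetry. *)
Lemma expectation_increment_mul i j (u v u' v' : R) (X Y : Omega -> R) :
  0 <= u -> u <= v -> 0 <= u' -> u' <= v' ->
  (u < v -> adapted_at G u X) -> (u' < v' -> adapted_at G u' Y) ->
  bounded_rv X -> bounded_rv Y ->
  \int[P]_w (X w * (B i v w - B i u w) * (Y w * (B j v' w - B j u' w))) =
  (i == j)%:R * (\int[P]_w (X w * Y w) * overlap u v u' v').
Proof.
move=> u0; rewrite le_eqVlt => /orP[/eqP<-|uv].
  move=> u'0 uv' _ _ _ _.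
  under eq_Rintegral do rewrite subrr mulr0 mul0r.
  rewrite /Rintegral integral0/=.
  have -> : overlap u u u' v' = 0; last by rewrite !mulr0.
  apply/max_idPl; rewrite subr_le0; apply: le_trans (_ : u <= _).
    by rewrite ge_min lexx.
  by rewrite le_max lexx.
move=> u'0; rewrite le_eqVlt => /orP[/eqP<-|uv'].
  move=> _ _ _ _.
  under eq_Rintegral do rewrite subrr !mulr0.
  rewrite /Rintegral integral0/=.
  have -> : overlap u v u' u' = 0; last by rewrite !mulr0.
  apply/max_idPl; rewrite subr_le0; apply: le_trans (_ : u' <= _).
    by rewrite ge_min lexx orbT.
  by rewrite le_max lexx orbT.
move=> /(_ uv) aX /(_ uv') aY bX bY.
have [uu'|/ltW uu'] := leP u u'.
  have := @expectation_increment_mul_le i j _ _ _ _ _ _ u0 uv uu' uv' aX aY bX bY.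
  by rewrite (max_idPr uu').
have := @expectation_increment_mul_le j i _ _ _ _ _ _ u'0 uv' uu' uv aY aX bY bX.
rewrite (max_idPr uu') (minC v' v) eq_sym => H.
transitivity (\int[P]_w (Y w * (B j v' w - B j u' w) * (X w * (B i v w - B i u w)))).
  by apply: eq_Rintegral => w _; rewrite mulrC.
rewrite H; congr (_ * (_ * _)); apply: eq_Rintegral => w _; exact: mulrC.
Qed.

End elementary_integrals.

(** * Step processes and their conditional isometry *)

Section step_processes.
Context {R : realType} {disp : measure_display} {Omega : measurableType disp}.
Variables (P : probability Omega R) (G : R -> set (set Omega)).
Variables (n : nat) (B : 'I_n -> R -> Omega -> R).
Hypothesis GP : usual_conditions P G.
Hypothesis BP : brownian_motion P G B.

Local Notation L2 := (sqintegrable P setT).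
Local Notation mu := (@lebesgue_measure R).

(* The integrand xi 1_(lo, hi] in the component [et_idx] of the Brownian motion. *)
Record eterm := ETerm {
  et_idx : 'I_n;
  et_coef : Omega -> R;
  et_lo : R;
  et_hi : R;
  et_lo_ge0 : 0 <= et_lo;
  et_lohi : et_lo <= et_hi;
  et_adapted : adapted_at G et_lo et_coef;
  et_bounded : bounded_rv et_coef }.

Definition et_int (e : eterm) (t : R) (w : Omega) : R :=
  et_coef e w * (B (et_idx e) (Num.min t (et_hi e)) w -
                 B (et_idx e) (Num.min t (et_lo e)) w).

Definition et_val (e : eterm) (j : 'I_n) (s : R) (w : Omega) : R :=
  (et_idx e == j)%:R * (et_coef e w * (et_lo e < s <= et_hi e)%R%:R).

(** A list of terms carries no common partition: terms of different processes and components may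
    overlap freely, and the isometry accounts for the overlaps pair by pair. *)
Definition step_int (L : seq eterm) t w : R := \sum_(e <- L) et_int e t w.
Definition step_val (L : seq eterm) j s w : R := \sum_(e <- L) et_val e j s w.

(** [hi] and [lo] are the end points of the interval of [e] clipped to []s, t]]. The outer minimum
    in [lo] collapses the interval to a point, instead of reversing it, if nothing is left. *)
Local Notation hi e t := (Num.min t (et_hi e)).
Local Notation lo e s t := (Num.min (Num.max (et_lo e) s) (hi e t)).

Lemma et_int_increment e s t w : s <= t ->
  et_int e t w - et_int e s w =
  et_coef e w * (B (et_idx e) (hi e t) w - B (et_idx e) (lo e s t) w).
Proof.
move=> st; rewrite /et_int -mulrBr; congr (_ * _).
have := et_lohi e; move: (B _) (et_lo e) (et_hi e) => b a c ac.
have [tc|ct] := leP t c.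
  rewrite (min_idPl (le_trans st tc)).
  have [as_|sa] := leP a s.
    by rewrite (min_idPl st) (min_idPr (le_trans as_ st)); lra.
  by have [ta|at_] := leP t a; lra.
have at_ := le_trans ac (ltW ct); rewrite (min_idPr at_).
have [as_|sa] := leP a s.
  by have [sc|cs] := leP s c; lra.
by rewrite (min_idPl (le_trans (ltW sa) ac)) (min_idPl ac); lra.
Qed.

(** A proper clipped interval starts at the maximum of [et_lo e] and [s], when the coefficient is
    already known. For an empty one this can fail, hence the guarded last clause. *)
Lemma et_lo_gap e s t : 0 <= s -> s <= t ->
  [/\ 0 <= lo e s t, lo e s t <= hi e t &
      lo e s t < hi e t -> s <= lo e s t /\ adapted_at G (lo e s t) (et_coef e)].
Proof.
move=> s0 st; have a0 := et_lo_ge0 e; have ac := et_lohi e.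
have h0 : 0 <= hi e t.
  by rewrite le_min (le_trans s0 st) (le_trans a0 ac).
split; first by rewrite le_min h0 le_max a0.
  by rewrite ge_min lexx orbT.
rewrite [X in X < _]minElt; case: ifPn => [H _|_]; last by rewrite ltxx.
rewrite (min_idPl (ltW H)); split; first by rewrite le_max lexx orbT.
apply: (adapted_at_le GP a0 _ (@et_adapted e)).
by rewrite le_max lexx.
Qed.

Lemma et_int0 e w : et_int e 0 w = 0.
Proof.
rewrite /et_int (min_idPl (et_lo_ge0 e)).
by rewrite (min_idPl (le_trans (et_lo_ge0 e) (et_lohi e))) subrr mulr0.
Qed.

Lemma adapted_at_et_int e t : 0 <= t -> adapted_at G t (et_int e t).
Proof.
move=> t0; have [h0 lh H] := et_lo_gap e (lexx 0) t0.
have -> : et_int e t = fun w => et_coef e w *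
    (B (et_idx e) (hi e t) w - B (et_idx e) (lo e 0 t) w).
  by apply/funext => w; rewrite -et_int_increment// et_int0 subr0.
have [E|E] := eqVneq (lo e 0 t) (hi e t).
  by rewrite E; under eq_fun do rewrite subrr mulr0; exact: measurable_cst.
have /H[_ aX] : lo e 0 t < hi e t by rewrite lt_neqAle E lh.
have ht : hi e t <= t by rewrite ge_min lexx.
have aX' : adapted_at G t (et_coef e).
  exact: (adapted_at_le GP h0 (le_trans lh ht) aX).
apply: (measurable_funM aX').
apply: (adapted_at_le GP (le_trans h0 lh) ht).
exact: (brownian_increment_adapted_at GP BP).
Qed.

Lemma sqintegrable_et_increment e s t : 0 <= s -> s <= t ->
  L2 (fun w => et_int e t w - et_int e s w).
Proof.
move=> s0 st; under eq_fun do rewrite et_int_increment//.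
have [l0 lh H] := et_lo_gap e s0 st.
have [E|E] := eqVneq (lo e s t) (hi e t).
  by rewrite E; under eq_fun do rewrite subrr mulr0; exact: sqintegrable_cst.
have /H[_ aX] : lo e s t < hi e t by rewrite lt_neqAle E lh.
apply: (sqintegrable_mul_increment GP BP) => //.
apply: bounded_sqintegrable (et_bounded e).
exact: (adapted_at_measurable GP l0).
Qed.

Lemma sqintegrable_et_int e t : 0 <= t -> L2 (et_int e t).
Proof.
move=> t0; have := sqintegrable_et_increment e (lexx 0) t0.
by under eq_fun do rewrite et_int0 subr0.
Qed.

Lemma expectation_et_increment e s t X : 0 <= s -> s <= t ->
  adapted_at G s X -> L2 X ->
  \int[P]_w (X w * (et_int e t w - et_int e s w)) = 0.
Proof.
move=> s0 st aX sX.
have [l0 lh H] := et_lo_gap e s0 st.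
under eq_Rintegral do rewrite et_int_increment// mulrA.
have [E|E] := eqVneq (lo e s t) (hi e t).
  under eq_Rintegral do rewrite E subrr mulr0.
  by rewrite /Rintegral integral0.
have /H[sl aC] : lo e s t < hi e t by rewrite lt_neqAle E lh.
apply: (expectation_mul_increment GP BP) => //.
  by apply: measurable_funM => //; exact: (adapted_at_le GP s0 sl).
apply: sqintegrable_integrable; under eq_fun do rewrite mulrC.
apply: bounded_mul_sqintegrable (et_bounded e) sX.
exact: (adapted_at_measurable GP l0).
Qed.

(** The product of two terms is constant in time on the intersection of their intervals. The length
    is written with the clipped end points so as to match [expectation_increment_mul]. *)
Lemma et_val_mul_integral e e' s t w : 0 <= s -> s <= t ->
  mu.-integrable `]s, t] (EFin \o (fun r : R => \sum_j et_val e j r w * et_val e' j r w)) /\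
  \int[mu]_(r in `]s, t]) (\sum_j et_val e j r w * et_val e' j r w) =
  (et_idx e == et_idx e')%:R * (et_coef e w * et_coef e' w *
     Num.max 0 (Num.min (hi e t) (hi e' t) - Num.max (lo e s t) (lo e' s t))).
Proof.
move=> s0 st.
pose c := (et_idx e == et_idx e')%:R * (et_coef e w * et_coef e' w).
pose I : set R :=
  `]Num.max (et_lo e) (et_lo e'), Num.min (et_hi e) (et_hi e')]%classic.
have E r : \sum_j et_val e j r w * et_val e' j r w = c * (r \in I)%:R.
  rewrite (bigD1 (et_idx e))//= big1 ?addr0; last first.
    by move=> j /negPf ej; rewrite /et_val eq_sym ej !mul0r.
  rewrite /et_val eqxx mul1r /c (eq_sym (et_idx e')).
  have -> : (r \in I) = (et_lo e < r <= et_hi e) && (et_lo e' < r <= et_hi e').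
    by rewrite /I mem_setE in_itv/= gt_max le_min andbACA.
  move: (et_lo e < r <= et_hi e) (et_lo e' < r <= et_hi e') => b1 b2.
  by rewrite -mulnb natrM; ring.
have iI : mu.-integrable `]s, t] (EFin \o (fun r : R => (r \in I)%:R)).
  have : mu.-integrable setT (fun r => (\1_I r)%:E).
    by apply: integrable_indic_itv.
  exact: integrableS.
have Ef : (fun r => \sum_j et_val e j r w * et_val e' j r w) =
    (fun r => c * (r \in I)%:R) by apply/funext => r; exact: E.
have iIc : mu.-integrable `]s, t] (EFin \o (fun r : R => c * (r \in I)%:R)).
  by apply: (integrableZl _ c iI).
have -> : \int[mu]_(r in `]s, t]) (\sum_j et_val e j r w * et_val e' j r w) =
  \int[mu]_(r in `]s, t]) (c * (r \in I)%:R) by apply: eq_Rintegral => r _; exact: E.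
split; first by rewrite Ef.
rewrite RintegralZl// /c -!mulrA; congr (_ * (_ * (_ * _))).
rewrite /Rintegral integral_indic//; last exact: measurable_itv.
have -> : I `&` `]s, t] = `]Num.max (Num.max (et_lo e) (et_lo e')) s,
    Num.min (Num.min (et_hi e) (et_hi e')) t]%classic.
  apply/seteqP; split => r; rewrite /I /= !in_itv/= !gt_max !le_min.
    by case=> /andP[/andP[-> ->] /andP[-> ->]] /andP[-> ->].
  by case/andP=> /andP[/andP[-> ->] ->] /andP[/andP[-> ->] ->].
have LE (a b : R) : fine (mu `]a, b]) = Num.max 0 (b - a).
  rewrite lebesgue_measure_itv/= lte_fin [RHS]maxElt subr_gt0.
  by case: ifP => // _; rewrite -EFinB.
rewrite [LHS]LE.
move: (et_lo e) (et_hi e) (et_lo e') (et_hi e') => a b a' b'.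
have -> : Num.min (Num.min b b') t = Num.min (Num.min t b) (Num.min t b').
  by rewrite -minACA minxx minC.
have -> : Num.max (Num.max a a') s = Num.max (Num.max a s) (Num.max a' s).
  by rewrite -maxACA maxxx.
move: (Num.min t b) (Num.min t b') (Num.max a s) (Num.max a' s) => m m' M M'.
have minl : Num.min m m' <= m by rewrite ge_min lexx.
have minr : Num.min m m' <= m' by rewrite ge_min lexx orbT.
have maxl (x y : R) : x <= Num.max x y by rewrite le_max lexx.
have maxr (x y : R) : y <= Num.max x y by rewrite le_max lexx orbT.
have max0 (x y : R) : x <= y -> Num.max 0 (x - y) = 0.
  by move=> xy; apply/max_idPl; rewrite subr_le0.
(* If a clipped interval is empty, both sides are 0; otherwise the outer minimum in the clipped left
   end point has no effect. *)
have [Mm|/ltW mM] := leP M m; last first.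
  rewrite max0; last exact: le_trans minl (le_trans mM (maxl _ _)).
  by rewrite max0//; exact: le_trans minl (maxl _ _).
have [Mm'|/ltW mM'] := leP M' m'; last first.
  rewrite max0; last exact: le_trans minr (le_trans mM' (maxr _ _)).
  by rewrite max0//; exact: le_trans minr (maxr _ _).
by [].
Qed.

Lemma adapted_at_step_int L t : 0 <= t -> adapted_at G t (step_int L t).
Proof.
move=> t0; rewrite /step_int; elim: L => [|e L IH].
  by under eq_fun do rewrite big_nil; exact: measurable_cst.
under eq_fun do rewrite big_cons.
by apply: measurable_funD => //; exact: adapted_at_et_int.
Qed.

Lemma sqintegrable_step_int L t : 0 <= t -> L2 (step_int L t).
Proof.
by move=> t0; apply: sqintegrable_sum => // e; exact: sqintegrable_et_int.
Qed.

Lemma step_int0 L w : step_int L 0 w = 0.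
Proof. by rewrite /step_int big1// => e _; exact: et_int0. Qed.

Lemma expectation_step_increment L s t X : 0 <= s -> s <= t ->
  adapted_at G s X -> L2 X ->
  \int[P]_w (X w * (step_int L t w - step_int L s w)) = 0.
Proof.
move=> s0 st aX sX.
under eq_Rintegral.
  move=> w _; rewrite /step_int -sumrB mulr_sumr; over.
rewrite Rintegral_sum//; last first.
  by move=> e; apply: sqintegrable_mul => //; exact: sqintegrable_et_increment.
by rewrite big1// => e _; exact: expectation_et_increment.
Qed.

Lemma step_val_mul_integral L L' s t w : 0 <= s -> s <= t ->
  mu.-integrable `]s, t] (EFin \o (fun r : R => \sum_j step_val L j r w * step_val L' j r w)) /\
  \int[mu]_(r in `]s, t]) (\sum_j step_val L j r w * step_val L' j r w) =
  \sum_(e <- L) \sum_(e' <- L')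
    (et_idx e == et_idx e')%:R * (et_coef e w * et_coef e' w *
     Num.max 0 (Num.min (hi e t) (hi e' t) - Num.max (lo e s t) (lo e' s t))).
Proof.
move=> s0 st.
have E : (fun r : R => \sum_j step_val L j r w * step_val L' j r w) =
  (fun r : R => \sum_(e <- L) \sum_(e' <- L') \sum_j et_val e j r w * et_val e' j r w).
  apply/funext => r.
  under eq_bigr do rewrite /step_val mulr_suml.
  rewrite exchange_big/=; apply: eq_bigr => e _.
  under eq_bigr do rewrite mulr_sumr.
  by rewrite exchange_big.
have ii e e' := (@et_val_mul_integral e e' s t w s0 st).1.
have mI : measurable (`]s, t]%classic : set (measurableTypeR R)).
  exact: measurable_itv.
have ii' e : mu.-integrable `]s, t] (EFin \o (fun r : R =>
    \sum_(e' <- L') \sum_j et_val e j r w * et_val e' j r w)).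
  have := integrable_sum mI L' (P := xpredT) (h := fun e' => EFin \o (fun r : R =>
    \sum_j et_val e j r w * et_val e' j r w)) (fun e' _ => ii e e').
  by apply: eq_integrable => // r _; rewrite /= sumEFin.
rewrite E; split.
  have := integrable_sum mI L (P := xpredT) (h := fun e => EFin \o (fun r : R =>
    \sum_(e' <- L') \sum_j et_val e j r w * et_val e' j r w)) (fun e _ => ii' e).
  by apply: eq_integrable => // r _; rewrite /= sumEFin.
transitivity (\int[mu]_(r in `]s, t])
  (\sum_(e <- L) \sum_(e' <- L') \sum_j et_val e j r w * et_val e' j r w)).
  by congr Rintegral.
rewrite Rintegral_sum//; apply: eq_bigr => e _.
rewrite Rintegral_sum//; apply: eq_bigr => e' _.
exact: (@et_val_mul_integral e e' s t w s0 st).2.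
Qed.

(** The Ito isometry conditionally on [G s], with a bounded test variable [X] in place of a
    conditional expectation. Both sides expand over pairs of terms into the same overlaps. *)
Lemma expectation_step_increment_mul L L' s t X : 0 <= s -> s <= t ->
  adapted_at G s X -> bounded_rv X ->
  \int[P]_w (X w * ((step_int L t w - step_int L s w) *
                    (step_int L' t w - step_int L' s w))) =
  \int[P]_w (X w * \int[mu]_(r in `]s, t])
     (\sum_j step_val L j r w * step_val L' j r w)).
Proof.
move=> s0 st aX bX; have mX := adapted_at_measurable GP s0 aX.
have sI e : L2 (fun w => X w * (et_int e t w - et_int e s w)).
  by apply: bounded_mul_sqintegrable => //; exact: sqintegrable_et_increment.
transitivity (\int[P]_w (\sum_(e <- L) \sum_(e' <- L')
    X w * (et_int e t w - et_int e s w) * (et_int e' t w - et_int e' s w))).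
  apply: eq_Rintegral => w _; rewrite /step_int -!sumrB mulrA [X w * _]mulr_sumr mulr_suml.
  by apply: eq_bigr => e _; rewrite mulr_sumr.
have iee' e e' : P.-integrable setT (EFin \o (fun w =>
    X w * (et_int e t w - et_int e s w) * (et_int e' t w - et_int e' s w))).
  by apply: sqintegrable_mul => //; exact: sqintegrable_et_increment.
have ie e : P.-integrable setT (EFin \o (fun w => \sum_(e' <- L')
    X w * (et_int e t w - et_int e s w) * (et_int e' t w - et_int e' s w))).
  have := integrable_sum measurableT L' (P := xpredT) (fun e' _ => iee' e e').
  by apply: eq_integrable => // r _; rewrite /= sumEFin.
rewrite Rintegral_sum//.
under [RHS]eq_Rintegral.
  move=> w _; rewrite (@step_val_mul_integral L L' s t w s0 st).2 mulr_sumr.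
  under eq_bigr do rewrite mulr_sumr.
  over.
have sC e : L2 (et_coef e).
  apply: bounded_sqintegrable (et_bounded e).
  exact: (adapted_at_measurable GP (et_lo_ge0 e) (@et_adapted e)).
pose ov e e' := Num.max 0 (Num.min (hi e t) (hi e' t) - Num.max (lo e s t) (lo e' s t)).
have jee' e e' : P.-integrable setT (EFin \o (fun w =>
    X w * ((et_idx e == et_idx e')%:R * (et_coef e w * et_coef e' w * ov e e')))).
  have := @sqintegrable_mul _ _ _ P setT measurableT (fun w => X w * et_coef e w)
    (fun w => ((et_idx e == et_idx e')%:R * ov e e') * et_coef e' w).
  move=> /(_ (bounded_mul_sqintegrable mX bX (sC e))).
  move=> /(_ (sqintegrableZ measurableT _ (sC e'))).
  by apply: eq_integrable => // w _; congr EFin; ring.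
have je e : P.-integrable setT (EFin \o (fun w => \sum_(e' <- L')
    X w * ((et_idx e == et_idx e')%:R * (et_coef e w * et_coef e' w * ov e e')))).
  have := integrable_sum measurableT L' (P := xpredT) (fun e' _ => jee' e e').
  by apply: eq_integrable => // r _; rewrite /= sumEFin.
rewrite [RHS]Rintegral_sum//; apply: eq_bigr => e _.
rewrite !Rintegral_sum//; apply: eq_bigr => e' _.
have [l0 lh H] := et_lo_gap e s0 st; have [l0' lh' H'] := et_lo_gap e' s0 st.
transitivity (\int[P]_w ((X w * et_coef e w) *
    (B (et_idx e) (hi e t) w - B (et_idx e) (lo e s t) w) *
    (et_coef e' w * (B (et_idx e') (hi e' t) w - B (et_idx e') (lo e' s t) w)))).
  by apply: eq_Rintegral => w _; rewrite !et_int_increment// !mulrA.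
rewrite (expectation_increment_mul GP BP) //; last 4 first.
- move=> /H[sl aC]; apply: measurable_funM => //.
  exact: (adapted_at_le GP s0 sl aX).
- by move=> /H'[].
- exact: bounded_rvM (et_bounded e).
- exact: et_bounded.
rewrite -/(ov e e') mulrCA mulrC -RintegralZl//; last first.
  exact: (sqintegrable_mul measurableT (bounded_mul_sqintegrable mX bX (sC e)) (sC e')).
by apply: eq_Rintegral => w _; ring.
Qed.

End step_processes.

(** * Approximation by simple processes with dominated energies *)

Section simple_processes.
Context {R : realType} {disp : measure_display} {Omega : measurableType disp}.
Variables (P : probability Omega R) (G : R -> set (set Omega)) (T : R).
Hypothesis GP : usual_conditions P G.
Local Notation mu := (@lebesgue_measure R).
Implicit Types S : simple_process G T.

Lemma sp_time_mono S i j : (i <= j)%N -> (j <= sp_size S)%N ->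
  sp_time S i <= sp_time S j.
Proof.
elim: j => [|j IH]; first by rewrite leqn0 => /eqP->.
rewrite leq_eqVlt => /orP[/eqP->//|ij] jS.
by apply: le_trans (IH _ (ltnW jS)) (sp_time_le jS).
Qed.

Lemma sp_time_nonneg S i : (i <= sp_size S)%N -> 0 <= sp_time S i.
Proof. by move=> iS; apply: le_trans (sp_time_ge0 S) (sp_time_mono (leq0n _) iS). Qed.

Lemma sp_adapted_at S i : (i < sp_size S)%N ->
  adapted_at G (sp_time S i) (sp_xi S i).
Proof.
move=> iS; apply/(adapted_atP GP); last by move=> U mU; exact: sp_adapted.
exact: sp_time_nonneg (ltnW iS).
Qed.

(** For [m] equal to [sp_size S] this is the time integral of the squared process; the smaller
    values of [m] serve to decide where the process is stopped. *)
Definition sp_energy S (m : nat) (w : Omega) : R :=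
  \sum_(i < m) sp_xi S i w ^+ 2 * (sp_time S i.+1 - sp_time S i).

Lemma sp_energy_mono S m m' w : (m <= m')%N -> (m' <= sp_size S)%N ->
  sp_energy S m w <= sp_energy S m' w.
Proof.
elim: m' => [|k IH]; first by rewrite leqn0 => /eqP->.
rewrite leq_eqVlt => /orP[/eqP->//|mk] kS.
apply: le_trans (IH mk (ltnW kS)) _; rewrite /sp_energy big_ord_recr/= lerDl.
by rewrite mulr_ge0 ?sqr_ge0// subr_ge0; exact: sp_time_le.
Qed.

(** The intervals are pairwise disjoint, so no cross terms survive. *)
Lemma sp_val_sqr S s w : sp_val S s w ^+ 2 =
  \sum_(i < sp_size S) sp_xi S i w ^+ 2 *
    (sp_time S i < s <= sp_time S i.+1)%R%:R.
Proof.
rewrite /sp_val expr2 big_distrlr/=; apply: eq_bigr => i _.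
rewrite (bigD1 i)//= big1 ?addr0 => [|j ji].
  by case: (_ < _ <= _); rewrite ?mulr0 ?mulr1// expr2.
wlog ij : i j {ji} / (i < j)%N.
  move=> H; have [ij|ji'|/val_inj ij] := ltngtP i j; first exact: H.
    by rewrite mulrC; exact: H.
  by rewrite ij eqxx in ji.
have [/andP[_ s1]|_] := boolP (sp_time S i < s <= _); last by rewrite mulr0 mul0r.
have [/andP[s2 _]|_] := boolP (sp_time S j < s <= _); last by rewrite !mulr0.
have := le_lt_trans (sp_time_mono ij (ltnW (ltn_ord j))) s2.
by move=> /(le_lt_trans s1); rewrite ltxx.
Qed.

Let indic_step S i w : (i < sp_size S)%N ->
  mu.-integrable `[0, T] (EFin \o (fun s : R => sp_xi S i w ^+ 2 *
    (sp_time S i < s <= sp_time S i.+1)%R%:R)) /\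
  \int[mu]_(s in `[0, T]) (sp_xi S i w ^+ 2 *
    (sp_time S i < s <= sp_time S i.+1)%R%:R) =
  sp_xi S i w ^+ 2 * (sp_time S i.+1 - sp_time S i).
Proof.
move=> iS; pose I : set R := `]sp_time S i, sp_time S i.+1]%classic.
have E : (fun s : R => sp_xi S i w ^+ 2 * (sp_time S i < s <= sp_time S i.+1)%R%:R) =
    (fun s : R => sp_xi S i w ^+ 2 * \1_I s).
  by apply/funext => s; rewrite /indic/= /I mem_setE in_itv.
have iI : mu.-integrable `[0, T] (EFin \o (\1_I : R -> R)).
  have : mu.-integrable setT (EFin \o (\1_I : R -> R)).
    by apply: integrable_indic_itv.
  by apply: integrableS => //; exact: measurable_itv.
have m0T : measurable (`[0, T]%classic : set (measurableTypeR R)).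
  exact: measurable_itv.
rewrite E; split; first exact: (integrableZl m0T _ iI).
rewrite RintegralZl//; congr (_ * _).
rewrite /Rintegral integral_indic//; last exact: measurable_itv.
have -> : I `&` `[0, T] = I.
  apply/setIidPl => s; rewrite /I /= !in_itv/= => /andP[s1 s2].
  rewrite (le_trans (sp_time_nonneg (ltnW iS)) (ltW s1))/=.
  by apply: le_trans s2 (le_trans (sp_time_mono iS (leqnn _)) (sp_time_leT S)).
have LE (a b : R) : a <= b -> fine (mu `]a, b]) = b - a.
  rewrite lebesgue_measure_itv/= lte_fin; case: ltP => [_ _|ba ab].
    by rewrite -EFinB.
  by apply/esym/eqP; rewrite subr_eq0 eq_le ba ab.
exact: LE (sp_time_le iS).
Qed.

Lemma sp_val_sqr_integral S w :
  mu.-integrable `[0, T] (EFin \o (fun s : R => sp_val S s w ^+ 2)) /\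
  \int[mu]_(s in `[0, T]) (sp_val S s w ^+ 2) = sp_energy S (sp_size S) w.
Proof.
have m0T : measurable (`[0, T]%classic : set (measurableTypeR R)).
  exact: measurable_itv.
have E : (fun s : R => sp_val S s w ^+ 2) = (fun s : R =>
    \sum_(i < sp_size S) sp_xi S i w ^+ 2 * (sp_time S i < s <= sp_time S i.+1)%R%:R).
  by apply/funext => s; exact: sp_val_sqr.
split.
  rewrite E.
  have := integrable_sum m0T (index_enum 'I_(sp_size S)) (P := xpredT)
   (h := fun i => EFin \o (fun s : R => sp_xi S i w ^+ 2 *
     (sp_time S i < s <= sp_time S i.+1)%R%:R))
   (fun i _ => (indic_step w (ltn_ord i)).1).
  by apply: eq_integrable => // s _; rewrite /= sumEFin.
transitivity (\int[mu]_(s in `[0, T]) (\sum_(i < sp_size S)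
    sp_xi S i w ^+ 2 * (sp_time S i < s <= sp_time S i.+1)%R%:R)).
  by apply: eq_Rintegral => s _; exact: sp_val_sqr.
rewrite Rintegral_sum//; last by move=> i; exact: (indic_step w (ltn_ord i)).1.
by apply: eq_bigr => i _; exact: (indic_step w (ltn_ord i)).2.
Qed.

Lemma measurable_sp_val S w (D : set R) : measurable_fun D (fun s : R => sp_val S s w).
Proof.
rewrite /sp_val; apply: measurable_sum => i; apply: measurable_funM => //.
have -> : (fun s : R => (sp_time S i < s <= sp_time S i.+1)%R%:R : R) =
    \1_(`]sp_time S i, sp_time S i.+1]%classic : set R).
  by apply/funext => s; rewrite /indic/= mem_setE in_itv.
by apply: measurable_indic; exact: measurable_itv.
Qed.

Lemma sp_val_sqintegrable S w :
  sqintegrable mu `[0, T] (fun s : R => sp_val S s w).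
Proof.
split; last exact: (sp_val_sqr_integral S w).1.
exact: measurable_sp_val.
Qed.

Section truncation.
Variables (S : simple_process G T) (K : R).

Let xi' i w := sp_xi S i w * (sp_energy S i.+1 w <= K)%R%:R.

Let xi'_adapted i : (i < sp_size S)%N ->
  forall U : set R, measurable U -> G (sp_time S i) (xi' i @^-1` U).
Proof.
move=> iS; have t0 := sp_time_nonneg (ltnW iS).
have ax k : (k <= i)%N -> adapted_at G (sp_time S i) (sp_xi S k).
  move=> ki; have kS := leq_ltn_trans ki iS.
  apply: (adapted_at_le GP _ _ (sp_adapted_at kS)).
    exact: sp_time_nonneg (ltnW kS).
  exact: sp_time_mono (ltnW iS).
apply/(adapted_atP GP) => //; apply: measurable_funM; first exact: ax.
have ae : adapted_at G (sp_time S i) (sp_energy S i.+1).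
  apply: measurable_sum => k; apply: measurable_funM => //.
  by apply: measurable_funX; apply: ax; rewrite -ltnS.
have -> : (fun w => (sp_energy S i.+1 w <= K)%R%:R : R) =
    \1_(sp_energy S i.+1 @^-1` `]-oo, K]).
  apply/funext => w; rewrite /indic/=; congr ((nat_of_bool _)%:R).
  by apply/idP/idP; rewrite inE/= in_itv.
apply: measurable_indic; rewrite -[X in measurable X]setTI.
by apply: ae => //; exact: measurable_itv.
Qed.

Let xi'_bounded : exists c : R, forall i, (i < sp_size S)%N ->
  forall w, `|xi' i w| <= c.
Proof.
have [c Sc] := sp_bounded S; exists c => i iS w.
apply: le_trans (Sc i iS w); rewrite /xi' normrM; case: (_ <= K).
  by rewrite normr1 mulr1.
by rewrite normr0 mulr0 normr_ge0.
Qed.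

(* [S] is stopped before its energy exceeds [K].  The energy up to [t_(i+1)] is
   already known at time [t_i], so that the stopped process is adapted. *)
Definition sp_trunc : simple_process G T :=
  SimpleProcess (sp_time_ge0 S) (fun i => @sp_time_le _ _ _ _ _ S i)
    (sp_time_leT S) xi'_adapted xi'_bounded.

(** The two bounds support each other: a term is kept only if the full energy up to and including it
    is at most [K], and the truncated energy never exceeds the full one; a dropped term adds
    nothing. *)
Lemma sp_trunc_energy_le w : 0 <= K ->
  sp_energy sp_trunc (sp_size S) w <= K /\
  sp_energy sp_trunc (sp_size S) w <= sp_energy S (sp_size S) w.
Proof.
(* The trivial inequality is introduced so that the induction runs over all prefixes of length
   [m <= sp_size S]. *)
move=> K0; have : (sp_size S <= sp_size S)%N by [].
elim: {1 3 4 5}(sp_size S) => [_|m IH mS].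
  by rewrite /sp_energy !big_ord0.
have [h1 h2] := IH (ltnW mS).
have d0 : 0 <= sp_time S m.+1 - sp_time S m by rewrite subr_ge0; exact: sp_time_le.
have Em : sp_energy S m.+1 w = sp_energy S m w +
   sp_xi S m w ^+ 2 * (sp_time S m.+1 - sp_time S m).
  by rewrite /sp_energy big_ord_recr.
have Em' : sp_energy sp_trunc m.+1 w = sp_energy sp_trunc m w +
   xi' m w ^+ 2 * (sp_time S m.+1 - sp_time S m).
  by rewrite /sp_energy big_ord_recr.
rewrite Em' /xi'; have := mulr_ge0 (sqr_ge0 (sp_xi S m w)) d0.
have [EK|EK] := leP (sp_energy S m.+1 w) K; rewrite ?mulr1 ?mulr0.
  move: EK; rewrite Em; set x := sp_xi S m w ^+ 2 * (_ - _) => EK x0.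
  by split; lra.
by rewrite Em expr0n/= mul0r; set x := sp_xi S m w ^+ 2 * (_ - _) => x0; split; lra.
Qed.

Lemma sp_trunc_id w : sp_energy S (sp_size S) w <= K ->
  (forall s, sp_val sp_trunc s w = sp_val S s w) /\
  (forall b t, sp_int sp_trunc b t w = sp_int S b t w).
Proof.
move=> SK; have E (i : 'I_(sp_size S)) : xi' i w = sp_xi S i w.
  by rewrite /xi' (le_trans (sp_energy_mono w (ltn_ord i) (leqnn _)) SK) mulr1.
split=> [s|b t].
  by apply: eq_bigr => i _; rewrite [sp_xi _ _ _]E.
by apply: eq_bigr => i _; rewrite [sp_xi _ _ _]E.
Qed.

End truncation.

Variables (n : nat) (B : 'I_n -> R -> Omega -> R).

Lemma sp_xi_bounded S i : (i < sp_size S)%N -> bounded_rv (sp_xi S i).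
Proof. by move=> iS; have [c Sc] := sp_bounded S; exists c => w; exact: Sc. Qed.

Definition sp_term (j : 'I_n) S (i : 'I_(sp_size S)) : eterm G n :=
  ETerm j (sp_time_nonneg (ltnW (ltn_ord i))) (sp_time_le (ltn_ord i))
    (sp_adapted_at (ltn_ord i)) (sp_xi_bounded (ltn_ord i)).

Definition sp_step (S : 'I_n -> simple_process G T) : seq (eterm G n) :=
  flatten [seq [seq sp_term j i | i <- index_enum 'I_(sp_size (S j))]
          | j <- index_enum 'I_n].

Lemma step_val_sp (S : 'I_n -> simple_process G T) j s w :
  step_val (sp_step S) j s w = sp_val (S j) s w.
Proof.
rewrite /step_val /sp_step big_flatten/= big_map.
rewrite (bigD1 j)//= [X in _ + X]big1 ?addr0; last first.
  move=> k /negPf kj; rewrite big_map big1// => i _.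
  by rewrite /et_val/= kj mul0r.
by rewrite big_map; apply: eq_bigr => i _; rewrite /et_val/= eqxx mul1r.
Qed.

Lemma step_int_sp (S : 'I_n -> simple_process G T) t w :
  step_int B (sp_step S) t w = \sum_j sp_int (S j) (B j) t w.
Proof.
rewrite /step_int /sp_step big_flatten/= big_map; apply: eq_bigr => j _.
by rewrite big_map.
Qed.

End simple_processes.

(** * Comparison with functions that need not be measurable *)

Section nonmeasurable_bound.
Context d (T : measurableType d) (R : realType).
Variable mu : {measure set T -> \bar R}.
Local Open Scope ereal_scope.

(* No measurability is required of [q]: its integral is then a lower integral. *)
Lemma ge0_le_lower_integral (f q : T -> \bar R) : (forall x, 0 <= f x) ->
  (forall x, f x <= q x) -> \int[mu]_x f x <= \int[mu]_x q x.
Proof.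
move=> f0 fq; have q0 x : 0 <= q x := le_trans (f0 x) (fq x).
rewrite !ge0_integralTE//; apply: ereal_sup_le => _ [h hf <-].
by exists h => // x; exact: le_trans (hf x) (fq x).
Qed.

(** The exceptional set is removed from [f], whose integral does not change because [f] is
    measurable; [q] is left as it is. *)
Lemma ae_ge0_le_lower_integral (f q : T -> \bar R) : measurable_fun setT f ->
  (forall x, 0 <= f x) -> (forall x, 0 <= q x) ->
  {ae mu, forall x, f x <= q x} -> \int[mu]_x f x <= \int[mu]_x q x.
Proof.
move=> mf f0 q0 [N [mN N0 sN]].
have -> : \int[mu]_x f x = \int[mu]_x (f \_ (~` N)) x.
  by rewrite -integral_mkcond (ge0_negligible_integral mN)// setTD.
apply: ge0_le_lower_integral => x; first by apply: erestrict_ge0.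
rewrite patchE; case: ifPn => // xN.
by apply: contrapT => fq; move: xN; rewrite inE; apply; exact: sN.
Qed.

End nonmeasurable_bound.

(** * Adaptedness up to null sets *)

Section completeness.
Context {R : realType} {disp : measure_display} {Omega : measurableType disp}.
Variables (P : probability Omega R) (G : R -> set (set Omega)).
Hypothesis GP : usual_conditions P G.

Lemma filtration_negligible t N : 0 <= t -> P.-negligible N -> G t N.
Proof.
by move=> t0 nN; apply: (filtration_le GP (lexx 0) t0); case: GP => _ _ _; exact.
Qed.

(** A preimage under [Y] differs from the preimage under [X] by part of a null set, and null sets
    belong to the filtration at all times. *)
Lemma adapted_at_ae_eq t X Y : 0 <= t -> adapted_at G t X ->
  {ae P, forall w, X w = Y w} -> adapted_at G t Y.
Proof.
move=> t0 aX XY.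
have mN N : P.-negligible N -> (G t).-sigma.-measurable N.
  by move=> nN; rewrite (measurable_filtration GP)//; exact: filtration_negligible.
move=> _ U mU; rewrite setTI.
pose E := [set w | X w = Y w].
have mE : (G t).-sigma.-measurable E by rewrite -[E]setCK; apply: measurableC; exact: mN.
have -> : Y @^-1` U = (X @^-1` U `&` E) `|` (Y @^-1` U `&` ~` E).
  apply/seteqP; split => w /=.
    by move=> Uw; have [Ew|Ew] := pselect (E w); [left; split => //; rewrite /= Ew|right].
  by case=> [[+ Ew]|[]//]; rewrite /= (Ew : X w = Y w).
apply: measurableU.
  by apply: measurableI => //; rewrite -[X in measurable X]setTI; exact: aX.
by apply: mN; apply: negligibleS XY => w [].
Qed.

(** The set of convergence belongs to [G t] because its complement is negligible; multiplied by its
    indicator, the sequence converges everywhere. *)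
Lemma adapted_at_cvg t (X_ : nat -> Omega -> R) X : 0 <= t ->
  (forall k, adapted_at G t (X_ k)) ->
  {ae P, forall w, X_ k w @[k --> \oo] --> X w} -> adapted_at G t X.
Proof.
move=> t0 aX cX; pose E := [set w | X_ k w @[k --> \oo] --> X w].
have mE : (G t).-sigma.-measurable E.
  rewrite -[E]setCK; apply: measurableC; rewrite (measurable_filtration GP)//.
  exact: filtration_negligible.
apply: (adapted_at_ae_eq t0 (X := fun w => X w * \1_E w)); last first.
  apply: filterS cX => w Ew; rewrite /indic/= mem_set ?mulr1//.
apply: (@measurable_fun_cvg _ (g_sigma_algebraType (G t)) R setT
  (fun k w => X_ k w * \1_E w)).
  by move=> k; apply: measurable_funM; [exact: aX|exact: measurable_indic].
move=> w _; have [wE|wE] := pselect (E w).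
  by rewrite /indic/= mem_set//; under eq_fun do rewrite mulr1; rewrite mulr1.
by rewrite /indic/= memNset//; under eq_fun do rewrite mulr0; rewrite mulr0; exact: cvg_cst.
Qed.

End completeness.

(** * Simple approximations with a common integrable bound *)

Section approximation.
Context {R : realType} {disp : measure_display} {Omega : measurableType disp}.
Variables (P : probability Omega R) (G : R -> set (set Omega)) (T : R).
Hypotheses (GP : usual_conditions P G) (T0 : 0 < T).
Local Notation mu := (@lebesgue_measure R).

(** The definition of the integral gives convergence in probability; here it is almost sure, and
    [Phi] bounds the energies of all approximations at once, which permits dominated convergence. *)
Definition ito_approximation (b H Z : R -> Omega -> R)
    (S : nat -> simple_process G T) (Phi : Omega -> \bar R) : Prop :=
  [/\ P.-integrable setT Phi,
    {ae P, forall w, sqintegrable mu `[0, T] (fun s : R => H s w)},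
    {ae P, forall w,
       \int[mu]_(s in `[0, T]) ((sp_val (S k) s w - H s w) ^+ 2) @[k --> \oo] --> 0},
    {ae P, forall w, forall eps, 0 < eps -> \forall k \near \oo,
       forall t, 0 <= t <= T -> `|sp_int (S k) b t w - Z t w| <= eps} &
    {ae P, forall w, forall k,
       ((sp_energy (S k) (sp_size (S k)) w)%:E <= Phi w)%E}].

Let m0T : measurable (`[0, T]%classic : set (measurableTypeR R)).
Proof. exact: measurable_itv. Qed.

(** A measurable path at finite distance from a simple one is itself square integrable. The energy
    bound rests on a^2 <= 2 (a - x)^2 + 2 x^2, that is, (a - 2 x)^2 >= 0. *)
Lemma simple_sqdist_bound (S : simple_process G T) (w : Omega) (h : R -> R) (c : R) :
  measurable_fun `[0, T] h ->
  (\int[mu]_(s in `[0%R, T]) ((sp_val S s w - h s) ^+ 2)%:E <= c%:E)%E ->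
  [/\ sqintegrable mu `[0, T] h,
    \int[mu]_(s in `[0, T]) ((sp_val S s w - h s) ^+ 2) <= c &
    sp_energy S (sp_size S) w <= 2 * c + 2 * \int[mu]_(s in `[0, T]) (h s ^+ 2)].
Proof.
move=> mh Dc; have sS := sp_val_sqintegrable S w.
have D0 : (0 <= \int[mu]_(s in `[0%R, T]) ((sp_val S s w - h s) ^+ 2)%:E)%E.
  by apply: integral_ge0 => s _; rewrite lee_fin sqr_ge0.
have sD : sqintegrable mu `[0, T] (fun s : R => sp_val S s w - h s).
  have mD : measurable_fun `[0, T] (fun s : R => sp_val S s w - h s).
    by apply: measurable_funB => //; exact: measurable_sp_val.
  split => //; apply/integrableP; split.
    by apply/measurable_EFinP; exact: measurable_funX.
  under eq_integral do rewrite gee0_abs ?lee_fin ?sqr_ge0//.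
  by rewrite (le_lt_trans Dc)// ltry.
have sh : sqintegrable mu `[0, T] h.
  have -> : h = (fun s : R => sp_val S s w - (sp_val S s w - h s)).
    by apply/funext => s; rewrite opprB addrC subrK.
  exact: (sqintegrableB m0T sS sD).
have Dc' : \int[mu]_(s in `[0, T]) ((sp_val S s w - h s) ^+ 2) <= c.
  rewrite /Rintegral -lee_fin fineK//.
  by rewrite ge0_fin_numE// (le_lt_trans Dc)// ltry.
split => //; rewrite -(sp_val_sqr_integral S w).2.
have i1 : mu.-integrable `[0, T] (EFin \o (fun s : R => 2 * (sp_val S s w - h s) ^+ 2)).
  by case: sD => _ i; exact: (integrableZl m0T 2 i).
have i2 : mu.-integrable `[0, T] (EFin \o (fun s : R => 2 * h s ^+ 2)).
  by case: sh => _ i; exact: (integrableZl m0T 2 i).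
apply: (@le_trans _ _ (2 * \int[mu]_(s in `[0, T]) ((sp_val S s w - h s) ^+ 2) +
    2 * \int[mu]_(s in `[0, T]) (h s ^+ 2))); last by rewrite lerD2r ler_pM2l.
rewrite -!RintegralZl//; [|by case: sh|by case: sD].
rewrite -RintegralD//; apply: le_Rintegral => //.
- by case: sS.
- exact: (integrableD m0T i1 i2).
- move=> s _; set a := sp_val S s w; set x := h s.
  by have := sqr_ge0 (a - x - x); nra.
Qed.

Let half_pow (k : nat) : R := (2 ^ k.+1)%:R^-1.
(** The probability allowed to each of the two failures at level [k], in energy and in uniform
    distance. The denominator [k.+1] compensates the weight that the truncation level puts on the
    failure event. *)
Let thr (k : nat) : R := half_pow k / k.+1%:R.

Let half_pow_gt0 k : 0 < half_pow k.
Proof. by rewrite invr_gt0 ltr0n expn_gt0. Qed.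

Let thr_gt0 k : 0 < thr k. Proof. by rewrite divr_gt0 ?ltr0n ?half_pow_gt0. Qed.

Let sum_half_pow : (\sum_(0 <= k <oo) (half_pow k)%:E <= 1)%E.
Proof.
have := @epsilon_trick R (fun=> 0%E) 1 xpredT (fun=> lexx _) ler01.
rewrite [X in (_ <= X + _)%E]eseries0// add0e.
by under eq_eseriesr do rewrite add0e div1r.
Qed.

Let weighted_sum (F : nat -> set Omega) : (forall k, P (F k) <= (thr k + thr k)%:E)%E ->
  (\sum_(0 <= k <oo) (k.+1%:R%:E * P (F k)) < +oo)%E.
Proof.
move=> PF; apply: (@le_lt_trans _ _ (\sum_(0 <= k <oo) (2%:E * (half_pow k)%:E))%E).
  apply: lee_nneseries => [k _ _|k _]; first by rewrite mule_ge0// lee_fin.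
  apply: (@le_trans _ _ (k.+1%:R%:E * (thr k + thr k)%:E)%E).
    by rewrite lee_pmul2l// lte_fin ltr0n.
  rewrite -!EFinM lee_fin /thr -mulrDl mulrCA divff ?pnatr_eq0// mulr1.
  by rewrite mulr_natl mulr2n.
rewrite nneseriesZl//; last by move=> k _; rewrite lee_fin ltW.
apply: (@le_lt_trans _ _ (2%:E * 1)%E); last by rewrite mule1 ltry.
by rewrite lee_pmul2l.
Qed.

(* The [k]-th approximation fails on an event [A_k] with [P A_k <= 2^-k / (k + 1)].
   Truncated at level [k], its energy is at most [k] on [A_k] and at most
   [2 + 2 int H^2] elsewhere, and [sum_k (k + 1) 1_(A_k)] is integrable. *)
Lemma ito_integral_approximation (b H Z : R -> Omega -> R) (q : Omega -> \bar R) :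
  ito_integral P G T b H Z ->
  (forall w, (0 <= q w)%E) -> (\int[P]_w q w < +oo)%E ->
  {ae P, forall w, (\int[mu]_(s in `[0%R, T]) (H s w ^+ 2)%:E <= q w)%E} ->
  exists (S : nat -> simple_process G T) (Phi : Omega -> \bar R),
    ito_approximation b H Z S Phi.
Proof.
move=> [mH [S0 [D0 E0]]] q0 qoo Hq.
have pick k : exists SA : simple_process G T * set Omega,
    [/\ measurable SA.2, (P SA.2 <= (thr k + thr k)%:E)%E &
     forall w, ~ SA.2 w ->
      (\int[mu]_(s in `[0%R, T]) ((sp_val SA.1 s w - H s w) ^+ 2)%:E <= k.+1%:R^-1%:E)%E /\
      forall t, 0 <= t <= T -> `|sp_int SA.1 b t w - Z t w| <= k.+1%:R^-1].
  have k0 : (0 : R) < k.+1%:R^-1 by rewrite invr_gt0 ltr0n.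
  have [N1 _ H1] := D0 _ _ k0 (thr_gt0 k); have [N2 _ H2] := E0 _ _ k0 (thr_gt0 k).
  have [A1 mA1 [s1 PA1]] := H1 (maxn N1 N2) (leq_maxl _ _).
  have [A2 mA2 [s2 PA2]] := H2 (maxn N1 N2) (leq_maxr _ _).
  exists (S0 (maxn N1 N2), A1 `|` A2) => /=; split.
  - exact: measurableU.
  - rewrite EFinD; apply: le_trans (measureU2 P mA1 mA2) _; exact: leeD.
  - move=> w /not_orP[nA1 nA2]; split.
      by rewrite leNgt; apply/negP => lt; apply: nA1; exact: s1.
    move=> t t0T; rewrite leNgt; apply/negP => lt; apply: nA2; apply: s2.
    rewrite /=; apply: (@lt_le_trans _ _ (`|sp_int (S0 (maxn N1 N2)) b t w - Z t w|%:E)).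
      by rewrite lte_fin.
    by apply: ereal_sup_ubound; exists t => //=; rewrite in_itv.
have [SA SAP] := choice pick.
pose F k := (SA k).2; pose S k := sp_trunc GP (SA k).1 k%:R.
have mF k : measurable (F k) by have [] := SAP k.
have PF k : (P (F k) <= (thr k + thr k)%:E)%E by have [] := SAP k.
(* Borel-Cantelli: the weighted series dominates the series of probabilities. *)
have FN : P (lim_sup_set F) = 0%E.
  apply: lim_sup_set_cvg0 => //; apply: le_lt_trans (weighted_sum PF).
  apply: lee_nneseries => // k _; rewrite -[leLHS]mul1e lee_wpmul2r//.
  by rewrite lee_fin ler1n.
have aeF : {ae P, forall w, exists N, forall k, (N <= k)%N -> ~ F k w}.
  exists (lim_sup_set F); split => //.
    by apply: bigcap_measurable => // k _; apply: bigcup_measurable.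
  move=> w /= nw n _ /=; apply: contrapT => nF; apply: nw; exists n => k nk Fk.
  by apply: nF; exists k.
(* On a path that is eventually outside the failure events the untruncated energies stay bounded, so
   that truncation at level [k] has no effect once [k] exceeds this bound. *)
have path w : measurable_fun `[0, T] (fun s : R => H s w) ->
    (exists N, forall k, (N <= k)%N -> ~ F k w) ->
    [/\ sqintegrable mu `[0, T] (fun s : R => H s w),
     forall k, ~ F k w -> sp_energy (SA k).1 (sp_size (SA k).1) w <=
        2 + 2 * \int[mu]_(s in `[0, T]) (H s w ^+ 2) &
     exists N, forall k, (N <= k)%N -> ~ F k w /\
       ((forall s, sp_val (S k) s w = sp_val (SA k).1 s w) /\
        (forall b t, sp_int (S k) b t w = sp_int (SA k).1 b t w))].
  move=> mHw [N FNw].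
  have B k : ~ F k w -> sqintegrable mu `[0, T] (fun s : R => H s w) /\
      sp_energy (SA k).1 (sp_size (SA k).1) w <=
        2 + 2 * \int[mu]_(s in `[0, T]) (H s w ^+ 2).
    move=> nF; have [_ _ /(_ _ nF)[Dk _]] := SAP k.
    have [h1 _ h3] := simple_sqdist_bound mHw Dk; split => //.
    apply: le_trans h3 _; rewrite lerD2r -[leRHS]mulr1 ler_pM2l//.
    by rewrite invf_le1 ?ltr0n// ler1n.
  have [sH _] := B N (FNw _ (leqnn _)); split => // [k /B[]//|].
  set J := \int[mu]_(s in `[0, T]) (H s w ^+ 2).
  exists (maxn N (Num.trunc (2 + 2 * J)).+1) => k; rewrite geq_max => /andP[Nk Jk].
  have nF := FNw _ Nk; split => //; apply: sp_trunc_id.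
  apply: le_trans (B k nF).2 _; apply/ltW.
  apply: lt_le_trans (truncnS_gt _) _; by rewrite ler_nat.
have aeE : {ae P, forall w, measurable_fun `[0, T] (fun s : R => H s w) /\
    exists N, forall k, (N <= k)%N -> ~ F k w} by apply: filterS2 mH aeF.
have aeH : {ae P, forall w, sqintegrable mu `[0, T] (fun s : R => H s w)}.
  by apply: filterS aeE => w [mw Fw]; case: (path w mw Fw).
have inv0 : (k.+1%:R^-1 : R) @[k --> \oo] --> (0 : R).
  exact: cvg_harmonic.
have aeD : {ae P, forall w,
    \int[mu]_(s in `[0, T]) ((sp_val (S k) s w - H s w) ^+ 2) @[k --> \oo] --> 0}.
  apply: filterS aeE => w [mw Fw]; have [_ _ [N FNw]] := path w mw Fw.
  apply: (@squeeze_cvgr _ _ _ _ (fun=> 0) (fun k : nat => k.+1%:R^-1)) => //; last first.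
    exact: cvg_cst.
  exists N => // k /= Nk; have [nF [ES _]] := FNw _ Nk.
  apply/andP; split; first by apply: Rintegral_ge0 => s _; exact: sqr_ge0.
  have [_ _ /(_ _ nF)[Dk _]] := SAP k.
  have [_ h2 _] := simple_sqdist_bound mw Dk.
  by under eq_Rintegral do rewrite ES.
pose J w := \int[mu]_(s in `[0, T]) (H s w ^+ 2).
(* Measurability of [H] is known along paths only; [J] is measurable in [w] as an almost sure limit
   of energies of adapted simple processes. *)
have aJ : adapted_at G T J.
  apply: (adapted_at_cvg GP (ltW T0) (X_ := fun k => sp_energy (S k) (sp_size (S k)))).
    move=> k; apply: measurable_sum => i; apply: measurable_funM => //.
    apply: measurable_funX; apply: (adapted_at_le GP _ _ (sp_adapted_at GP (ltn_ord i))).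
      exact: sp_time_nonneg (ltnW (ltn_ord i)).
    exact: le_trans (sp_time_mono (ltnW (ltn_ord i)) (leqnn _)) (sp_time_leT _).
  apply: filterS2 aeH aeD => w sH cD.
  have := cvg_Rintegral_mul m0T (fun k => sp_val_sqintegrable (S k) w)
    (fun k => sp_val_sqintegrable (S k) w) sH sH cD cD.
  under eq_fun do under eq_Rintegral do rewrite -expr2.
  under eq_fun do rewrite (sp_val_sqr_integral _ w).2.
  by under eq_Rintegral do rewrite -expr2.
have mJ : measurable_fun setT J := adapted_at_measurable GP (ltW T0) aJ.
have J0 w : 0 <= J w by apply: Rintegral_ge0 => s _; exact: sqr_ge0.
(* The measurable function [J] lies almost surely below [q], so its integral is at most the lower
   integral of [q]. *)
have Joo : (\int[P]_w (J w)%:E < +oo)%E.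
  apply: le_lt_trans qoo; apply: ae_ge0_le_lower_integral => //.
    exact/measurable_EFinP.
  apply: filterS2 aeH Hq => w sH; apply: le_trans.
  rewrite /J /Rintegral fineK//; apply: integrable_fin_num => //; by case: sH.
pose u k w : \bar R := ((k.+1%:R : R)%:E * (\1_(F k) w)%:E)%E.
pose Th w : \bar R := (\sum_(0 <= k <oo) u k w)%E.
have mTh k : measurable_fun setT (u k).
  by apply: emeasurable_funM => //; apply/measurable_EFinP; exact: measurable_indic.
have Th0 k w : (0 <= u k w)%E.
  by rewrite mule_ge0// lee_fin.
have Th_ge0 w : (0 <= Th w)%E by apply: nneseries_ge0 => k _ _.
have mTh' : measurable_fun setT Th by apply: ge0_emeasurable_sum => // k w _ _.
exists S, (fun w => Th w + (2 + 2 * J w)%:E)%E; split => //.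
- apply: integrableD => //.
    apply/integrableP; split => //; under eq_integral do rewrite gee0_abs//.
    rewrite /Th integral_nneseries//; apply: le_lt_trans (weighted_sum PF).
    apply: lee_nneseries => // [k _ _|k _]; first by apply: integral_ge0.
    by rewrite /u ge0_integralZl_EFin// ?integral_indic ?setIT//; apply/measurable_EFinP.
  have iJ : P.-integrable setT (EFin \o J).
    apply/integrableP; split; first exact/measurable_EFinP.
    by under eq_integral do rewrite /= ger0_norm//.
  have := integrableD measurableT (finite_measure_integrable_cst P 2 measurableT)
    (integrableZl measurableT 2 iJ).
  by apply: eq_integrable.
- apply: filterS aeE => w [mw Fw] eps eps0; have [_ _ [N FNw]] := path w mw Fw.
  have /cvgrPdist_le/(_ _ eps0)[N' _ H'] := inv0.
  exists (maxn N N') => // k /=; rewrite geq_max => /andP[Nk N'k] t t0T.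
  have [nF [_ EI]] := FNw _ Nk; have [_ _ /(_ _ nF)[_ Ek]] := SAP k.
  rewrite EI; apply: le_trans (Ek t t0T) _; have := H' k N'k.
  by rewrite sub0r normrN ger0_norm// invr_ge0.
- apply: filterS aeE => w [mw Fw] k; have [_ EB _] := path w mw Fw.
  have [e1 e2] := sp_trunc_energy_le GP (SA k).1 w (ler0n R k).
  have J2 : (0 <= (2 + 2 * J w)%:E)%E by rewrite lee_fin addr_ge0// mulr_ge0.
  have [Fk|nF] := pselect (F k w).
    apply: (@le_trans _ _ (u k w)).
      rewrite /u /indic/= mem_set// mule1 lee_fin; apply: le_trans e1 _.
      by rewrite ler_nat.
    apply: (@le_trans _ _ (Th w)); last by rewrite leeDl.
    rewrite /Th (@nneseriesD1 _ _ k)//; apply: leeDl; exact: nneseries_ge0.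
  apply: (@le_trans _ _ ((2 + 2 * J w)%:E)); last by rewrite leeDr.
  by rewrite lee_fin; apply: le_trans e2 (EB k nF).
Qed.

End approximation.

Lemma cvg_sumr (R : realType) (U I : Type) (F : set_system U) (FF : Filter F)
    (s : seq I) (f_ : U -> I -> R) (f : I -> R) :
  (forall i, f_ m i @[m --> F] --> f i) ->
  \sum_(i <- s) f_ m i @[m --> F] --> \sum_(i <- s) f i.
Proof.
move=> H; elim: s => [|i s IH].
  by rewrite big_nil; under eq_fun do rewrite big_nil; exact: cvg_cst.
by rewrite big_cons; under eq_fun do rewrite big_cons; exact: cvgD.
Qed.

Lemma eq_bounded_variation (R : realType) (a b : R) (f g : R -> R) :
  (forall x, a <= x <= b -> f x = g x) ->
  bounded_variation a b f -> bounded_variation a b g.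
Proof.
move=> fg [c fc]; exists c => _ [s abs <-]; apply: fc; exists s => //.
rewrite /variation; apply: eq_big_nat => k /andP[_ ks] /=.
have h m : (m < (size s).+1)%N -> a <= nth b (a :: s) m <= b.
  by move=> ms; rewrite itv_partition_nth_ge// itv_partition_nth_le.
by rewrite -!fg//; [exact: (h k (ltnW ks))|exact: (h k.+1 ks)].
Qed.

(** * Time integrals along a fixed path *)

Section paths.
Context {R : realType}.
Variables (T : R) (n : nat).
Hypothesis T0 : 0 < T.
Local Notation mu := (@lebesgue_measure R).
Local Notation L2T := (sqintegrable mu `[0, T]).

Let m0T : measurable (`[0, T]%classic : set (measurableTypeR R)).
Proof. exact: measurable_itv. Qed.

Let mst (s t : R) : measurable (`]s, t]%classic : set (measurableTypeR R)).
Proof. exact: measurable_itv. Qed.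

Let sub_itv (s t : R) : 0 <= s -> t <= T ->
  (`]s, t]%classic : set R) `<=` (`[0, T]%classic : set R).
Proof.
move=> s0 tT x /=; rewrite !in_itv/= => /andP[sx xt].
by rewrite (le_trans s0 (ltW sx)) (le_trans xt tT).
Qed.

Lemma sqintegrable_sub (s t : R) (f : R -> R) : 0 <= s -> t <= T ->
  L2T f -> sqintegrable mu `]s, t] f.
Proof.
move=> s0 tT [mf if2]; split; first exact: measurable_funS (sub_itv s0 tT) mf.
by apply: integrableS if2 => //; exact: sub_itv.
Qed.

Lemma le_Rintegral_sub (s t : R) (f : R -> R) : 0 <= s -> t <= T ->
  (forall r, 0 <= f r) -> mu.-integrable `[0, T] (EFin \o f) ->
  \int[mu]_(r in `]s, t]) f r <= \int[mu]_(r in `[0, T]) f r.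
Proof.
move=> s0 tT f0 intf; rewrite /Rintegral fine_le//.
- apply: integrable_fin_num => //; apply: integrableS intf => //; exact: sub_itv.
- exact: integrable_fin_num.
- apply: ge0_subset_integral => //; last exact: sub_itv.
  + by case/integrableP : intf.
  + by move=> r _; rewrite lee_fin.
Qed.

Lemma integrable_sum_mul (s t : R) (f g : 'I_n -> R -> R) : 0 <= s -> t <= T ->
  (forall j, L2T (f j)) -> (forall j, L2T (g j)) ->
  mu.-integrable `]s, t] (EFin \o (fun r : R => \sum_j f j r * g j r)).
Proof.
move=> s0 tT sf sg.
have := integrable_sum (mst s t) (index_enum 'I_n) (P := xpredT)
  (h := fun j => EFin \o (fun r : R => f j r * g j r))
  (fun j _ => sqintegrable_mul (mst s t) (sqintegrable_sub s0 tT (sf j))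
                (sqintegrable_sub s0 tT (sg j))).
by apply: eq_integrable => // r _; rewrite /= sumEFin.
Qed.

Lemma Rintegral_sum_mul (s t : R) (f g : 'I_n -> R -> R) : 0 <= s -> t <= T ->
  (forall j, L2T (f j)) -> (forall j, L2T (g j)) ->
  \int[mu]_(r in `]s, t]) (\sum_j f j r * g j r) =
  \sum_j \int[mu]_(r in `]s, t]) (f j r * g j r).
Proof.
move=> s0 tT sf sg; apply: Rintegral_sum => // j.
by apply: sqintegrable_mul => //; exact: sqintegrable_sub.
Qed.

Lemma cvg_Rintegral_sum_mul (s t : R) (f_ g_ : nat -> 'I_n -> R -> R)
    (f g : 'I_n -> R -> R) : 0 <= s -> t <= T ->
  (forall m j, L2T (f_ m j)) -> (forall m j, L2T (g_ m j)) ->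
  (forall j, L2T (f j)) -> (forall j, L2T (g j)) ->
  (forall j, \int[mu]_(r in `[0, T]) ((f_ m j r - f j r) ^+ 2) @[m --> \oo] --> 0) ->
  (forall j, \int[mu]_(r in `[0, T]) ((g_ m j r - g j r) ^+ 2) @[m --> \oo] --> 0) ->
  \int[mu]_(r in `]s, t]) (\sum_j f_ m j r * g_ m j r) @[m --> \oo] -->
  \int[mu]_(r in `]s, t]) (\sum_j f j r * g j r).
Proof.
move=> s0 tT sf_ sg_ sf sg F G.
have sub (h_ : nat -> 'I_n -> R -> R) (h : 'I_n -> R -> R) j :
    (forall m j, L2T (h_ m j)) -> L2T (h j) ->
    \int[mu]_(r in `[0, T]) ((h_ m j r - h j r) ^+ 2) @[m --> \oo] --> 0 ->
    \int[mu]_(r in `]s, t]) ((h_ m j r - h j r) ^+ 2) @[m --> \oo] --> 0.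
  move=> sh_ sh cv; apply: (squeeze_cvgr _ _ cv); last exact: cvg_cst.
  near=> m; apply/andP; split.
    by apply: Rintegral_ge0 => r _; exact: sqr_ge0.
  apply: (@le_Rintegral_sub s t (fun r => (h_ m j r - h j r) ^+ 2)) => //.
    by move=> r; exact: sqr_ge0.
  by case: (sqintegrableB m0T (sh_ m j) sh).
rewrite Rintegral_sum_mul//.
under eq_fun do rewrite Rintegral_sum_mul//.
apply: cvg_sumr => j; apply: cvg_Rintegral_mul.
- exact: mst.
- by move=> m; exact: sqintegrable_sub.
- by move=> m; exact: sqintegrable_sub.
- exact: sqintegrable_sub.
- exact: sqintegrable_sub.
- exact: sub.
- exact: sub.
Unshelve. all: by end_near. Qed.

(** From |a b| <= a^2 + b^2. The right-hand side is taken over the whole of [[0, T]], so as not to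
    depend on [s] and [t]. *)
Lemma Rintegral_sum_mul_bound (s t : R) (f g : 'I_n -> R -> R) : 0 <= s -> t <= T ->
  (forall j, L2T (f j)) -> (forall j, L2T (g j)) ->
  `|\int[mu]_(r in `]s, t]) (\sum_j f j r * g j r)| <=
  \sum_j (\int[mu]_(r in `[0, T]) (f j r ^+ 2) + \int[mu]_(r in `[0, T]) (g j r ^+ 2)).
Proof.
move=> s0 tT sf sg; rewrite Rintegral_sum_mul//.
apply: le_trans (ler_norm_sum _ _ _) _; apply: ler_sum => j _.
have sf' := sqintegrable_sub s0 tT (sf j); have sg' := sqintegrable_sub s0 tT (sg j).
have ifg := sqintegrable_mul (mst s t) sf' sg'.
have if2 : mu.-integrable `]s, t] (EFin \o (fun r : R => f j r ^+ 2)) by case: sf'.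
have ig2 : mu.-integrable `]s, t] (EFin \o (fun r : R => g j r ^+ 2)) by case: sg'.
apply: (@le_trans _ _ (\int[mu]_(r in `]s, t]) (f j r ^+ 2) +
    \int[mu]_(r in `]s, t]) (g j r ^+ 2))).
  apply: le_trans (le_normr_Rintegral _ _) _ => //.
  rewrite -RintegralD//; apply: le_Rintegral => //.
  - by have := integrable_norm ifg.
  - exact: (integrableD (mst s t) if2 ig2).
  - move=> r _; rewrite normrM -(real_normK (num_real (f j r))).
    rewrite -(real_normK (num_real (g j r))).
    have := normr_ge0 (f j r); have := normr_ge0 (g j r); nra.
apply: lerD; apply: le_Rintegral_sub => //.
- by move=> r; exact: sqr_ge0.
- by case: (sf j).
- by move=> r; exact: sqr_ge0.
- by case: (sg j).
Qed.

(** Writing h = |h| - (|h| - h) makes the primitive a difference of two monotone functions. *)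
Lemma integral_bounded_variation (h : R -> R) :
  mu.-integrable `[0, T] (EFin \o h) ->
  bounded_variation 0 T (fun t => \int[mu]_(r in `[0, t]) h r).
Proof.
move=> ih.
have ia : mu.-integrable `[0, T] (EFin \o (fun r => `|h r|)) := integrable_norm ih.
have id : mu.-integrable `[0, T] (EFin \o (fun r => `|h r| - h r)).
  exact: (integrableB m0T ia ih).
have mono (g : R -> R) : (forall r, 0 <= g r) -> mu.-integrable `[0, T] (EFin \o g) ->
    {in `[0, T] &, {homo (fun t : R => \int[mu]_(r in `[0, t]) g r) : x y / x <= y}}.
  move=> g0 ig x y; rewrite !in_itv/= => /andP[x0 xT] /andP[y0 yT] xy.
  have sub0 (z : R) : z <= T -> (`[0, z]%classic : set R) `<=` (`[0, T]%classic : set R).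
    by move=> zT r /=; rewrite !in_itv/= => /andP[-> /le_trans]; exact.
  have m0 (z : R) : measurable (`[0, z]%classic : set (measurableTypeR R)).
    exact: measurable_itv.
  have iz (z : R) : z <= T -> mu.-integrable `[0, z] (EFin \o g).
    by move=> zT; apply: integrableS ig => //; exact: sub0.
  rewrite /Rintegral fine_le//.
  - by apply: integrable_fin_num => //; exact: iz.
  - by apply: integrable_fin_num => //; exact: iz.
  - apply: ge0_subset_integral => //.
    + by case/integrableP : (iz y yT).
    + by move=> r _; rewrite lee_fin.
    + by move=> r /=; rewrite !in_itv/= => /andP[-> rx]; exact: le_trans rx xy.
have b1 := nondecreasing_bounded_variation (mono _ (fun r => normr_ge0 (h r)) ia).
have d0 r : 0 <= `|h r| - h r by rewrite subr_ge0 ler_norm.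
have b2 := bounded_variationN (nondecreasing_bounded_variation (mono _ d0 id)).
apply: eq_bounded_variation (bounded_variationD T0 b1 b2) => t t0T.
move: t0T => /andP[t0 tT].
have m0t : measurable (`[0, t]%classic : set (measurableTypeR R)).
  exact: measurable_itv.
have st : (`[0, t]%classic : set R) `<=` (`[0, T]%classic : set R).
  by move=> r /=; rewrite !in_itv/= => /andP[-> /le_trans]; exact.
rewrite [LHS]/= -[LHS]/(_ - _) -RintegralB//.
- by apply: eq_Rintegral => r _; rewrite subKr.
- by apply: integrableS ia.
- by apply: integrableS id.
Qed.

(** [b] is continuous within the half-line only; the minimum with [c] maps [[0, T]] into the
    half-line, so the limits are composed within it. *)
Lemma stopped_path_continuous (b : R -> R) (c : R) : 0 <= c ->
  {within `[0, +oo[, continuous b} ->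
  {within `[0, T], continuous (fun t => b (Num.min t c))}.
Proof.
move=> c0 /subspace_continuousP cb; apply/subspace_continuousP => x /=.
rewrite in_itv/= => /andP[x0 xT].
have m0 : 0 <= Num.min x c by rewrite le_min x0.
apply: (@cvg_comp _ _ _ (fun t => Num.min t c) b _
   (within (`[0, +oo[%classic : set R) (nbhs (Num.min x c)))); last first.
  by apply: cb; rewrite /= in_itv/= m0.
have cm : Num.min t c @[t --> x] --> Num.min x c.
  under eq_fun do rewrite minr_absE; rewrite minr_absE.
  apply: cvgM; last exact: cvg_cst.
  apply: cvgB; first by apply: cvgD; [exact: cvg_id|exact: cvg_cst].
  by apply: cvg_norm; apply: cvgB; [exact: cvg_id|exact: cvg_cst].
move=> A wA.
have := cm (fun z : R => (`[0, +oo[%classic : set R) z -> A z) wA.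
rewrite -[X in _ -> X]/(nbhs x (fun y : R => (`[0, T]%classic : set R) y -> A (Num.min y c))).
apply: (@filterS _ (nbhs x)) => y Ay y0T; apply: Ay.
by move: y0T; rewrite /= !in_itv/= andbT le_min c0 => /andP[-> _].
Qed.

Lemma uniform_limit_continuous (f_ : nat -> R -> R) (f : R -> R) :
  (forall k, {within `[0, T], continuous (f_ k)}) ->
  (forall eps, 0 < eps -> \forall k \near \oo,
     forall t, 0 <= t <= T -> `|f_ k t - f t| <= eps) ->
  {within `[0, T], continuous f}.
Proof.
move=> cf H; apply/subspace_continuousP => x xT.
apply/cvgrPdist_le => e e0; have e3 : 0 < e / 3 by rewrite divr_gt0.
have [N _ /(_ N (leqnn _)) HN] := H _ e3.
have xT' : 0 <= x <= T by move: xT; rewrite /= in_itv.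
move/subspace_continuousP : (cf N) => /(_ _ xT)/cvgrPdist_le/(_ _ e3) cN.
near=> y; have yT : 0 <= y <= T by near: y; apply: filterS (withinT _ _) => y /=; rewrite in_itv.
have h1 := HN _ xT'; have h2 := HN _ yT.
have h3 : `|f_ N x - f_ N y| <= e / 3 by near: y; exact: cN.
have -> : f x - f y = - (f_ N x - f x) + (f_ N x - f_ N y) + (f_ N y - f y) by ring.
apply: le_trans (ler_normD _ _) _; have := ler_normD (- (f_ N x - f x)) (f_ N x - f_ N y).
by rewrite normrN; lra.
Unshelve. all: by end_near. Qed.

End paths.

(** * Limits of stochastic integrals *)

Section convergence_in_L2.
Context d (Omega : measurableType d) (R : realType).
Variable P : probability Omega R.
Local Notation L2 := (sqintegrable P setT).

Lemma dominated_Rintegral (f_ : nat -> Omega -> R) (f : Omega -> R)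
    (Phi : Omega -> \bar R) :
  (forall k, measurable_fun setT (f_ k)) -> measurable_fun setT f ->
  {ae P, forall w, f_ k w @[k --> \oo] --> f w} -> P.-integrable setT Phi ->
  {ae P, forall w, forall k, (`|f_ k w|%:E <= Phi w)%E} ->
  P.-integrable setT (EFin \o f) /\
  \int[P]_w f_ k w @[k --> \oo] --> \int[P]_w f w.
Proof.
move=> mf_ mf cf iPhi dom.
have [] := @dominated_convergence _ _ _ P setT measurableT
  (fun k => EFin \o f_ k) (EFin \o f) Phi.
- by move=> k; exact/measurable_EFinP.
- exact/measurable_EFinP.
- by apply: filterS cf => w cw _; apply: cvg_EFin cw; exact: nearW.
- exact: iPhi.
- by apply: filterS dom => w cw k _; exact: cw.
move=> intf _ c; split => //; apply: fine_cvg.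
by rewrite /Rintegral fineK//; exact: integrable_fin_num.
Qed.

(** Square integrability of [U] is part of the conclusion: for a stochastic integral it is not known
    in advance, only the almost sure convergence and the limit of the second moments are. *)
Lemma fatou_sqintegrable (U_ : nat -> Omega -> R) (U : Omega -> R) (c : R) :
  (forall k, L2 (U_ k)) -> measurable_fun setT U ->
  {ae P, forall w, U_ k w @[k --> \oo] --> U w} ->
  \int[P]_w (U_ k w ^+ 2) @[k --> \oo] --> c ->
  L2 U /\ \int[P]_w (U w ^+ 2) <= c.
Proof.
move=> sU_ mU cU cc.
have U0 : (forall (k : nat) (w : Omega), setT w -> 0 <= (U_ k w ^+ 2)%:E)%E.
  by move=> k w _; rewrite lee_fin sqr_ge0.
have mU2 k : measurable_fun setT (fun w => (U_ k w ^+ 2)%:E).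
  by apply/measurable_EFinP/measurable_funX; case: (sU_ k).
have F := fatou P measurableT mU2 U0.
have E : limn_einf (fun k => \int[P]_w (U_ k w ^+ 2)%:E)%E = c%:E.
  apply: (cvg_limn_einf_sup _).1.
  rewrite (_ : (fun k => _) = (fun k => (\int[P]_w (U_ k w ^+ 2))%:E)).
    by apply: cvg_EFin; [exact: nearW|exact: cc].
  apply/funext => k; rewrite /Rintegral fineK//.
  by apply: integrable_fin_num => //; case: (sU_ k).
have L : (\int[P]_w (U w ^+ 2)%:E <= c%:E)%E.
  rewrite -E; apply: le_trans F; apply: ae_ge0_le_lower_integral.
  - exact/measurable_EFinP/measurable_funX.
  - by move=> w; rewrite lee_fin sqr_ge0.
  - move=> w; rewrite limn_einf_lim; apply: lime_ge; first exact: is_cvg_einfs.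
    apply: nearW => m; apply: le_ereal_inf_tmp => _ [k /= _ <-].
    by rewrite lee_fin sqr_ge0.
  - apply: filterS cU => w cw.
    rewrite (_ : limn_einf _ = (U w ^+ 2)%:E)//.
    apply: (cvg_limn_einf_sup _).1; apply: cvg_EFin; first exact: nearW.
    by rewrite expr2; under [X in X @ _]eq_fun do rewrite /= expr2; exact: cvgM.
have pos : (0 <= \int[P]_w (U w ^+ 2)%:E)%E.
  by apply: integral_ge0 => w _; rewrite lee_fin sqr_ge0.
have fin : (\int[P]_w (U w ^+ 2)%:E)%E \is a fin_num.
  by rewrite ge0_fin_numE// (le_lt_trans L)// ltry.
split; last by rewrite /Rintegral -lee_fin fineK.
split => //; apply/integrableP; split; first exact/measurable_EFinP/measurable_funX.
under eq_integral do rewrite gee0_abs ?lee_fin ?sqr_ge0//.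
by rewrite (le_lt_trans L)// ltry.
Qed.

Definition cvg_L2 (F_ : nat -> Omega -> R) (F : Omega -> R) : Prop :=
  [/\ forall k, L2 (F_ k), L2 F &
      \int[P]_w ((F_ k w - F w) ^+ 2) @[k --> \oo] --> 0].

Lemma cvg_L2_mul F_ F H_ H : cvg_L2 F_ F -> cvg_L2 H_ H ->
  \int[P]_w (F_ k w * H_ k w) @[k --> \oo] --> \int[P]_w (F w * H w).
Proof.
by move=> [sF_ sF cF] [sH_ sH cH]; apply: cvg_Rintegral_mul.
Qed.

Lemma cvg_L2_cst F : L2 F -> cvg_L2 (fun=> F) F.
Proof.
move=> sF; split => //; under eq_fun do under eq_Rintegral do rewrite subrr expr0n.
by rewrite /Rintegral integral0; exact: cvg_cst.
Qed.

Lemma cvg_L2B F_ F H_ H : cvg_L2 F_ F -> cvg_L2 H_ H ->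
  cvg_L2 (fun k w => F_ k w - H_ k w) (fun w => F w - H w).
Proof.
move=> [sF_ sF cF] [sH_ sH cH].
have sFk k : L2 (fun w => F_ k w - F w) by exact: sqintegrableB.
have sHk k : L2 (fun w => H_ k w - H w) by exact: sqintegrableB.
split; [by move=> k; exact: sqintegrableB|exact: sqintegrableB|].
apply: (@squeeze_cvgr _ _ _ _ (fun=> 0) (fun k =>
  2 * \int[P]_w ((F_ k w - F w) ^+ 2) + 2 * \int[P]_w ((H_ k w - H w) ^+ 2))).
- apply: nearW => k; apply/andP; split.
    by apply: Rintegral_ge0 => w _; exact: sqr_ge0.
  have i1 : P.-integrable setT (EFin \o (fun w => 2 * (F_ k w - F w) ^+ 2)).
    by case: (sFk k) => _ i; exact: (integrableZl measurableT 2 i).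
  have i2 : P.-integrable setT (EFin \o (fun w => 2 * (H_ k w - H w) ^+ 2)).
    by case: (sHk k) => _ i; exact: (integrableZl measurableT 2 i).
  rewrite -!RintegralZl//; [|by case: (sHk k)|by case: (sFk k)].
  rewrite -RintegralD//; apply: le_Rintegral => //.
  + have : L2 (fun w => (F_ k w - F w) - (H_ k w - H w)) by exact: sqintegrableB.
    move=> [_]; apply: eq_integrable => // w _; congr EFin; ring.
  + exact: (integrableD measurableT i1 i2).
  + move=> w _; have := sqr_ge0 ((F_ k w - F w) + (H_ k w - H w)); nra.
- exact: cvg_cst.
- rewrite -[X in _ --> X]addr0 -[X in _ --> X + _](mulr0 2) -[X in _ --> _ + X](mulr0 2).
  by apply: cvgD; apply: cvgM => //; exact: cvg_cst.
Qed.

Lemma cvg_L2_bounded_mul (X : Omega -> R) F_ F : measurable_fun setT X ->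
  (forall w, `|X w| <= 1) -> cvg_L2 F_ F ->
  cvg_L2 (fun k w => X w * F_ k w) (fun w => X w * F w).
Proof.
move=> mX X1 [sF_ sF cF].
have sX H : L2 H -> L2 (fun w => X w * H w).
  by apply: sqintegrable_bounded_mul => // w _; exact: X1.
split; [by move=> k; exact: sX|exact: sX|].
apply: (squeeze_cvgr _ _ cF); last exact: cvg_cst.
apply: nearW => k; apply/andP; split.
  by apply: Rintegral_ge0 => w _; exact: sqr_ge0.
have sFk : L2 (fun w => F_ k w - F w) by exact: sqintegrableB.
apply: le_Rintegral => //.
- by have [_] := sX _ sFk; apply: eq_integrable => // w _; congr EFin; ring.
- by case: sFk.
- move=> w _; rewrite -mulrBr exprMn -[leRHS]mul1r ler_wpM2r ?sqr_ge0//.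
  by rewrite -real_normK ?num_real// expr_le1.
Qed.

End convergence_in_L2.

(** * Convergence of covariations *)

Section ito_limit.
Context {R : realType} {disp : measure_display} {Omega : measurableType disp}.
Variables (P : probability Omega R) (G : R -> set (set Omega)) (T : R).
Variables (n : nat) (B : 'I_n -> R -> Omega -> R).
Hypotheses (GP : usual_conditions P G) (BP : brownian_motion P G B) (T0 : 0 < T).

Local Notation mu := (@lebesgue_measure R).
Local Notation L2T := (sqintegrable mu `[0, T]).
Local Notation L2 := (sqintegrable P setT).

Let m0T : measurable (`[0, T]%classic : set (measurableTypeR R)).
Proof. exact: measurable_itv. Qed.

(** For stochastic integrals with integrands [f] and [g] this is the increment of their bracket over
    []s, t]]. *)
Definition quad (f g : 'I_n -> R -> Omega -> R) (s t : R) (w : Omega) : R :=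
  \int[mu]_(r in `]s, t]) (\sum_j f j r w * g j r w).

Lemma ae_forall_ord (Q : 'I_n -> Omega -> Prop) :
  (forall j, {ae P, forall w, Q j w}) -> {ae P, forall w, forall j, Q j w}.
Proof.
move=> H; have := @ae_foralln _ _ _ P (fun k w => forall j : 'I_n, val j = k -> Q j w).
have H' k : {ae P, forall w, forall j : 'I_n, val j = k -> Q j w}.
  have [kn|kn] := ltnP k n.
    apply: filterS (H (Ordinal kn)) => w Qw j jk.
    by have -> : j = Ordinal kn by exact: val_inj.
  by apply: nearW => w j jk; move: (ltn_ord j); rewrite jk ltnNge kn.
by move=> /(_ H'); apply: filterS => w Hw j; exact: (Hw j).
Qed.

Definition l2_approx (f_ : nat -> 'I_n -> R -> Omega -> R)
    (f : 'I_n -> R -> Omega -> R) (Phi : Omega -> \bar R) : Prop :=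
  [/\ P.-integrable setT Phi,
    {ae P, forall w, forall m j, L2T (fun r : R => f_ m j r w) /\
       ((\int[mu]_(r in `[0, T]) (f_ m j r w ^+ 2))%:E <= Phi w)%E},
    {ae P, forall w, forall j, L2T (fun r : R => f j r w)} &
    {ae P, forall w, forall j,
       \int[mu]_(r in `[0, T]) ((f_ m j r w - f j r w) ^+ 2) @[m --> \oo] --> 0}].

(** Constant sequences count as approximations: with one argument frozen, here at [f_ m] and in the
    next lemma at the limit, iterated limits become instances of the joint limit in
    [cvg_expectation_quad]. *)
Lemma l2_approx_cst f_ f Phi m : l2_approx f_ f Phi -> l2_approx (fun=> f_ m) (f_ m) Phi.
Proof.
move=> [iPhi bd _ _]; split => //.
- by apply: filterS bd => w bw _ j; exact: bw.
- by apply: filterS bd => w bw j; exact: (bw m j).1.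
- apply: nearW => w j.
  under eq_fun do under eq_Rintegral do rewrite subrr expr0n.
  by rewrite /Rintegral integral0; exact: cvg_cst.
Qed.

(** The energy of the limit inherits the bound [Phi] because it is the limit of the energies. *)
Lemma l2_approx_limit f_ f Phi : l2_approx f_ f Phi -> l2_approx (fun=> f) f Phi.
Proof.
move=> [iPhi bd sf cv]; split => //.
- apply: filterS3 bd sf cv => w bw sw cw _ j; split => //.
  have C := cvg_Rintegral_mul m0T (fun m => (bw m j).1) (fun m => (bw m j).1)
    (sw j) (sw j) (cw j) (cw j).
  have E (h : R -> R) : \int[mu]_(r in `[0, T]) (h r * h r) =
      \int[mu]_(r in `[0, T]) (h r ^+ 2).
    by apply: eq_Rintegral => r _; rewrite expr2.
  rewrite E in C.
  have C' : (\int[mu]_(r in `[0, T]) (f_ m j r w ^+ 2))%:E @[m --> \oo] -->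
      (\int[mu]_(r in `[0, T]) (f j r w ^+ 2))%:E.
    apply: cvg_EFin; first exact: nearW.
    by under [X in X @ _]eq_fun do rewrite /= -E.
  rewrite -(cvg_lim _ C')//; apply: lime_le; first by apply/cvg_ex; eexists; exact: C'.
  by apply: nearW => m /=; exact: (bw m j).2.
- apply: nearW => w j.
  under eq_fun do under eq_Rintegral do rewrite subrr expr0n.
  by rewrite /Rintegral integral0; exact: cvg_cst.
Qed.

(** The time integrals converge path by path; completeness of the filtration transfers adaptedness
    to the limit, and the sum of [Phi w + Psi w] over the components dominates, whence the
    convergence of expectations. *)
Lemma cvg_expectation_quad f_ f g_ g Phi Psi (X : Omega -> R) (s t u : R) :
  0 <= s -> t <= T -> 0 <= u ->
  measurable_fun setT X -> (forall w, `|X w| <= 1) ->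
  l2_approx f_ f Phi -> l2_approx g_ g Psi ->
  (forall m, adapted_at G u (quad (f_ m) (g_ m) s t)) ->
  [/\ adapted_at G u (quad f g s t),
    P.-integrable setT (EFin \o (fun w => X w * quad f g s t w)) &
    \int[P]_w (X w * quad (f_ m) (g_ m) s t w) @[m --> \oo] -->
    \int[P]_w (X w * quad f g s t w)].
Proof.
move=> s0 tT u0 mX X1 [iPhi bf sf cf] [iPsi bg sg cg] aQ.
have cQ : {ae P, forall w, quad (f_ m) (g_ m) s t w @[m --> \oo] --> quad f g s t w}.
  have H1 : {ae P, forall w, (forall m j, L2T (fun r : R => f_ m j r w)) /\
      (forall j, L2T (fun r : R => f j r w))}.
    by apply: filterS2 bf sf => w b1 s1; split => // m j; exact: (b1 m j).1.
  have H2 : {ae P, forall w, (forall m j, L2T (fun r : R => g_ m j r w)) /\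
      (forall j, L2T (fun r : R => g j r w))}.
    by apply: filterS2 bg sg => w b1 s1; split => // m j; exact: (b1 m j).1.
  have H3 : {ae P, forall w,
     (forall j, \int[mu]_(r in `[0, T]) ((f_ m j r w - f j r w) ^+ 2) @[m --> \oo] --> 0) /\
     (forall j, \int[mu]_(r in `[0, T]) ((g_ m j r w - g j r w) ^+ 2) @[m --> \oo] --> 0)}.
    by apply: filterS2 cf cg.
  apply: filterS3 H1 H2 H3 => w [h1 h2] [h3 h4] [h5 h6].
  exact: (@cvg_Rintegral_sum_mul R T n s t (fun m j r => f_ m j r w)
    (fun m j r => g_ m j r w) (fun j r => f j r w) (fun j r => g j r w)).
have aQ' := adapted_at_cvg GP u0 aQ cQ.
have mQ' := adapted_at_measurable GP u0 aQ'.
pose Dom w := (\sum_(j < n) (Phi w + Psi w))%E.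
have iDom : P.-integrable setT Dom.
  apply: (integrable_sum measurableT (index_enum 'I_n) (P := xpredT)
    (h := fun _ w => (Phi w + Psi w)%E)) => j _; exact: integrableD.
have [] := @dominated_Rintegral _ _ _ P (fun m w => X w * quad (f_ m) (g_ m) s t w)
  (fun w => X w * quad f g s t w) Dom.
- move=> m; apply: measurable_funM => //.
  exact: (adapted_at_measurable GP u0 (aQ m)).
- exact: measurable_funM.
- by apply: filterS cQ => w cw; apply: cvgM => //; exact: cvg_cst.
- exact: iDom.
- apply: filterS2 bf bg => w b1 b2 m.
  apply: (@le_trans _ _ (`|quad (f_ m) (g_ m) s t w|%:E)).
    by rewrite lee_fin normrM ler_piMl.
  apply: (@le_trans _ _ (\sum_j (\int[mu]_(r in `[0, T]) (f_ m j r w ^+ 2) +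
      \int[mu]_(r in `[0, T]) (g_ m j r w ^+ 2)))%:E).
    rewrite lee_fin; apply: (@Rintegral_sum_mul_bound R T n s t
      (fun j r => f_ m j r w) (fun j r => g_ m j r w)) => // j.
      exact: (b1 m j).1.
    exact: (b2 m j).1.
  rewrite -sumEFin; apply: lee_sum => j _; rewrite EFinD; apply: leeD.
    exact: (b1 m j).2.
  exact: (b2 m j).2.
by move=> h1 h2; split.
Qed.

Definition vector_approximation (H : 'I_n -> R -> Omega -> R) (Y : R -> Omega -> R)
    (S : nat -> 'I_n -> simple_process G T) (Phi : Omega -> \bar R) : Prop :=
  l2_approx (fun k j s w => sp_val (S k j) s w) H Phi /\
  {ae P, forall w, forall eps, 0 < eps -> \forall k \near \oo,
     forall t, 0 <= t <= T -> `|step_int B (sp_step GP (S k)) t w - Y t w| <= eps}.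

Lemma vector_approximation_exists H Y (q : Omega -> \bar R) :
  ito_integral_sum P G T B H Y ->
  (forall w, (0 <= q w)%E) -> (\int[P]_w q w < +oo)%E ->
  (forall j, {ae P, forall w,
     (\int[mu]_(s in `[0%R, T]) (H j s w ^+ 2)%:E <= q w)%E}) ->
  exists S Phi, vector_approximation H Y S Phi.
Proof.
move=> [Z [HZ YZ]] q0 qoo Hq.
have /choice[SPhi HS] : forall j, exists SPhi : (nat -> simple_process G T) * (Omega -> \bar R),
    ito_approximation P (B j) (H j) (Z j) SPhi.1 SPhi.2.
  move=> j; have [S [Phi H1]] := ito_integral_approximation GP T0 (HZ j) q0 qoo (Hq j).
  by exists (S, Phi).
exists (fun k j => (SPhi j).1 k), (fun w => \sum_j (SPhi j).2 w)%E.
split; first split.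
- apply: (integrable_sum measurableT (index_enum 'I_n) (P := xpredT)
    (h := fun j => (SPhi j).2)) => j _; by case: (HS j).
- have /ae_forall_ord : forall j, {ae P, forall w, forall k,
      ((sp_energy ((SPhi j).1 k) (sp_size ((SPhi j).1 k)) w)%:E <= (SPhi j).2 w)%E}.
    by move=> j; case: (HS j).
  apply: filterS => w Ew m j; split; first exact: sp_val_sqintegrable.
  rewrite (sp_val_sqr_integral _ w).2; apply: le_trans (Ew j m) _.
  (* The other majorants are nonnegative at [w], since each dominates an energy. *)
  rewrite (bigD1 j)//= leeDl//; apply: sume_ge0 => i _.
  apply: le_trans (Ew i 0%N); rewrite lee_fin -(sp_val_sqr_integral _ w).2.
  by apply: Rintegral_ge0 => r _; exact: sqr_ge0.
- by apply: ae_forall_ord => j; case: (HS j).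
- by apply: ae_forall_ord => j; case: (HS j).
have /ae_forall_ord U : forall j, {ae P, forall w, forall eps, 0 < eps ->
    \forall k \near \oo, forall t, 0 <= t <= T ->
      `|sp_int ((SPhi j).1 k) (B j) t w - Z j t w| <= eps}.
  by move=> j; case: (HS j).
apply: filterS2 YZ U => w Yw Uw eps eps0.
(* [n.+1] instead of [n], as there may be no component at all. *)
have epsn : 0 < eps / n.+1%:R by rewrite divr_gt0// ltr0n.
have /choice[N HN] : forall j, exists N, forall k, (N <= k)%N -> forall t, 0 <= t <= T ->
    `|sp_int ((SPhi j).1 k) (B j) t w - Z j t w| <= eps / n.+1%:R.
  by move=> j; have [N _ H1] := Uw j _ epsn; exists N => k Nk; exact: H1.
exists (\max_j N j) => // k /= Nk t t0T.
rewrite step_int_sp Yw// -sumrB; apply: le_trans (ler_norm_sum _ _ _) _.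
apply: (@le_trans _ _ (\sum_(j < n) (eps / n.+1%:R))).
  apply: ler_sum => j _; apply: HN => //; apply: leq_trans Nk.
  exact: (leq_bigmax j).
rewrite sumr_const card_ord -[leLHS]mulr_natr mulrAC.
by rewrite ler_pdivrMr ?ltr0n// ler_pM2l// ler_nat.
Qed.

(** Read off the explicit overlap formula: a coefficient that is not yet known at time [t] belongs
    to an empty clipped interval and is multiplied by 0. *)
Lemma adapted_at_quad_step (L L' : seq (eterm G n)) s t : 0 <= s -> s <= t ->
  adapted_at G t (quad (step_val L) (step_val L') s t).
Proof.
move=> s0 st; have t0 := le_trans s0 st.
have E : quad (step_val L) (step_val L') s t = (fun w =>
  \sum_(e <- L) \sum_(e' <- L')
    (et_idx e == et_idx e')%:R * (et_coef e w * et_coef e' w *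
     Num.max 0 (Num.min (Num.min t (et_hi e)) (Num.min t (et_hi e')) -
       Num.max (Num.min (Num.max (et_lo e) s) (Num.min t (et_hi e)))
         (Num.min (Num.max (et_lo e') s) (Num.min t (et_hi e')))))).
  by apply/funext => w; exact: (@step_val_mul_integral R disp Omega G n L L' s t w s0 st).2.
rewrite E; apply: measurable_sum => e; apply: measurable_sum => e'.
apply: measurable_funM => //.
have [_ _ g1] := et_lo_gap GP e s0 st; have [_ _ g2] := et_lo_gap GP e' s0 st.
have h1 : Num.min t (et_hi e) <= t by rewrite ge_min lexx.
have h2 : Num.min t (et_hi e') <= t by rewrite ge_min lexx.
move: g1 g2; set m := Num.min (Num.max _ _) _; set m' := Num.min (Num.max _ _) _.
move=> g1 g2; have [mh|mh] := ltP m (Num.min t (et_hi e)); last first.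
  rewrite (max_idPl _); last first.
    by rewrite subr_le0 ge_min !le_max mh.
  by under eq_fun do rewrite mulr0; exact: measurable_cst.
have [mh'|mh'] := ltP m' (Num.min t (et_hi e')); last first.
  rewrite (max_idPl _); last first.
    by rewrite subr_le0 ge_min !le_max mh' !orbT.
  by under eq_fun do rewrite mulr0; exact: measurable_cst.
have [sm a1] := g1 mh; have [sm' a2] := g2 mh'.
have a1' : adapted_at G t (et_coef e).
  exact: (adapted_at_le GP (le_trans s0 sm) (le_trans (ltW mh) h1) a1).
have a2' : adapted_at G t (et_coef e').
  exact: (adapted_at_le GP (le_trans s0 sm') (le_trans (ltW mh') h2) a2).
by apply: measurable_funM => //; exact: (measurable_funM a1' a2').
Qed.

Lemma quad_sp (S S' : 'I_n -> simple_process G T) :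
  quad (fun j s w => sp_val (S j) s w) (fun j s w => sp_val (S' j) s w) =
  quad (step_val (sp_step GP S)) (step_val (sp_step GP S')).
Proof.
apply/funext => s; apply/funext => t; apply/funext => w; apply: eq_Rintegral => r _.
by apply: eq_bigr => j _; rewrite !step_val_sp.
Qed.

End ito_limit.

(** * Stochastic integrals as limits in mean square *)

Section ito_martingales.
Context {R : realType} {disp : measure_display} {Omega : measurableType disp}.
Variables (P : probability Omega R) (G : R -> set (set Omega)) (T : R).
Variables (n : nat) (B : 'I_n -> R -> Omega -> R).
Hypotheses (GP : usual_conditions P G) (BP : brownian_motion P G B) (T0 : 0 < T).

Local Notation mu := (@lebesgue_measure R).
Local Notation L2T := (sqintegrable mu `[0, T]).
Local Notation L2 := (sqintegrable P setT).
Local Notation spv S := (fun j s w => sp_val (S j) s w).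
Local Notation I S k t := (step_int B (sp_step GP (S k)) t).

Lemma adapted_at_quad_sp (S S' : 'I_n -> simple_process G T) s t :
  0 <= s -> s <= t -> adapted_at G t (quad (spv S) (spv S') s t).
Proof. by move=> s0 st; rewrite (quad_sp GP); exact: (adapted_at_quad_step GP). Qed.

Lemma expectation_sp_increment_mul (S S' : 'I_n -> simple_process G T) s t X :
  0 <= s -> s <= t -> adapted_at G s X -> bounded_rv X ->
  \int[P]_w (X w * ((step_int B (sp_step GP S) t w - step_int B (sp_step GP S) s w) *
                    (step_int B (sp_step GP S') t w - step_int B (sp_step GP S') s w))) =
  \int[P]_w (X w * quad (spv S) (spv S') s t w).
Proof.
move=> s0 st aX bX; rewrite (expectation_step_increment_mul GP BP)//.
by rewrite (quad_sp GP).
Qed.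

Section approximated.
Variables (H : 'I_n -> R -> Omega -> R) (Y : R -> Omega -> R).
Variables (S : nat -> 'I_n -> simple_process G T) (Phi : Omega -> \bar R).
Hypothesis VA : vector_approximation B GP H Y S Phi.

Let LA : l2_approx P T (fun k => spv (S k)) H Phi. Proof. exact: VA.1. Qed.

Lemma step_int_cvg t : 0 <= t <= T ->
  {ae P, forall w, I S k t w @[k --> \oo] --> Y t w}.
Proof.
move=> t0T; apply: filterS VA.2 => w Uw.
apply/cvgrPdist_le => e e0; have := Uw e e0.
by apply: filterS => k /(_ t t0T); rewrite distrC.
Qed.

Lemma ito_adapted_at t : 0 <= t <= T -> adapted_at G t (Y t).
Proof.
move=> t0T; have t0 : 0 <= t by case/andP: t0T.
apply: (adapted_at_cvg GP t0 _ (step_int_cvg t0T)) => k.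
exact: (adapted_at_step_int GP BP).
Qed.

(** Let a(k, m) be the inner product of the k-th and m-th step integrals. By the isometry a(k, m)
    tends to b_k as m grows, a(m, m) to c, and b_k to c. Fatou's lemma in m bounds the squared
    distance from [Y t] to the k-th integral by c - 2 b_k + a(k, k), which tends to c - 2 c + c =
    0. *)
Lemma step_int_cvg_L2 t : 0 <= t <= T -> cvg_L2 P (fun k => I S k t) (Y t).
Proof.
move=> t0T; have /andP[t0 tT] := t0T.
have s1 : forall w : Omega, `|(fun=> 1 : R) w| <= 1 by move=> w; rewrite normr1.
have m1 : measurable_fun setT (fun _ : Omega => 1 : R) by exact: measurable_cst.
pose E Q := \int[P]_w (1 * Q w).
pose a k m := \int[P]_w (I S k t w * I S m t w).
have aE k m : a k m = E (quad (spv (S k)) (spv (S m)) 0 t).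
  rewrite /E -expectation_sp_increment_mul//; last 2 first.
  - exact: measurable_cst.
  - by exists 1 => w; rewrite normr1.
  by apply: eq_Rintegral => w _; rewrite mul1r !step_int0 !subr0.
pose b k := E (quad (spv (S k)) H 0 t); pose c := E (quad H H 0 t).
have kb : forall i, adapted_at G t (quad (spv (S i)) H 0 t) /\
    (a i m @[m --> \oo] --> b i).
  move=> i.
  have [] := @cvg_expectation_quad _ _ _ P G T n GP _ _ _ _ Phi Phi (fun=> 1) 0 t t
    (lexx _) tT t0 m1 s1 (l2_approx_cst i LA) LA.
    by move=> m; exact: adapted_at_quad_sp.
  by move=> h1 _ h2; split => //; under eq_fun do rewrite aE.
have ac : a m m @[m --> \oo] --> c.
  have [] := @cvg_expectation_quad _ _ _ P G T n GP _ _ _ _ Phi Phi (fun=> 1) 0 t t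
    (lexx _) tT t0 m1 s1 LA LA.
    by move=> m; exact: adapted_at_quad_sp.
  by move=> h1 _ h2; under eq_fun do rewrite aE.
have bc : b k @[k --> \oo] --> c.
  have [] := @cvg_expectation_quad _ _ _ P G T n GP _ _ _ _ Phi Phi (fun=> 1) 0 t t
    (lexx _) tT t0 m1 s1 LA (l2_approx_limit LA).
    by move=> m; exact: (kb m).1.
  by [].
pose d k := c - 2 * b k + a k k.
have sI k : L2 (I S k t) by exact: (sqintegrable_step_int GP BP).
have key k : L2 (fun w => Y t w - I S k t w) /\
    \int[P]_w ((Y t w - I S k t w) ^+ 2) <= d k.
  apply: (@fatou_sqintegrable _ _ _ P (fun m w => I S m t w - I S k t w)).
  - by move=> m; exact: sqintegrableB.
  - apply: measurable_funB; last by case: (sI k).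
    exact: (adapted_at_measurable GP t0 (ito_adapted_at t0T)).
  - by apply: filterS (step_int_cvg t0T) => w cw; apply: cvgB => //; exact: cvg_cst.
  - have -> : (fun m => \int[P]_w ((I S m t w - I S k t w) ^+ 2)) =
        (fun m => a m m - 2 * a k m + a k k).
      apply/funext => m; rewrite /a.
      have i1 := sqintegrable_mul measurableT (sI m) (sI m).
      have i2 := sqintegrable_mul measurableT (sI k) (sI m).
      have i3 := sqintegrable_mul measurableT (sI k) (sI k).
      have i2' : P.-integrable setT (EFin \o (fun w => 2 * (I S k t w * I S m t w))).
        exact: (integrableZl measurableT 2 i2).
      rewrite -RintegralZl// -RintegralB// -RintegralD//; last first.
        exact: (integrableB measurableT i1 i2').
      by apply: eq_Rintegral => w _; ring.
    apply: cvgD; last exact: cvg_cst.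
    by apply: cvgB => //; apply: cvgM; [exact: cvg_cst|exact: (kb k).2].
have sY : L2 (Y t).
  have := sqintegrableD measurableT (key 0%N).1 (sI 0%N).
  by under eq_fun do rewrite subrK.
split => //.
have d0 : d k @[k --> \oo] --> (0 : R).
  have -> : 0 = c - 2 * c + c :> R by ring.
  apply: cvgD => //; apply: cvgB; first exact: cvg_cst.
  by apply: cvgM => //; exact: cvg_cst.
apply: (squeeze_cvgr _ _ d0); last exact: cvg_cst.
apply: nearW => k; apply/andP; split.
  by apply: Rintegral_ge0 => w _; exact: sqr_ge0.
apply: le_trans (key k).2; rewrite le_eqVlt; apply/orP; left; apply/eqP.
by apply: eq_Rintegral => w _; rewrite -sqrrN opprB.
Qed.

Lemma ito_sqintegrable t : 0 <= t <= T -> L2 (Y t).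
Proof. by case/step_int_cvg_L2. Qed.

Lemma expectation_ito_increment s t X : 0 <= s -> s <= t -> t <= T ->
  adapted_at G s X -> L2 X -> \int[P]_w (X w * (Y t w - Y s w)) = 0.
Proof.
move=> s0 st tT aX sX.
have ct : cvg_L2 P (fun k => I S k t) (Y t).
  by apply: step_int_cvg_L2; rewrite (le_trans s0 st).
have cs : cvg_L2 P (fun k => I S k s) (Y s).
  by apply: step_int_cvg_L2; rewrite s0 (le_trans st tT).
have := cvg_L2_mul (cvg_L2_cst sX) (cvg_L2B ct cs).
under eq_fun do rewrite (expectation_step_increment GP BP)//.
by move=> C; apply: cvg_unique C _ => //; exact: cvg_cst.
Qed.

(** Almost every path is a uniform limit on [[0, T]] of step integrals, which are finite
    combinations of Brownian paths stopped at fixed times. *)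
Lemma ito_continuous : continuous_process P `[0, T] Y.
Proof.
have /ae_forall_ord cB : forall j, {ae P, forall w,
    {within `[0, +oo[, continuous (fun t => B j t w)}}.
  by case: BP.
apply: filterS2 VA.2 cB => w Uw Bw.
apply: (uniform_limit_continuous (f_ := fun k t => I S k t w)); last exact: Uw.
move=> k; apply/subspace_continuousP => x xT; apply: cvg_sumr => e.
apply: cvgM; first exact: cvg_cst.
have h0 := le_trans (et_lo_ge0 e) (et_lohi e).
apply: cvgB.
  have /subspace_continuousP := @stopped_path_continuous R T _ _ h0 (Bw (et_idx e)).
  exact.
have /subspace_continuousP := @stopped_path_continuous R T _ _ (et_lo_ge0 e) (Bw (et_idx e)).
exact.
Qed.

End approximated.

Section two_approximated.
Variables (H : 'I_n -> R -> Omega -> R) (Y : R -> Omega -> R).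
Variables (S : nat -> 'I_n -> simple_process G T) (Phi : Omega -> \bar R).
Hypothesis VA : vector_approximation B GP H Y S Phi.
Variables (H' : 'I_n -> R -> Omega -> R) (Y' : R -> Omega -> R).
Variables (S' : nat -> 'I_n -> simple_process G T) (Phi' : Omega -> \bar R).
Hypothesis VA' : vector_approximation B GP H' Y' S' Phi'.

Lemma quad_adapted_integrable s t : 0 <= s -> s <= t -> t <= T ->
  adapted_at G t (quad H H' s t) /\ P.-integrable setT (EFin \o quad H H' s t).
Proof.
move=> s0 st tT; have t0 := le_trans s0 st.
have s1 : forall w : Omega, `|(fun=> 1 : R) w| <= 1 by move=> w; rewrite normr1.
have m1 : measurable_fun setT (fun _ : Omega => 1 : R) by exact: measurable_cst.
have [] := @cvg_expectation_quad _ _ _ P G T n GP _ _ _ _ Phi Phi' (fun=> 1) s t t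
    s0 tT t0 m1 s1 VA.1 VA'.1.
  by move=> m; exact: adapted_at_quad_sp.
move=> h1 h2 _; split => //.
by move: h2; apply: eq_integrable => // w _ /=; rewrite mul1r.
Qed.

(** The isometry for step integrals passes to the limit on both sides: products of increments by
    convergence in mean square, covariations by dominated convergence. *)
Lemma expectation_ito_increment_mul s t X : 0 <= s -> s <= t -> t <= T ->
  adapted_at G s X -> (forall w, `|X w| <= 1) ->
  P.-integrable setT (EFin \o (fun w => X w * quad H H' s t w)) /\
  \int[P]_w (X w * ((Y t w - Y s w) * (Y' t w - Y' s w))) =
  \int[P]_w (X w * quad H H' s t w).
Proof.
move=> s0 st tT aX X1; have t0 := le_trans s0 st.
have mX := adapted_at_measurable GP s0 aX.
have t0T : 0 <= t <= T by rewrite t0.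
have s0T : 0 <= s <= T by rewrite s0 (le_trans st tT).
have [] := @cvg_expectation_quad _ _ _ P G T n GP _ _ _ _ Phi Phi' X s t t
    s0 tT t0 mX X1 VA.1 VA'.1.
  by move=> m; exact: adapted_at_quad_sp.
move=> _ iQ C; split => //.
have := cvg_L2_mul (cvg_L2_bounded_mul mX X1
   (cvg_L2B (step_int_cvg_L2 VA t0T) (step_int_cvg_L2 VA s0T)))
   (cvg_L2B (step_int_cvg_L2 VA' t0T) (step_int_cvg_L2 VA' s0T)).
under eq_Rintegral do rewrite -mulrA.
move=> C'; apply: cvg_unique C' _ => //.
rewrite (_ : (fun k => _) = fun k => \int[P]_w (X w * quad (spv (S k)) (spv (S' k)) s t w))//.
apply/funext => k; rewrite -expectation_sp_increment_mul//; last by exists 1.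
by apply: eq_Rintegral => w _; rewrite mulrA.
Qed.

End two_approximated.

End ito_martingales.

(** * Martingale property and bracket *)

Section ito_isometry_bracket.
Context {R : realType} {disp : measure_display} {Omega : measurableType disp}.
Variables (P : probability Omega R) (G : R -> set (set Omega)) (T : R).
Variables (n : nat) (B : 'I_n -> R -> Omega -> R).
Hypotheses (GP : usual_conditions P G) (BP : brownian_motion P G B) (T0 : 0 < T).

Local Notation mu := (@lebesgue_measure R).
Local Notation L2T := (sqintegrable mu `[0, T]).
Local Notation L2 := (sqintegrable P setT).

Lemma adapted_process (X : R -> Omega -> R) :
  (forall t, 0 <= t <= T -> adapted_at G t (X t)) -> adapted G `[0, T] X.
Proof.
move=> aX t t0T t0; apply/(adapted_atP GP) => //; apply: aX.
by move: t0T; rewrite /= in_itv.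
Qed.

Lemma martingale_of_increments (X : R -> Omega -> R) :
  (forall t, 0 <= t <= T -> adapted_at G t (X t)) ->
  (forall t, 0 <= t <= T -> P.-integrable setT (EFin \o X t)) ->
  (forall s t A, 0 <= s -> s <= t -> t <= T -> G s A ->
    \int[P]_w (\1_A w * (X t w - X s w)) = 0) ->
  martingale P G T X.
Proof.
move=> aX iX mX; split => //; first exact: adapted_process.
move=> s t s0 st tT A GA; have mA := filtration_measurable GP s0 GA.
have iXt : P.-integrable setT (EFin \o X t) by apply: iX; rewrite (le_trans s0 st).
have iXs : P.-integrable setT (EFin \o X s) by apply: iX; rewrite s0 (le_trans st tT).
have iA (Y : Omega -> R) : P.-integrable setT (EFin \o Y) -> P.-integrable A (EFin \o Y).
  by move=> iY; apply: integrableS iY.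
have E : \int[P]_(w in A) (X t w - X s w) = 0.
  rewrite -[RHS](mX s t A s0 st tT GA) Rintegral_mkcond; apply: eq_Rintegral => w _.
  by rewrite patchE /indic; case: (w \in A); rewrite ?mul1r ?mul0r.
rewrite RintegralB// in E; [|exact: iA..].
have fi (Y : Omega -> R) : P.-integrable setT (EFin \o Y) ->
    (\int[P]_(w in A) (Y w)%:E = (\int[P]_(w in A) Y w)%:E)%E.
  by move=> /iA iY; rewrite /Rintegral fineK//; exact: integrable_fin_num.
by rewrite !fi//; congr EFin; move/eqP : E; rewrite subr_eq0 => /eqP.
Qed.

Lemma indic_adapted s A : 0 <= s -> G s A ->
  [/\ adapted_at G s (\1_A : Omega -> R), forall w, `|\1_A w| <= 1 :> R &
      L2 (\1_A : Omega -> R)].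
Proof.
move=> s0 GA; have a1 := adapted_at_indic GP s0 GA.
have b1 w : `|\1_A w| <= 1 :> R by rewrite /indic; case: (w \in A); rewrite ?normr1 ?normr0.
split => //; apply: bounded_sqintegrable; first exact: (adapted_at_measurable GP s0 a1).
by exists 1.
Qed.

Lemma ito_sum_martingale H Y (S : nat -> 'I_n -> simple_process G T) Phi :
  vector_approximation B GP H Y S Phi ->
  continuous_square_integrable_martingale P G T Y.
Proof.
move=> VA; split; first exact: (ito_continuous BP VA).
- move=> t t0T; have [_ iY] := ito_sqintegrable BP VA t0T.
  by rewrite unlock; exact: integrable_lty.
apply: martingale_of_increments => [t t0T|t t0T|s t A s0 st tT GA].
- exact: (ito_adapted_at BP VA).
- by apply: sqintegrable_integrable; exact: (ito_sqintegrable BP VA).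
- have [a1 _ s1] := indic_adapted s0 GA.
  exact: (expectation_ito_increment BP VA).
Qed.

(** With D the increment from s to t, the product satisfies D(Y Y') = DY DY' + Y_s DY' + Y'_s DY.
    Tested against an event of [G s], the last two terms vanish by the martingale property, and the
    isometry matches the first with the increment of the bracket. *)
Lemma ito_sum_bracket H Y (S : nat -> 'I_n -> simple_process G T) Phi
    H' Y' (S' : nat -> 'I_n -> simple_process G T) Phi' :
  vector_approximation B GP H Y S Phi -> vector_approximation B GP H' Y' S' Phi' ->
  is_bracket P G T Y Y' (fun t w =>
    \int[mu]_(s in `[0, t]) (\sum_j H j s w * H' j s w)).
Proof.
move=> VA VA'.
pose A t w := \int[mu]_(s in `[0, t]) (\sum_j H j s w * H' j s w).
have ae2 : {ae P, forall w, (forall j, L2T (fun r : R => H j r w)) /\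
    (forall j, L2T (fun r : R => H' j r w))}.
  by case: VA => [[_ _ sH _] _]; case: VA' => [[_ _ sH' _] _]; apply: filterS2 sH sH'.
have int0 w s t : (forall j, L2T (fun r : R => H j r w)) ->
    (forall j, L2T (fun r : R => H' j r w)) -> 0 <= s -> t <= T ->
    mu.-integrable `]s, t] (EFin \o (fun r : R => \sum_j H j r w * H' j r w)).
  move=> h1 h2 s0 tT.
  exact: (@integrable_sum_mul R T n s t (fun j r => H j r w) (fun j r => H' j r w)).
have intT w : (forall j, L2T (fun r : R => H j r w)) ->
    (forall j, L2T (fun r : R => H' j r w)) ->
    mu.-integrable `[0, T] (EFin \o (fun r : R => \sum_j H j r w * H' j r w)).
  move=> h1 h2.
  have m0T : measurable (`[0, T]%classic : set (measurableTypeR R)).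
    exact: measurable_itv.
  have := integrable_sum m0T (index_enum 'I_n) (P := xpredT)
    (h := fun j => EFin \o (fun r : R => H j r w * H' j r w))
    (fun j _ => sqintegrable_mul m0T (h1 j) (h2 j)).
  by apply: eq_integrable => // r _; rewrite /= sumEFin.
(* [A] integrates over the closed interval from 0 and [quad] over the half-open one; they agree on
   paths with an integrable integrand, hence almost surely, and completeness then makes [A]
   adapted. *)
have Aquad t : 0 <= t <= T -> {ae P, forall w, quad H H' 0 t w = A t w}.
  move=> /andP[t0 tT]; apply: filterS ae2 => w [h1 h2].
  exact: Rintegral_itv_obnd_cbnd (int0 w 0 t h1 h2 (lexx _) tT).
have Aincr s t : 0 <= s -> s <= t -> t <= T ->
    {ae P, forall w, A t w - A s w = quad H H' s t w}.
  move=> s0 st tT; apply: filterS ae2 => w [h1 h2].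
  rewrite /A /quad; have := @Rintegral_itvB R
    (fun r : R => \sum_j H j r w * H' j r w) (BLeft 0) (BRight t) s.
  apply; rewrite ?bnd_simp//.
  apply: integrableS (intT w h1 h2).
  - exact: measurable_itv.
  - exact: measurable_itv.
  - by move=> r /=; rewrite !in_itv/= => /andP[-> /le_trans]; exact.
have aA t : 0 <= t <= T -> adapted_at G t (A t).
  move=> t0T; have /andP[t0 tT] := t0T.
  have [aQ _] := quad_adapted_integrable VA VA' (lexx 0) t0 tT.
  exact: (adapted_at_ae_eq GP t0 aQ (Aquad t t0T)).
have iA t : 0 <= t <= T -> P.-integrable setT (EFin \o A t).
  move=> t0T; have /andP[t0 tT] := t0T.
  have [_ iQ] := quad_adapted_integrable VA VA' (lexx 0) t0 tT.
  have mA := adapted_at_measurable GP t0 (aA t t0T).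
  have /integrableP[mQ lQ] := iQ.
  have mA' : measurable_fun setT (EFin \o A t) by exact/measurable_EFinP.
  apply/integrableP; split; first exact: mA'.
  apply: le_lt_trans lQ; rewrite le_eqVlt; apply/orP; left; apply/eqP.
  apply: (@ae_eq_integral _ _ _ P setT
    (fun w => `|(quad H H' 0 t w)%:E|%E) (fun w => `|(A t w)%:E|%E)) => //.
  - exact: measurableT_comp.
  - exact: measurableT_comp.
  - by apply: filterS (Aquad t t0T) => w /= -> _.
split.
- exact: adapted_process.
- by apply: nearW => w; rewrite set_itv1 Rintegral_set1.
- apply: filterS ae2 => w [h1 h2].
  exact: (parameterized_integral_continuous (ltW T0) (intT w h1 h2)).
- by apply: filterS ae2 => w [h1 h2]; apply: integral_bounded_variation => //; exact: intT.
have sY t : 0 <= t <= T -> L2 (Y t) by exact: (ito_sqintegrable BP VA).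
have sY' t : 0 <= t <= T -> L2 (Y' t) by exact: (ito_sqintegrable BP VA').
apply: martingale_of_increments => [t t0T|t t0T|s t E s0 st tT GE].
- apply: measurable_funB; last exact: aA.
  by apply: measurable_funM; [exact: (ito_adapted_at BP VA)|exact: (ito_adapted_at BP VA')].
- have iYY := sqintegrable_mul measurableT (sY t t0T) (sY' t t0T).
  exact: (integrableB measurableT iYY (iA t t0T)).
have t0T : 0 <= t <= T by rewrite (le_trans s0 st).
have s0T : 0 <= s <= T by rewrite s0 (le_trans st tT).
have [a1 b1 s1] := indic_adapted s0 GE.
have m1 := adapted_at_measurable GP s0 a1.
have s1M Z : L2 Z -> L2 (fun w => \1_E w * Z w).
  by move=> sZ; apply: bounded_mul_sqintegrable => //; exists 1.
have [iq E1] := expectation_ito_increment_mul BP VA VA' s0 st tT a1 b1.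
have sD := sqintegrableB measurableT (sY t t0T) (sY s s0T).
have sD' := sqintegrableB measurableT (sY' t t0T) (sY' s s0T).
have E2 : \int[P]_w (\1_E w * Y s w * (Y' t w - Y' s w)) = 0.
  apply: (expectation_ito_increment BP VA') => //; last exact: s1M (sY s s0T).
  by apply: measurable_funM a1 _; exact: (ito_adapted_at BP VA).
have E3 : \int[P]_w (\1_E w * Y' s w * (Y t w - Y s w)) = 0.
  apply: (expectation_ito_increment BP VA) => //; last exact: s1M (sY' s s0T).
  by apply: measurable_funM a1 _; exact: (ito_adapted_at BP VA').
have i1 : P.-integrable setT (EFin \o (fun w => \1_E w * ((Y t w - Y s w) * (Y' t w - Y' s w)))).
  have := sqintegrable_mul measurableT (s1M _ sD) sD'.
  by apply: eq_integrable => // w _; congr EFin; rewrite mulrA.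
have i2 : P.-integrable setT (EFin \o (fun w => \1_E w * Y s w * (Y' t w - Y' s w))).
  exact: (sqintegrable_mul measurableT (s1M _ (sY s s0T)) sD').
have i3 : P.-integrable setT (EFin \o (fun w => \1_E w * Y' s w * (Y t w - Y s w))).
  exact: (sqintegrable_mul measurableT (s1M _ (sY' s s0T)) sD).
have iDA : P.-integrable setT (EFin \o (fun w => \1_E w * (A t w - A s w))).
  have iAA := integrableB measurableT (iA t t0T) (iA s s0T).
  apply: le_integrable iAA => //.
    apply/measurable_EFinP; apply: measurable_funM => //; apply: measurable_funB.
      by case/integrableP : (iA t t0T) => /measurable_EFinP.
    by case/integrableP : (iA s s0T) => /measurable_EFinP.
  by move=> w _ /=; rewrite lee_fin normrM ler_piMl.
have E4 : \int[P]_w (\1_E w * (A t w - A s w)) = \int[P]_w (\1_E w * quad H H' s t w).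
  rewrite /Rintegral; congr fine; apply: ae_eq_integral => //.
  - by case/integrableP : iDA.
  - by case/integrableP : iq.
  - by apply: filterS (Aincr s t s0 st tT) => w /= -> _.
transitivity (\int[P]_w (\1_E w * ((Y t w - Y s w) * (Y' t w - Y' s w)) +
   \1_E w * Y s w * (Y' t w - Y' s w) + \1_E w * Y' s w * (Y t w - Y s w) -
   \1_E w * (A t w - A s w))).
  by apply: eq_Rintegral => w _; rewrite /A; ring.
have i12 := integrableD measurableT i1 i2.
have i123 := integrableD measurableT i12 i3.
rewrite RintegralB// RintegralD// RintegralD//.
by rewrite E2 E3 E4 E1 !addr0 subrr.
Qed.

End ito_isometry_bracket.

(** * Iterated Lebesgue integrals over simplices *)

Section iterated_integral.
Context {R : realType}.
Local Notation mu := (@lebesgue_measure R).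

Definition coord_measurable d' (Y : measurableType d') n (b : Y -> 'rV[R]_n) :=
  forall i, measurable_fun setT (fun y => b y 0 i).

(* Borel measurability in [x] and [y] jointly, without a sigma-algebra on ['rV_n]. *)
Definition jointly_borel d (X : measurableType d) n (f : X -> 'rV[R]_n -> R) :=
  forall d' (Y : measurableType d') (a : Y -> X) (b : Y -> 'rV[R]_n),
  measurable_fun setT a -> coord_measurable b ->
  measurable_fun setT (fun y => f (a y) (b y)).

Definition borel_fun n (f : 'rV[R]_n -> R) :=
  forall d' (Y : measurableType d') (b : Y -> 'rV[R]_n),
  coord_measurable b -> measurable_fun setT (fun y => f (b y)).

Definition bounded_support (C L : R) n (f : 'rV[R]_n -> R) :=
  forall y, `|f y| <= C /\ forall i, L < `|y 0 i| -> f y = 0.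

Definition rint n (f : 'rV[R]_n -> R) : R := fine (lebesgue_int (EFin \o f)).

Definition cons_row n (t : R) (y : 'rV[R]_n) : 'rV[R]_n.+1 :=
  row_mx (\row_(_ < 1) t) y.

Lemma cons_row0 n t (y : 'rV[R]_n) : cons_row t y 0 0 = t.
Proof.
transitivity (row_mx (\row_(_ < 1) t) y 0 (lshift n 0)); last by rewrite row_mxEl mxE.
by congr (row_mx _ _ _ _); exact/val_inj.
Qed.

Lemma cons_row_lift n t (y : 'rV[R]_n) i : cons_row t y 0 (lift 0 i) = y 0 i.
Proof.
transitivity (row_mx (\row_(_ < 1) t) y 0 (rshift 1 i)); last by rewrite row_mxEr.
by congr (row_mx _ _ _ _); exact/val_inj.
Qed.

Lemma coord_measurable_cons d' (Y : measurableType d') n (a : Y -> R) (b : Y -> 'rV[R]_n) :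
  measurable_fun setT a -> coord_measurable b ->
  coord_measurable (fun y => cons_row (a y) (b y)).
Proof.
move=> ma mb i; have [j ->|->] := unliftP 0 i.
  by rewrite (_ : (fun _ => _) = fun y => b y 0 j)//; apply/funext => y; rewrite cons_row_lift.
by rewrite (_ : (fun _ => _) = a)//; apply/funext => y; rewrite cons_row0.
Qed.

Lemma bounded_support_cons C L n (f : 'rV[R]_n.+1 -> R) t :
  bounded_support C L f -> bounded_support C L (fun y => f (cons_row t y)).
Proof.
move=> fCL y; split; first by have [] := fCL (cons_row t y).
by move=> i Ly; apply: (fCL _).2 (lift 0 i) _; rewrite cons_row_lift.
Qed.

Lemma bounded_integrable_itv (C L : R) (g : R -> R) : 0 <= C -> 0 <= L ->
  measurable_fun setT g -> (forall t, `|g t| <= C) ->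
  (forall t, L < `|t| -> g t = 0) ->
  mu.-integrable setT (EFin \o g) /\ `|\int[mu]_t g t| <= C * (2 * L).
Proof.
move=> C0 L0 mg gC gL.
pose k : R -> R := fun t => C * \1_(`[- L, L]%classic) t.
have ik : mu.-integrable setT (EFin \o k).
  rewrite (_ : EFin \o k = (fun t => C%:E * (EFin \o \1_(`[(- L)%R, L]%classic : set R)) t)%E) //.
  by apply: integrableZl => //; exact: integrable_indic_itv.
have gk (t : R) : `|g t| <= k t.
  rewrite /k indicE mem_setE/= in_itv/=.
  have [Lt|tL] := ltP L `|t|; first by rewrite gL// normr0 mulr_ge0.
  by move: (tL); rewrite ler_norml => ->; rewrite mulr1.
have ig : mu.-integrable setT (EFin \o g).
  apply: le_integrable ik => //; first exact/measurable_EFinP.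
  by move=> t _ /=; rewrite lee_fin (le_trans (gk t))// ler_norm.
split=> //; apply: le_trans (le_normr_Rintegral _ ig) _ => //.
apply: le_trans (le_Rintegral _ _ ik _) _ => //.
- by have := integrable_abse ig.
- rewrite RintegralZl//; last exact: integrable_indic_itv.
  rewrite ler_wpM2l// /Rintegral integral_indic//= setIT lebesgue_measure_itv/=.
  by case: ifP => _ /=; rewrite ?mulr_ge0// opprK; lra.
Qed.

Lemma lebesgue_intS n (f : 'rV[R]_n.+1 -> R) :
  lebesgue_int (EFin \o f) =
  (\int[mu]_t lebesgue_int (EFin \o (fun y => f (cons_row t y))))%E.
Proof. by []. Qed.

Lemma bounded_support_ge0 C L n (f : 'rV[R]_n -> R) : bounded_support C L f -> 0 <= C.
Proof. by move=> /(_ 0)[fC _]; exact: le_trans fC. Qed.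

(** Tonelli's theorem gives measurability for nonnegative integrands, so the positive and negative
    parts are integrated separately and subtracted. *)
Lemma measurable_Rintegral_section d (X : measurableType d)
    (g : X * (measurableTypeR R) -> R) : measurable_fun setT g ->
  (forall x, mu.-integrable setT (fun t => (g (x, t))%:E)) ->
  measurable_fun setT (fun x => \int[mu]_t g (x, t)).
Proof.
move=> mg ig; rewrite /Rintegral.
apply: (@measurableT_comp _ _ _ _ _ _ (@fine R)) => //.
have mg' : measurable_fun setT (EFin \o g) by exact/measurable_EFinP.
have mp : measurable_fun setT (fun z => maxe (g z)%:E 0)%E by exact: measurable_maxe.
have mn : measurable_fun setT (fun z => maxe (- (g z)%:E) 0)%E.
  by apply: measurable_maxe => //; exact: measurableT_comp.
have max_ge0 (u : \bar R) : (0 <= maxe u 0)%E by rewrite le_max lexx orbT.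
rewrite (_ : (fun x => _) = fun x => (fubini_F mu (fun z => maxe (g z)%:E 0) x -
    fubini_F mu (fun z => maxe (- (g z)%:E) 0) x)%E).
  apply: emeasurable_funB.
    exact: (@measurable_fun_fubini_tonelli_F _ _ _ _ R mu _ mp (fun z => max_ge0 _)).
  exact: (@measurable_fun_fubini_tonelli_F _ _ _ _ R mu _ mn (fun z => max_ge0 _)).
apply/funext => x; rewrite integralE /fubini_F.
by congr (_ - _)%E; apply: eq_integral => t _; rewrite ?funeposE ?funenegE.
Qed.

Lemma lebesgue_int0 n : lebesgue_int (EFin \o (fun _ : 'rV[R]_n => 0)) = 0%E.
Proof.
elim: n => [//|n IHn]; rewrite lebesgue_intS.
transitivity (\int[mu]_(t in [set: R]) 0)%E; last by rewrite integral0.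
by apply: eq_integral => t _; rewrite -[RHS]IHn.
Qed.

(* [x] has to be a parameter for the induction on [n] to go through. *)
Lemma lebesgue_int_param C L n : 0 <= C -> 0 <= L ->
  forall d (X : measurableType d) (f : X -> 'rV[R]_n -> R),
  jointly_borel f -> (forall x, bounded_support C L (f x)) ->
  (forall x, lebesgue_int (EFin \o f x) = (rint (f x))%:E /\
             `|rint (f x)| <= C * (2 * L) ^+ n) /\
  measurable_fun setT (fun x => rint (f x)).
Proof.
move=> C0 L0; elim: n => [|n IH] d X f jf bf.
  split=> [x|]; first by rewrite expr0 mulr1; split=> //; have [] := bf x 0.
  rewrite (_ : (fun x => rint (f x)) = fun x => f x 0)//.
  by apply: (jf _ X id (fun=> 0)).
(* The first coordinate joins the parameter, and the induction hypothesis handles the remaining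
   ones. *)
pose f' (z : X * (measurableTypeR R)) (y : 'rV[R]_n) := f z.1 (cons_row z.2 y).
have jf' : jointly_borel f'.
  move=> d' Y a b /measurable_fun_pairP[ma1 ma2] mb.
  by apply: jf => //; exact: coord_measurable_cons.
have bf' z : bounded_support C L (f' z) by exact: bounded_support_cons.
have [IH1 IHm] := IH _ _ f' jf' bf'.
have int0 x t : L < `|t| -> rint (f' (x, t)) = 0.
  move=> Lt; rewrite /rint.
  have -> : f' (x, t) = (fun _ : 'rV[R]_n => 0).
    by apply/funext => y /=; apply: (bf x _).2 0 _; rewrite cons_row0.
  by rewrite lebesgue_int0.
have intE x : lebesgue_int (EFin \o f x) = (\int[mu]_t (rint (f' (x, t)))%:E)%E.
  by rewrite lebesgue_intS; apply: eq_integral => t _; rewrite -(IH1 (x, t)).1.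
have ig x := @bounded_integrable_itv (C * (2 * L) ^+ n) L
  (fun t => rint (f' (x, t))) _ L0 (measurable_fun_pair2 x IHm)
  (fun t => (IH1 (x, t)).2) (@int0 x).
have CL : 0 <= C * (2 * L) ^+ n by rewrite mulr_ge0// exprn_ge0// mulr_ge0.
have rE x : rint (f x) = \int[mu]_t rint (f' (x, t)) by rewrite /rint intE.
split=> [x|].
  rewrite rE; split; last by have := (ig CL x).2; rewrite -mulrA -exprSr.
  rewrite intE /Rintegral fineK//.
  exact: integrable_fin_num (ig CL x).1.
rewrite (_ : (fun x => rint (f x)) = fun x => \int[mu]_t rint (f' (x, t))).
  by apply: (measurable_Rintegral_section IHm) => x; exact: (ig CL x).1.
by apply/funext.
Qed.

End iterated_integral.

(** * Linearity and positivity of iterated integrals *)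

Section compact_integral.
Context {R : realType}.
Local Notation mu := (@lebesgue_measure R).

(** A class stable under linear combinations and under fixing the first coordinate, on which the
    iterated integral is finite at every stage. *)
Definition borel_compact n (f : 'rV[R]_n -> R) :=
  borel_fun f /\ exists C L, 0 <= L /\ bounded_support C L f.

Lemma borel_compact_cons n (f : 'rV[R]_n.+1 -> R) t :
  borel_compact f -> borel_compact (fun y => f (cons_row t y)).
Proof.
move=> [bf [C [L [L0 fCL]]]]; split; last first.
  by exists C, L; split=> //; exact: bounded_support_cons.
by move=> d' Y b mb; apply: bf; exact: coord_measurable_cons.
Qed.

Lemma rint_cons n (f : 'rV[R]_n.+1 -> R) : borel_compact f ->
  mu.-integrable setT (EFin \o (fun t => rint (fun y => f (cons_row t y)))) /\
  rint f = \int[mu]_t rint (fun y => f (cons_row t y)).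
Proof.
move=> [bf [C [L [L0 fCL]]]].
have C0 := bounded_support_ge0 fCL.
pose f' (t : measurableTypeR R) (y : 'rV[R]_n) := f (cons_row t y).
have jf' : jointly_borel f'.
  by move=> d' Y a b ma mb; apply: bf; exact: coord_measurable_cons.
have bf' t : bounded_support C L (f' t) by exact: bounded_support_cons.
have [I1 Im] := lebesgue_int_param C0 L0 jf' bf'.
split.
  have CL : 0 <= C * (2 * L) ^+ n by rewrite mulr_ge0// exprn_ge0// mulr_ge0.
  apply: (bounded_integrable_itv CL L0 Im (fun t => (I1 t).2) _).1 => t Lt.
  rewrite /rint (_ : f' t = (fun _ : 'rV[R]_n => 0)) ?lebesgue_int0//.
  by apply/funext => y /=; apply: (fCL _).2 0 _; rewrite cons_row0.
rewrite /rint lebesgue_intS; congr fine; apply: eq_integral => t _.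
exact: (I1 t).1.
Qed.

Lemma borel_compactD n (f g : 'rV[R]_n -> R) : borel_compact f ->
  borel_compact g -> borel_compact (fun x => f x + g x).
Proof.
move=> [bf [C [L [L0 fCL]]]] [bg [D [M [M0 gDM]]]]; split.
  by move=> d' Y b mb; apply: measurable_funD; [exact: bf|exact: bg].
exists (C + D), (Num.max L M); split; first by rewrite le_max L0.
move=> y; split.
  by rewrite (le_trans (ler_normD _ _))// lerD//; [exact: (fCL y).1|exact: (gDM y).1].
by move=> i; rewrite gt_max => /andP[Ly My]; rewrite ((fCL y).2 i)// ((gDM y).2 i)// addr0.
Qed.

Lemma borel_compactZ n (a : R) (f : 'rV[R]_n -> R) : borel_compact f ->
  borel_compact (fun x => a * f x).
Proof.
move=> [bf [C [L [L0 fCL]]]]; split.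
  move=> d' Y b mb; apply: measurable_funM; [exact: measurable_cst|exact: bf].
exists (`|a| * C), L; split=> // y; split.
  by rewrite normrM ler_wpM2l//; exact: (fCL y).1.
by move=> i Ly; rewrite ((fCL y).2 i)// mulr0.
Qed.

Lemma rintD n (f g : 'rV[R]_n -> R) : borel_compact f -> borel_compact g ->
  rint (fun x => f x + g x) = rint f + rint g.
Proof.
elim: n f g => [//|n IH] f g cf cg.
have [if_ ->] := rint_cons cf; have [ig ->] := rint_cons cg.
have [_ ->] := rint_cons (borel_compactD cf cg).
rewrite -RintegralD//; apply: eq_Rintegral => t _.
by apply: IH; exact: borel_compact_cons.
Qed.

Lemma rintZ n a (f : 'rV[R]_n -> R) : borel_compact f ->
  rint (fun x => a * f x) = a * rint f.
Proof.
elim: n f => [//|n IH] f cf.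
have [if_ ->] := rint_cons cf.
have [_ ->] := rint_cons (borel_compactZ a cf).
rewrite -RintegralZl//; apply: eq_Rintegral => t _.
by apply: IH; exact: borel_compact_cons.
Qed.

Lemma rint_ge0 n (f : 'rV[R]_n -> R) : (forall x, 0 <= f x) -> 0 <= rint f.
Proof.
move=> f0; rewrite /rint fine_ge0//.
elim: n f f0 => [|n IH] f f0; first by rewrite /= lee_fin.
by rewrite lebesgue_intS; apply: integral_ge0 => t _; exact: IH.
Qed.

(** A lower bound on a cube of half-side [del] gains a factor [2 * del] at each one-dimensional
    integration; this is what later makes integrals over a simplex strictly positive. *)
Lemma rint_box_ge n (f : 'rV[R]_n -> R) (c del : R) (z : 'rV[R]_n) :
  borel_compact f -> (forall x, 0 <= f x) -> 0 <= c -> 0 <= del ->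
  (forall x : 'rV[R]_n, (forall i, `|x 0 i - z 0 i| <= del) -> c <= f x) ->
  c * (2 * del) ^+ n <= rint f.
Proof.
move=> cf f0 c0 del0; elim: n f z cf f0 => [|n IH] f z cf f0 fc.
  by rewrite expr0 mulr1 /rint/=; apply: fc => -[].
have [if_ ->] := rint_cons cf.
set a := z 0 0 - del; set b := z 0 0 + del; set k := c * (2 * del) ^+ n.
have ii : mu.-integrable setT (EFin \o \1_(`[a, b]%classic : set R)).
  exact: integrable_indic_itv.
have -> : c * (2 * del) ^+ n.+1 = \int[mu]_t (k * (\1_(`[a, b]%classic : set R) t)).
  rewrite RintegralZl// exprSr mulrA; congr (_ * _).
  rewrite /Rintegral integral_indic//= setIT lebesgue_measure_itv/= lte_fin /a /b.
  by case: ltP => [_|h]; rewrite -?EFinD/=; lra.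
apply: le_Rintegral => //.
  rewrite (_ : EFin \o _ = (fun t => k%:E * (EFin \o \1_(`[a, b]%classic : set R)) t)%E) //.
  exact: integrableZl.
move=> t _; rewrite indicE mem_setE/= in_itv/=.
have [tz|_] := boolP (a <= t <= b); last by rewrite mulr0; exact: rint_ge0.
rewrite mulr1; apply: (IH _ (\row_i z 0 (lift 0 i))) => //; first exact: borel_compact_cons.
move=> x xz; apply: fc => i; have [j ->|->] := unliftP 0 i.
  by have := xz j; rewrite mxE cons_row_lift.
by rewrite cons_row0 ler_distl.
Qed.

End compact_integral.

(** * Locally bounded Borel integrands on bounded sets *)

Section tame.
Context {R : realType}.

(** Polynomials and their positive parts are of this kind. Extended by 0 outside a bounded Borel
    set, such a function becomes [borel_compact]. *)
Definition tame n (f : 'rV[R]_n -> R) := borel_fun f /\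
  forall L : R, exists C, forall y : 'rV[R]_n,
    (forall i, `|y 0 i| <= L) -> `|f y| <= C.

Definition borel_bounded_set n (A : set 'rV[R]_n) :=
  (forall d' (Y : measurableType d') (b : Y -> 'rV[R]_n),
     coord_measurable b -> measurable [set y | A (b y)]) /\
  exists2 L : R, 0 <= L & forall y, A y -> forall i, `|y 0 i| <= L.

Variable n : nat.
Implicit Types (f g : 'rV[R]_n -> R) (A : set 'rV[R]_n).

Lemma tame_cst a : tame (fun _ : 'rV[R]_n => a).
Proof.
split; first by move=> d' Y b mb; exact: measurable_cst.
by move=> L; exists `|a|.
Qed.

Lemma tame_coord i : tame (fun y : 'rV[R]_n => y 0 i).
Proof. by split=> [d' Y b mb|L]; [exact: mb|exists L]. Qed.

Lemma tameD f g : tame f -> tame g -> tame (fun x => f x + g x).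
Proof.
move=> [bf Cf] [bg Cg]; split.
  by move=> d' Y b mb; apply: measurable_funD; [exact: bf|exact: bg].
move=> L; have [C fC] := Cf L; have [D gD] := Cg L; exists (C + D) => y yL.
by rewrite (le_trans (ler_normD _ _))// lerD//; [exact: fC|exact: gD].
Qed.

Lemma tameM f g : tame f -> tame g -> tame (fun x => f x * g x).
Proof.
move=> [bf Cf] [bg Cg]; split.
  by move=> d' Y b mb; apply: measurable_funM; [exact: bf|exact: bg].
move=> L; have [C fC] := Cf L; have [D gD] := Cg L; exists (C * D) => y yL.
by rewrite normrM ler_pM//; [exact: fC|exact: gD].
Qed.

Lemma tameB f g : tame f -> tame g -> tame (fun x => f x - g x).
Proof.
move=> tf tg; rewrite (_ : (fun _ => _) = fun x => f x + (-1) * g x).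
  by apply: tameD => //; apply: tameM => //; exact: tame_cst.
by apply/funext => x; rewrite mulN1r.
Qed.

Lemma tame_sum (I : Type) (s : seq I) (F : I -> 'rV[R]_n -> R) :
  (forall i, tame (F i)) -> tame (fun x => \sum_(i <- s) F i x).
Proof.
move=> tF; elim: s => [|i s IH].
  by under eq_fun do rewrite big_nil; exact: tame_cst.
by under eq_fun do rewrite big_cons; exact: tameD.
Qed.

Lemma tame_prod (I : Type) (s : seq I) (F : I -> 'rV[R]_n -> R) :
  (forall i, tame (F i)) -> tame (fun x => \prod_(i <- s) F i x).
Proof.
move=> tF; elim: s => [|i s IH].
  by under eq_fun do rewrite big_nil; exact: tame_cst.
by under eq_fun do rewrite big_cons; exact: tameM.
Qed.

Lemma tameX f k : tame f -> tame (fun x => f x ^+ k).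
Proof.
move=> tf; elim: k => [|k IH].
  by under eq_fun do rewrite expr0; exact: tame_cst.
by under eq_fun do rewrite exprS; exact: tameM.
Qed.

Lemma tame_max0 f : tame f -> tame (fun x => Num.max (f x) 0).
Proof.
move=> [bf Cf]; split.
  move=> d' Y b mb; apply: measurable_maxr; [exact: bf|exact: measurable_cst].
move=> L; have [C fC] := Cf L; exists C => y yL.
have := fC y yL; case: (leP (f y) 0) => // _.
by rewrite normr0; exact: le_trans.
Qed.

Lemma borel_compact_patch A f : borel_bounded_set A -> tame f ->
  borel_compact (f \_ A).
Proof.
move=> [bA [L L0 AL]] [bf Cf]; split; last first.
  have [C fC] := Cf L; exists (Num.max C 0), L; split=> // y; rewrite patchE.
  case: ifPn => [/set_mem Ay|_].
    split; first by rewrite le_max fC//; exact: AL.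
    by move=> i; rewrite ltNge AL.
  by rewrite normr0 le_max lexx orbT.
move=> d' Y b mb.
rewrite (_ : (fun _ => _) = fun y => f (b y) * \1_[set y | A (b y)] y).
  by apply: measurable_funM; [exact: bf|apply: measurable_indic; exact: bA].
by apply/funext => y; rewrite patch_indic.
Qed.

Lemma int_overE A f : int_over A f = rint (f \_ A).
Proof. by []. Qed.

Lemma int_overD A f g : borel_bounded_set A -> tame f -> tame g ->
  int_over A (fun x => f x + g x) = int_over A f + int_over A g.
Proof.
move=> bA tf tg; rewrite !int_overE -rintD; [|exact: borel_compact_patch..].
by congr rint; apply/funext => x; rewrite !patchE; case: ifP; rewrite ?addr0.
Qed.

Lemma int_overZ A a f : borel_bounded_set A -> tame f ->
  int_over A (fun x => a * f x) = a * int_over A f.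
Proof.
move=> bA tf; rewrite !int_overE -rintZ; last exact: borel_compact_patch.
by congr rint; apply/funext => x; rewrite !patchE; case: ifP; rewrite ?mulr0.
Qed.

Lemma int_over_ge0 A f : (forall x, A x -> 0 <= f x) -> 0 <= int_over A f.
Proof.
move=> f0; rewrite int_overE rint_ge0// => x; rewrite patchE.
by case: ifP => // /set_mem; exact: f0.
Qed.

Lemma le_int_over A f g : borel_bounded_set A -> tame f -> tame g ->
  (forall x, A x -> f x <= g x) -> int_over A f <= int_over A g.
Proof.
move=> bA tf tg fg.
have -> : g = (fun x => f x + (g x - f x)) by apply/funext => x; rewrite subrKC.
rewrite int_overD ?lerDl//; last exact: tameB.
by apply: int_over_ge0 => x /fg; rewrite subr_ge0.
Qed.

Lemma int_over_sum A (I : Type) (s : seq I) (F : I -> 'rV[R]_n -> R) :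
  borel_bounded_set A -> (forall i, tame (F i)) ->
  int_over A (fun x => \sum_(i <- s) F i x) = \sum_(i <- s) int_over A (F i).
Proof.
move=> bA tF; elim: s => [|i s IH].
  rewrite big_nil -[RHS](mul0r (int_over A (fun=> 0))) -int_overZ//; last exact: tame_cst.
  by congr int_over; apply/funext => x; rewrite big_nil mul0r.
rewrite big_cons -IH -int_overD//; last exact: tame_sum.
by congr int_over; apply/funext => x; rewrite big_cons.
Qed.

Lemma int_over_box_gt0 A f (c del : R) (z : 'rV[R]_n) :
  borel_bounded_set A -> tame f -> (forall x, A x -> 0 <= f x) ->
  0 < c -> 0 < del ->
  (forall x : 'rV[R]_n, (forall i, `|x 0 i - z 0 i| <= del) -> A x /\ c <= f x) ->
  0 < int_over A f.
Proof.
move=> bA tf f0 c0 del0 fc; rewrite int_overE.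
have := @rint_box_ge _ _ (f \_ A) c del z (borel_compact_patch bA tf).
move=> /(_ _ (ltW c0) (ltW del0)) H; apply: (lt_le_trans _ (H _ _)).
- by rewrite mulr_gt0// exprn_gt0// mulr_gt0.
- by move=> x; rewrite patchE; case: ifP => // /set_mem; exact: f0.
- by move=> x /fc[Ax cx]; rewrite patchE mem_set.
Qed.

End tame.

(** * Simplices in barycentric coordinates *)

Section simplex.
Context {R : realType} {d : nat}.
Variable v : 'I_d.+1 -> 'rV[R]_d.
Hypothesis av : affinely_independent v.

Let E : 'M[R]_d := \matrix_(j < d) (v (lift ord0 j) - v ord0).

Let barycentric (x : 'rV[R]_d) : 'rV[R]_d := (x - v ord0) *m invmx E.

Let E_unit : E \in unitmx. Proof. by rewrite unitmxE unitfE. Qed.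

(** Coordinates along the edges at vertex 0, computed by inverting the edge matrix, replace the
    existential weights of [face] by finitely many affine inequalities; Borel measurability then
    follows. *)
Lemma simplexP x : simplex v x <->
  (forall j, 0 <= barycentric x 0 j) /\ \sum_j barycentric x 0 j <= 1.
Proof.
have EE (c : 'rV[R]_d) : c *m E = \sum_j c 0 j *: (v (lift ord0 j) - v ord0).
  rewrite mulmx_sum_row; apply: eq_bigr => j _; congr (_ *: _).
  by apply/rowP => k; rewrite !mxE.
split.
  move=> [a [a0 _ a1 ->]].
  have -> : barycentric (\sum_i a i *: v i) = \row_j a (lift ord0 j).
    apply: (canLR (mulmxK E_unit)); rewrite EE.
    under [RHS]eq_bigr do rewrite mxE scalerBr.
    rewrite sumrB -scaler_suml big_ord_recl/=.
    have -> : \sum_(i < d) a (lift ord0 i) = 1 - a ord0.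
      by rewrite -a1 big_ord_recl addrC addKr.
    by rewrite scalerBl scale1r opprB [X in X - _]addrC -addrA.
  split=> [j|]; first by rewrite mxE.
  under eq_bigr do rewrite mxE.
  by rewrite -a1 [leRHS]big_ord_recl lerDr.
move=> [c0 c1].
exists (fun i => if unlift ord0 i is Some j then barycentric x 0 j
                 else 1 - \sum_j barycentric x 0 j); split.
- by move=> i; case: unliftP => [j _|_]; rewrite ?subr_ge0.
- by move=> i; rewrite inE.
- rewrite big_ord_recl unlift_none.
  rewrite [X in _ + X](eq_bigr (fun j => barycentric x 0 j)) ?subrK//.
  by move=> j _; rewrite liftK.
- rewrite big_ord_recl unlift_none.
  rewrite [X in _ + X](eq_bigr (fun j => barycentric x 0 j *: v (lift ord0 j))); last first.
    by move=> j _; rewrite liftK.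
  have : x - v ord0 = \sum_j barycentric x 0 j *: (v (lift ord0 j) - v ord0).
    by rewrite -EE mulmxKV.
  have -> : \sum_j barycentric x 0 j *: (v (lift ord0 j) - v ord0) =
      \sum_j barycentric x 0 j *: v (lift ord0 j) - (\sum_j barycentric x 0 j) *: v ord0.
    by rewrite scaler_suml -sumrB; apply: eq_bigr => j _; rewrite scalerBr.
  move/(canRL (subrK _)) => {1}->.
  by rewrite scalerBl scale1r addrAC -addrA addrC.
Qed.

Lemma borel_sublevel (f : 'rV[R]_d -> R) d' (Y : measurableType d') (b : Y -> 'rV[R]_d) a :
  borel_fun f -> coord_measurable b -> measurable [set y | f (b y) <= a].
Proof.
move=> bf mb.
have := @measurable_fun_ler _ _ _ _ _ _ (bf _ _ _ mb) (measurable_cst a).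
move=> /(_ measurableT [set true]); rewrite setTI => /(_ _).
exact.
Qed.

Lemma tame_barycentric j : tame (fun x => barycentric x 0 j).
Proof.
under eq_fun do rewrite mxE.
apply: tame_sum => i; apply: tameM; last exact: tame_cst.
under eq_fun do rewrite !mxE.
by apply: tameB; [exact: tame_coord|exact: tame_cst].
Qed.

Lemma borel_bounded_simplex : borel_bounded_set (simplex v).
Proof.
split=> [d' Y b mb|].
  rewrite (_ : [set y | _] = (\bigcap_(j in [set: 'I_d]) [set y | - barycentric (b y) 0 j <= 0])
    `&` [set y | \sum_j barycentric (b y) 0 j <= 1]).
    apply: measurableI.
      apply: fin_bigcap_measurable => // j _.
      apply: (borel_sublevel (f := fun x => - barycentric x 0 j)) => //.
      have [] // := tameB (tame_cst _ 0) (tame_barycentric j).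
      by under eq_fun do rewrite sub0r.
    apply: (borel_sublevel (f := fun x => \sum_j barycentric x 0 j)) => //.
    by have [] := @tame_sum _ _ _ (index_enum 'I_d) _ tame_barycentric.
  apply/seteqP; split=> [y /= /simplexP[c0 c1]|y /= [c0 c1]].
    by split=> // j _ /=; rewrite oppr_le0.
  by apply/simplexP; split=> // j; have := c0 j I; rewrite /= oppr_le0.
exists (\sum_i \sum_k `|v i 0 k|).
  by apply: sumr_ge0 => i _; apply: sumr_ge0.
move=> y [a [a0 _ a1 ->]] k; rewrite summxE.
apply: le_trans (ler_norm_sum _ _ _) _; apply: ler_sum => i _; rewrite mxE normrM.
rewrite ger0_norm// (bigD1 k)//= -[leLHS]addr0 lerD//; last exact: sumr_ge0.
rewrite ler_piMl// -a1 (bigD1 i)//= lerDl; exact: sumr_ge0.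
Qed.

(** The cube is centred at the barycentre, whose coordinates are all c = 1 / (d + 1). A displacement
    of size del changes the coordinates by at most del S <= c in total, which keeps each of them
    nonnegative and the sum of those along the edges at most d c + c = 1. *)
Lemma simplex_box : exists (z : 'rV[R]_d) (del : R), 0 < del /\
  forall x : 'rV[R]_d, (forall i, `|x 0 i - z 0 i| <= del) -> simplex v x.
Proof.
pose c : R := d.+1%:R^-1.
have c0 : 0 < c by rewrite invr_gt0.
pose z := v ord0 + const_mx c *m E.
have zb : barycentric z = const_mx c by rewrite /barycentric addrC addKr mulmxK.
pose S := \sum_j \sum_i `|invmx E i j|.
have S0 : 0 <= S by apply: sumr_ge0 => j _; apply: sumr_ge0.
exists z, (c / (S + 1)); split; first by rewrite divr_gt0// ltr_wpDl.
move=> x xz; set del := c / (S + 1) in xz.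
have del0 : 0 <= del by rewrite divr_ge0 ?(ltW c0)// addr_ge0.
have dS : del * S <= c.
  rewrite /del mulrAC ler_pdivrMr ?ltr_wpDl// ler_wpM2l ?(ltW c0)//; lra.
pose e j := barycentric x 0 j - c.
have eE j : e j = \sum_i (x - z) 0 i * invmx E i j.
  have -> : e j = (barycentric x - barycentric z) 0 j by rewrite zb mxE; congr (_ + _); rewrite !mxE.
  by rewrite -mulmxBl opprB addrA subrK mxE.
have ej j : `|e j| <= del * \sum_i `|invmx E i j|.
  rewrite eE mulr_sumr; apply: le_trans (ler_norm_sum _ _ _) _; apply: ler_sum => i _.
  by rewrite normrM ler_wpM2r//; have := xz i; rewrite !mxE.
apply/simplexP; split=> [j|].
  have : `|e j| <= c.
    apply: le_trans (ej j) (le_trans _ dS); rewrite ler_wpM2l// /S [leRHS](bigD1 j)//= lerDl.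
    by apply: sumr_ge0 => k _; apply: sumr_ge0.
  by rewrite ler_norml /e => /andP[]; lra.
have -> : \sum_j barycentric x 0 j = \sum_j e j + d%:R * c.
  rewrite /e sumrB sumr_const card_ord mulr_natl; lra.
have : \sum_j e j <= c.
  apply: le_trans dS; rewrite mulr_sumr; apply: ler_sum => j _.
  exact: le_trans (ler_norm _) (ej j).
have : (d.+1)%:R * c = 1 by rewrite mulfV// pnatr_eq0.
rewrite -natr1 mulrDl mul1r; lra.
Qed.

End simplex.

(** * Broken polynomial spaces *)

Section polynomial_identity.
Context {R : realType} {d l : nat}.
Implicit Types (c : monomial d l -> R) (x z : 'rV[R]_d).

Definition polyfun c x : R := \sum_m c m * \prod_(i < d) x 0 i ^+ val m i.

Lemma poly_infinite_roots (q : {poly R}) (g : nat -> R) :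
  injective g -> (forall k, q.[g k] = 0) -> q = 0.
Proof.
move=> gi gq; apply/eqP/negPn/negP => q0.
have /(_ (mkseq g (size q)) _ _) := max_poly_roots q0.
rewrite size_mkseq ltnn => H; suff : false by []; apply: H; last exact: mkseq_uniq.
by apply/allP => _ /mapP[k _ ->]; rewrite /root gq.
Qed.

Lemma polyfun_line c z u : exists q : {poly R}, forall t, q.[t] = polyfun c (z + t *: u).
Proof.
exists (\sum_m c m *: \prod_(i < d) ((z 0 i)%:P + (u 0 i) *: 'X) ^+ val m i) => t.
rewrite horner_sum; apply: eq_bigr => m _; rewrite hornerZ horner_prod; congr (_ * _).
by apply: eq_bigr => i _; rewrite horner_exp !hornerE !mxE mulrC.
Qed.

(* Along each line through [z] a univariate polynomial has infinitely many roots. *)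
Lemma polyfun_eq0_box c z (del : R) : 0 < del ->
  (forall x, (forall i, `|x 0 i - z 0 i| < del) -> polyfun c x = 0) ->
  forall x, polyfun c x = 0.
Proof.
move=> del0 H x; have [q qE] := polyfun_line c z (x - z).
suff q0 : q = 0 by have := qE 1; rewrite q0 horner0 scale1r subrKC.
pose S := \sum_i `|(x - z) 0 i|.
have S0 : 0 <= S by apply: sumr_ge0.
have S1 : 0 < S + 1 by rewrite ltr_wpDl.
apply: (@poly_infinite_roots _ (fun k => del / (S + 1) / k.+1%:R)) => [k k'|k].
  move/mulfI => /(_ (lt0r_neq0 (divr_gt0 del0 S1)))/invr_inj/eqP.
  by rewrite eqr_nat => /eqP[].
rewrite qE; apply: H => i; rewrite mxE addrAC subrr add0r mxE normrM.
rewrite ger0_norm; last by rewrite !divr_ge0// ?(ltW del0) ?(ltW S1).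
have ui : `|(x - z) 0 i| < S + 1.
  by rewrite ltr_pwDr// /S (bigD1 i)//= lerDl sumr_ge0.
have : `|(x - z) 0 i| / (S + 1) / k.+1%:R < 1.
  by rewrite !ltr_pdivrMr// mul1r (lt_le_trans ui)// ler_peMl ?(ltW S1)// ler1n.
rewrite -(ltr_pM2l del0) mulr1; apply: le_lt_trans.
by rewrite le_eqVlt; apply/orP; left; apply/eqP; field; rewrite (lt0r_neq0 S1) addrC natr1 pnatr_eq0.
Qed.

(** Uniqueness of the digits in base [N], the first one being the remainder modulo [N]. It keeps
    distinct monomials apart under Kronecker's substitution. *)
Lemma digits_inj n N (a b : 'I_n -> nat) :
  (forall i, a i < N)%N -> (forall i, b i < N)%N ->
  (\sum_i a i * N ^ i = \sum_i b i * N ^ i)%N -> forall i, a i = b i.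
Proof.
elim: n a b => [|n IH] a b aN bN E i; first by case: i.
have N0 : (0 < N)%N by exact: leq_ltn_trans (aN i).
have rec (u : 'I_n.+1 -> nat) :
    (\sum_i u i * N ^ i = u ord0 + (\sum_(i < n) u (lift ord0 i) * N ^ i) * N)%N.
  rewrite big_ord_recl expn0 muln1 big_distrl/=; congr addn.
  by apply: eq_bigr => j _; rewrite /bump/= expnSr mulnA.
move: E; rewrite !rec => E.
have E0 : a ord0 = b ord0.
  by have := congr1 (modn^~ N) E; rewrite /= ![(_ ord0 + _)%N]addnC !modnMDl !modn_small.
have [j ->|->//] := unliftP ord0 i.
apply: (IH (a \o lift ord0) (b \o lift ord0)) => [k|k|] /=; [exact: aN|exact: bN|].
by move: E; rewrite E0 => /addnI/eqP; rewrite eqn_pmul2r// => /eqP.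
Qed.

(* Kronecker's substitution [x_i = s ^ ((l + 1) ^ i)]. *)
Lemma polyfun_eq0_coef c : (forall x, polyfun c x = 0) -> forall m, c m = 0.
Proof.
move=> H m.
pose e (m : monomial d l) := (\sum_(i < d) val m i * l.+1 ^ i)%N.
have e_inj : injective e.
  move=> m1 m2 E; apply/val_inj/ffunP => i; apply/val_inj.
  by apply: (@digits_inj d l.+1 (fun i => val m1 i) (fun i => val m2 i)) => // j;
    exact: ltn_ord.
pose q : {poly R} := \sum_m c m *: 'X^(e m).
have q0 : q = 0.
  apply: (@poly_infinite_roots _ (fun k => k%:R)) => [k k' /eqP|k].
    by rewrite eqr_nat => /eqP.
  rewrite -[RHS](H (\row_i k%:R ^+ (l.+1 ^ i))) horner_sum; apply: eq_bigr => m' _.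
  rewrite hornerZ hornerXn; congr (_ * _); rewrite /e -prodrXr.
  by apply: eq_bigr => i _; rewrite mxE -exprM mulnC.
have := congr1 (fun r : {poly R} => r`_(e m)) q0; rewrite coef0 coef_sum.
rewrite (bigD1 m)//= coefZ coefXn eqxx mulr1 big1 ?addr0//.
by move=> m' m'm; rewrite coefZ coefXn (inj_eq e_inj) eq_sym (negbTE m'm) mulr0.
Qed.

Lemma cvg_polyfun (U : Type) (F : set_system U) (FF : Filter F) c (y_ : U -> 'rV[R]_d) x :
  (forall i, y_ u 0 i @[u --> F] --> x 0 i) ->
  polyfun c (y_ u) @[u --> F] --> polyfun c x.
Proof.
move=> yx; apply: cvg_sumr => m; apply: cvgM; first exact: cvg_cst.
suff H (s : seq 'I_d) : \prod_(i <- s) y_ u 0 i ^+ val m i @[u --> F] -->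
    \prod_(i <- s) x 0 i ^+ val m i by exact: H.
elim: s => [|i s IH].
  by rewrite big_nil; under eq_fun do rewrite big_nil; exact: cvg_cst.
rewrite big_cons; under eq_fun do rewrite big_cons; apply: cvgM => //.
elim: (nat_of_ord _) => [|k IHk]; first exact: cvg_cst.
by rewrite exprS; under eq_fun do rewrite exprS; apply: cvgM; first exact: yx.
Qed.

Lemma continuous_polyfun c : continuous (polyfun c).
Proof.
move=> x; apply: (cvg_polyfun (nbhs_filter x)) => i; exact: coord_continuous.
Qed.

(** If the polynomial were nonzero at a point of a small box, its square would be bounded below on a
    cube inside the simplex and the integral of [f] would be positive. Comparison with [f], rather
    than equality, lets a single component of a vector field be isolated. *)
Lemma int_simplex_eq0_coef (v : 'I_d.+1 -> 'rV[R]_d) (f : 'rV[R]_d -> R) c :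
  affinely_independent v -> tame f -> (forall x, polyfun c x ^+ 2 <= f x) ->
  int_over (simplex v) f = 0 -> forall m, c m = 0.
Proof.
move=> av tf cf f0; apply: polyfun_eq0_coef.
have [z [del [del0 zS]]] := simplex_box av.
(* Halving the box leaves room, inside the simplex, for a cube of half-side [del / 2] around each of
   its points. *)
have d20 : 0 < del / 2 by rewrite divr_gt0.
apply: (@polyfun_eq0_box c z _ d20) => x xz.
apply/eqP/negPn/negP => Px0.
have P0 : 0 < `|polyfun c x| / 2 by rewrite divr_gt0// normr_gt0.
have /cvgrPdist_lt/(_ _ P0)/nbhs_ballP[e /= e0 xe] := @continuous_polyfun c x.
suff : 0 < int_over (simplex v) f by rewrite f0 ltxx.
apply: (@int_over_box_gt0 _ _ _ _ ((`|polyfun c x| / 2) ^+ 2) (Num.min (e / 2) (del / 2)) x) => //.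
- exact: borel_bounded_simplex.
- by move=> y _; apply: le_trans (cf y); exact: sqr_ge0.
- by rewrite exprn_gt0.
- by rewrite lt_min d20 divr_gt0.
move=> y xy; split.
  apply: zS => i; have := xy i; rewrite le_min => /andP[_ yx].
  rewrite (_ : y 0 i - z 0 i = (y 0 i - x 0 i) + (x 0 i - z 0 i)); last by ring.
  by rewrite (le_trans (ler_normD _ _))// [leRHS](splitr del) lerD// ltW.
apply: le_trans (cf y); rewrite -[leRHS]real_normK ?num_real// ler_sqr ?nnegrE ?(ltW P0)//.
have /xe : ball x e y.
  split=> // i j; rewrite (ord1 i) /ball/= distrC; have := xy j.
  by rewrite le_min => /andP[h _]; apply: le_lt_trans h _; rewrite ltr_pdivrMr//; lra.
move=> /= h; have := ler_normD (polyfun c x - polyfun c y) (polyfun c y).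
by rewrite subrK; lra.
Qed.

End polynomial_identity.

(** * Polynomial functions and their derivatives *)

Section polynomial_functions.
Context {R : realType} {d : nat}.
Implicit Types (x : 'rV[R]_d) (F : 'rV[R]_d -> R).

Definition polynomial_fun l F := exists c : monomial d l -> R, F =1 polyfun c.

Lemma polynomial_fun_sum l (I : Type) (s : seq I) (F : I -> 'rV[R]_d -> R) :
  (forall i, polynomial_fun l (F i)) ->
  polynomial_fun l (fun x => \sum_(i <- s) F i x).
Proof.
move=> pF; elim: s => [|i s [c cE]].
  by exists (fun=> 0) => x; rewrite big_nil /polyfun big1// => m _; rewrite mul0r.
have [b bE] := pF i; exists (fun m => b m + c m) => x.
rewrite big_cons cE bE /polyfun -big_split/=; apply: eq_bigr => m _.
by rewrite mulrDl.
Qed.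

Lemma polynomial_funZ l a F : polynomial_fun l F -> polynomial_fun l (fun x => a * F x).
Proof.
move=> [c cE]; exists (fun m => a * c m) => x; rewrite cE /polyfun mulr_sumr.
by apply: eq_bigr => m _; rewrite mulrA.
Qed.

Lemma polynomial_fun_monomial l (e : 'I_d -> nat) : (\sum_j e j <= l)%N ->
  polynomial_fun l (fun x => \prod_j x 0 j ^+ e j).
Proof.
move=> el.
have ej j : (e j < l.+1)%N by rewrite ltnS (leq_trans _ el)// (bigD1 j)//= leq_addr.
pose g : {ffun 'I_d -> 'I_l.+1} := [ffun j => inord (e j)].
have gE j : g j = e j :> nat by rewrite ffunE inordK.
have gl : (\sum_i g i <= l)%N by under eq_bigr do rewrite gE.
pose m0 : monomial d l := Sub g gl.
exists (fun m => (m == m0)%:R) => x; rewrite /polyfun (bigD1 m0)//= eqxx mul1r.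
rewrite [X in _ + X]big1 ?addr0; last by move=> m /negbTE ->; rewrite mul0r.
by apply: eq_bigr => j _; rewrite gE.
Qed.

Lemma polyfun_derive p (c : monomial d p -> R) i :
  polynomial_fun p.-1 (fun x => 'D_(delta_mx 0 i) (polyfun c) x).
Proof.
(* For [m_i = 0] the subtraction is truncated, but the coefficient is then [0]. *)
pose D (m : monomial d p) x := \prod_(j < d) x 0 j ^+ (val m j - (j == i)).
suff DE x : 'D_(delta_mx 0 i) (polyfun c) x = \sum_m c m * (val m i)%:R * D m x.
  rewrite (_ : (fun x => _) = fun x => \sum_m c m * (val m i)%:R * D m x); last exact/funext.
  apply: polynomial_fun_sum => m.
  have [mi0|mi0] := posnP (val m i).
    exists (fun=> 0) => x; rewrite mi0 mulr0 mul0r /polyfun big1// => m' _; exact: mul0r.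
  apply: polynomial_funZ; apply: polynomial_fun_monomial.
  rewrite -ltnS (leq_trans _ (leqSpred _))//; apply: leq_trans (valP m).
  rewrite -addn1 [leqRHS](eq_bigr (fun j => (val m j - (j == i)) + (j == i))%N).
    by rewrite big_split leq_add2l (bigD1 i)//= eqxx leq_addr.
  by move=> j _; rewrite subnK//; case: eqP => // ->.
(* [q] is the polynomial restricted to the line through [x] in direction [i]; the directional
   derivative is its algebraic derivative at 0. *)
pose q : {poly R} := \sum_m (c m * \prod_(j < d | j != i) x 0 j ^+ val m j) *:
  ('X + (x 0 i)%:P) ^+ val m i.
have qE h : q.[h] = polyfun c (h *: delta_mx 0 i + x).
  rewrite /q horner_sum; apply: eq_bigr => m _.
  rewrite hornerZ horner_exp !hornerE [in RHS](bigD1 i)//= mulrAC -mulrA; congr (_ * _).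
  rewrite !mxE !eqxx mulr1; congr (_ * _); apply: eq_bigr => j ji.
  by rewrite !mxE eqxx (negbTE ji) mulr0 add0r.
have -> : 'D_(delta_mx 0 i) (polyfun c) x = (horner q)^`()%classic 0.
  rewrite /derive /derive1; set f1 := (fun _ => _); set f2 := (fun _ => _).
  suff -> : f1 = f2 by [].
  apply/funext => h; rewrite /f1 /f2 /=.
  by rewrite !qE scale0r add0r addr0.
rewrite -derivE /q raddf_sum horner_sum; apply: eq_bigr => m _.
rewrite /= derivZ deriv_exp derivD derivX derivC addr0 mul1r.
rewrite hornerZ hornerMn horner_exp !hornerE -mulr_natl -!mulrA.
congr (_ * _); rewrite mulrCA; congr (_ * _).
rewrite /D [in RHS](bigD1 i)//= eqxx subn1 mulrC; congr (_ * _).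
by apply: eq_bigr => j /negbTE ->; rewrite subn0.
Qed.

End polynomial_functions.

(** * Integrals over the mesh *)

Section broken_integral.
Context {R : realType} {d : nat} (M : mesh R d).

Definition mesh_int (f : broken M) : R :=
  \sum_K int_over (simplex (vtx K)) (f K).

Definition tame_broken (f : broken M) := forall K, tame (f K).

Definition tame_vbroken (F : vbroken M) :=
  forall i, tame_broken (fun K x => F K x 0 i).

Let bs K : borel_bounded_set (simplex (vtx (m := M) K)) :=
  borel_bounded_simplex (@mesh_affine _ _ M K).

Lemma mesh_intD f g : tame_broken f -> tame_broken g ->
  mesh_int (fun K x => f K x + g K x) = mesh_int f + mesh_int g.
Proof.
by move=> tf tg; rewrite /mesh_int -big_split; apply: eq_bigr => K _; exact: int_overD.
Qed.

Lemma mesh_intZ a f : tame_broken f ->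
  mesh_int (fun K x => a * f K x) = a * mesh_int f.
Proof.
by move=> tf; rewrite /mesh_int mulr_sumr; apply: eq_bigr => K _; exact: int_overZ.
Qed.

Lemma mesh_int_sum (I : Type) (s : seq I) (F : I -> broken M) :
  (forall i, tame_broken (F i)) ->
  mesh_int (fun K x => \sum_(i <- s) F i K x) = \sum_(i <- s) mesh_int (F i).
Proof.
move=> tF; rewrite /mesh_int exchange_big; apply: eq_bigr => K _.
by apply: int_over_sum => // i; exact: tF.
Qed.

Lemma mesh_int_ge0 f : (forall K x, 0 <= f K x) -> 0 <= mesh_int f.
Proof. by move=> f0; apply: sumr_ge0 => K _; exact: int_over_ge0. Qed.

Lemma le_mesh_int f g : tame_broken f -> tame_broken g ->
  (forall K x, f K x <= g K x) -> mesh_int f <= mesh_int g.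
Proof. by move=> tf tg fg; apply: ler_sum => K _; exact: le_int_over. Qed.

Lemma tame_brokenM f g : tame_broken f -> tame_broken g ->
  tame_broken (fun K x => f K x * g K x).
Proof. by move=> tf tg K; exact: tameM. Qed.

Lemma tame_dot F G : tame_vbroken F -> tame_vbroken G ->
  tame_broken (fun K x => dot (F K x) (G K x)).
Proof.
by move=> tF tG K; apply: tame_sum => i; apply: tameM; [exact: tF|exact: tG].
Qed.

Lemma tame_ev l (v : dG M l) : tame_broken (ev v).
Proof.
move=> K; apply: tame_sum => m; apply: tameM; first exact: tame_cst.
by apply: tame_prod => i; apply: tameX; exact: tame_coord.
Qed.

Lemma tame_vev l (w : vdG M l) : tame_vbroken (vev w).
Proof. by move=> i K; under eq_fun do rewrite mxE; exact: tame_ev. Qed.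

Lemma tame_pos_part (f : broken M) : tame_broken f -> tame_broken (pos_part f).
Proof. by move=> tf K; exact: tame_max0. Qed.

End broken_integral.

Section dot.
Context {R : realType} {d : nat}.
Implicit Types x y : 'rV[R]_d.

Lemma dotC x y : dot x y = dot y x.
Proof. by apply: eq_bigr => i _; rewrite mulrC. Qed.

Lemma dot_suml (I : Type) (s : seq I) (c : I -> R) (x : I -> 'rV[R]_d) y :
  dot (\sum_(i <- s) c i *: x i) y = \sum_(i <- s) c i * dot (x i) y.
Proof.
rewrite /dot; under eq_bigr do rewrite summxE mulr_suml.
rewrite exchange_big; apply: eq_bigr => i _; rewrite mulr_sumr.
by apply: eq_bigr => j _; rewrite mxE mulrA.
Qed.

Lemma dot_ge0 x : 0 <= dot x x.
Proof. by apply: sumr_ge0 => i _; rewrite -expr2 sqr_ge0. Qed.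

End dot.

Section broken_polynomials.
Context {R : realType} {d : nat} (M : mesh R d).

Lemma ev_sum l (I : Type) (s : seq I) (c : I -> R) (u : I -> dG M l) K x :
  ev (\sum_(i <- s) c i *: u i) K x = \sum_(i <- s) c i * ev (u i) K x.
Proof.
rewrite /ev; under eq_bigr do rewrite summxE mulr_suml.
rewrite exchange_big; apply: eq_bigr => i _; rewrite mulr_sumr.
by apply: eq_bigr => m _; rewrite mxE mulrA.
Qed.

Lemma vev_sum l (I : Type) (s : seq I) (c : I -> R) (u : I -> vdG M l) K x :
  vev (\sum_(i <- s) c i *: u i) K x = \sum_(i <- s) c i *: vev (u i) K x.
Proof.
apply/rowP => j; rewrite mxE summxE sum_ffunE.
rewrite (eq_bigr (fun i => c i *: u i j)); last by move=> i _; rewrite ffunE.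
by rewrite ev_sum; apply: eq_bigr => i _; rewrite !mxE.
Qed.

(** On each element the square of each component is below the nonnegative integrand, whose integral
    is 0; so all coefficients vanish there. *)
Lemma vinner_eq0 l (w : vdG M l) : vinner (vev w) (vev w) = 0 -> w = 0.
Proof.
move=> /eqP; rewrite /vinner psumr_eq0; last first.
  by move=> K _; apply: int_over_ge0 => x _; exact: dot_ge0.
move=> /allP w0; apply/ffunP => i; apply/matrixP => K m; rewrite ffunE mxE.
have := @int_simplex_eq0_coef _ _ l (vtx (enum_val K))
  (fun x => dot (vev w (enum_val K) x) (vev w (enum_val K) x))
  (fun m => w i (enum_rank (enum_val K)) (enum_rank m)).
move=> /(_ (mesh_affine _) _ _ _ (enum_val m)); rewrite !enum_valK; apply.
- exact: (tame_dot (tame_vev w) (tame_vev w)).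
- move=> x; rewrite /dot (bigD1 i)//= -[leLHS]addr0 lerD//.
    by rewrite mxE -expr2 /ev enum_valK.
  by apply: sumr_ge0 => j _; rewrite -expr2 sqr_ge0.
- by apply/eqP; apply: w0; rewrite mem_index_enum.
Qed.

Lemma grad_ev p (v : dG M p) : exists w : vdG M p.-1, grad (ev v) = vev w.
Proof.
have /choice[c cE] : forall Ki : elt M * 'I_d, exists c : monomial d p.-1 -> R,
    (fun x => 'D_(delta_mx 0 Ki.2) (ev v Ki.1) x) =1 polyfun c.
  by move=> [K i]; exact: polyfun_derive.
exists [ffun i => \matrix_(k, m) c (enum_val k, i) (enum_val m)].
apply/funext => K; apply/funext => x; apply/rowP => i; rewrite !mxE ffunE.
rewrite (cE (K, i) x); apply: eq_bigr => m _.
by rewrite mxE !enum_rankK.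
Qed.

Lemma dgrad_vev p (v : dG M p) : exists w : vdG M p.-1, dgrad v = vev w.
Proof.
have [g gE] := grad_ev v.
exists (1 *: g + \sum_(F : fct M) (-1) *: lifting p F (jump F (ev v))).
apply/funext => K; apply/funext => x; rewrite /dgrad gE.
(* The list joins the elementwise gradient, tagged [inl tt], to the facets, so that a single linear
   combination covers both. *)
have := @vev_sum p.-1 _ [:: inl tt & map inr (index_enum (fct M))]
  (fun s => if s is inl _ then 1 else -1)
  (fun s => if s is inr F then lifting p F (jump F (ev v)) else g) K x.
rewrite !big_cons !big_map => ->.
by rewrite scale1r; congr (_ + _); rewrite -sumrN; apply: eq_bigr => F _; rewrite scaleN1r.
Qed.

End broken_polynomials.

(** * Covariance of the noise *)

Section noise_covariance.
Context {R : realType} {d : nat} (M : mesh R d) (p : nat).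
Variable f : (n_G M p).-tuple (vdG M p.-1).
Hypothesis hf : basis_of fullv f.

Let comb (c : 'rV[R]_(n_G M p)) : vdG M p.-1 := \sum_i c 0 i *: tnth f i.

(** Weight 1 gives the mass matrix and weight [pos_part (ev u)] gives [weighted_mass], so one
    bilinear identity serves for both. *)
Let gram (g : broken M) : 'M[R]_(n_G M p) := \matrix_(i, j) mesh_int (fun K x =>
  g K x * dot (vev (tnth f i) K x) (vev (tnth f j) K x)).

Lemma gram_form g c c' : tame_broken g -> (c *m gram g *m c'^T) 0 0 =
  mesh_int (fun K x => g K x * dot (vev (comb c) K x) (vev (comb c') K x)).
Proof.
move=> tg.
have tgf i j : tame_broken (fun K x =>
    g K x * dot (vev (tnth f i) K x) (vev (tnth f j) K x)).
  by apply: tame_brokenM => //; apply: tame_dot; exact: tame_vev.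
have tcgf i j : tame_broken (fun K x =>
    c 0 i * c' 0 j * (g K x * dot (vev (tnth f i) K x) (vev (tnth f j) K x))).
  by move=> K; apply: tameM; [exact: tame_cst|exact: tgf].
transitivity (\sum_i \sum_j mesh_int (fun K x =>
    c 0 i * c' 0 j * (g K x * dot (vev (tnth f i) K x) (vev (tnth f j) K x)))).
  rewrite mxE; under eq_bigr do rewrite mxE mulr_suml.
  rewrite exchange_big; apply: eq_bigr => i _; apply: eq_bigr => j _.
  by rewrite mesh_intZ// !mxE mulrAC.
under eq_bigr do rewrite -mesh_int_sum//.
rewrite -mesh_int_sum; last first.
  by move=> i K; apply: tame_sum => j; exact: tcgf.
congr mesh_int; apply/funext => K; apply/funext => x.
rewrite /comb !vev_sum dot_suml mulr_sumr; apply: eq_bigr => i _.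
rewrite dotC dot_suml !mulr_sumr; apply: eq_bigr => j _.
by rewrite dotC; ring.
Qed.

Lemma gram_tr g : (gram g)^T = gram g.
Proof.
apply/matrixP => i j; rewrite !mxE; congr mesh_int.
by apply/funext => K; apply/funext => x; rewrite dotC.
Qed.

Lemma mass_G_gram : mass_G f = gram (fun _ _ => 1).
Proof.
apply/matrixP => i j; rewrite !mxE /vinner; apply: eq_bigr => K _; congr int_over.
by apply/funext => x; rewrite mul1r.
Qed.

Lemma tame_broken1 : tame_broken (fun (_ : elt M) (_ : 'rV[R]_d) => 1).
Proof. by move=> K; exact: tame_cst. Qed.

Lemma mass_G_unit : mass_G f \in unitmx.
Proof.
rewrite -row_free_unit; apply: inj_row_free => c cM.
have /vinner_eq0 c0 : vinner (vev (comb c)) (vev (comb c)) = 0.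
  have := gram_form c c tame_broken1; rewrite -mass_G_gram cM mul0mx mxE => ->.
  by apply: eq_bigr => K _; congr int_over; apply/funext => x; rewrite mul1r.
apply/rowP => i; rewrite mxE.
have /freeP := basis_free hf; apply.
by rewrite -[RHS]c0; apply: eq_bigr => j _; rewrite -tnth_nth.
Qed.

Lemma comb_surj (w : vdG M p.-1) : exists c, w = comb c.
Proof.
exists (\row_i coord f i w); rewrite {1}(coord_basis hf (memvf w)).
by apply: eq_bigr => i _; rewrite mxE -tnth_nth.
Qed.

Lemma weighted_mass_gram u : weighted_mass f u = gram (pos_part (ev u)).
Proof. by []. Qed.

(** [psd_sqrt] is a choice among candidates; it has the expected properties because a candidate
    exists, the weighted mass being positive semi-definite by nonnegativity of its weight. *)
Lemma sqrt_weighted_mass u : let S := psd_sqrt (weighted_mass f u) in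
  S^T = S /\ S *m S = weighted_mass f u.
Proof.
have /xgetPex : exists S, [/\ S^T = S,
    forall x : 'rV[R]_(n_G M p), 0 <= (x *m S *m x^T) 0 0 & S *m S = weighted_mass f u].
  apply: psd_sqrt_exists; first by rewrite weighted_mass_gram gram_tr.
  move=> c; rewrite weighted_mass_gram gram_form; last exact/tame_pos_part/tame_ev.
  by apply: mesh_int_ge0 => K x; rewrite mulr_ge0 ?dot_ge0// le_max lexx orbT.
by move=> /(_ 0)[].
Qed.

(* In the basis [f], the noise integrands for the field with coordinates [c] are
   the coordinates of [P ^ (1/2) c]: the mass matrix cancels. *)
Lemma vinner_noise_coef u j c : vinner (vev (noise_coef f u j)) (vev (comb c)) =
  (psd_sqrt (weighted_mass f u) *m c^T) j 0.
Proof.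
set S := psd_sqrt _; have [ST _] := sqrt_weighted_mass u.
pose b : 'rV_(n_G M p) := \row_i (invmx (mass_G f) *m S) i j.
have -> : noise_coef f u j = comb b.
  by apply: eq_bigr => i _; congr (_ *: _); rewrite [RHS]mxE.
have -> : vinner (vev (comb b)) (vev (comb c)) = (b *m mass_G f *m c^T) 0 0.
  rewrite mass_G_gram gram_form; last exact: tame_broken1.
  by apply: eq_bigr => K _; congr int_over; apply/funext => x; rewrite mul1r.
have -> : b = row j ((invmx (mass_G f) *m S)^T) by apply/rowP => i; rewrite !mxE.
have MT : (mass_G f)^T = mass_G f by rewrite mass_G_gram gram_tr.
rewrite -!row_mul trmx_mul ST trmx_inv MT mulmxKV ?mass_G_unit//.
by rewrite row_mul mxE !mxE; apply: eq_bigr => i _; rewrite !mxE.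
Qed.

Lemma noise_covariance (u v1 v2 : dG M p) :
  \sum_j vinner (vev (noise_coef f u j)) (dgrad v1) *
         vinner (vev (noise_coef f u j)) (dgrad v2) =
  inner (pos_part (ev u)) (fun K x => dot (dgrad v1 K x) (dgrad v2 K x)).
Proof.
have [w1 ->] := dgrad_vev v1; have [w2 ->] := dgrad_vev v2.
have [c1 ->] := comb_surj w1; have [c2 ->] := comb_surj w2.
have [ST SS] := sqrt_weighted_mass u.
have -> : inner (pos_part (ev u))
    (fun K x => dot (vev (comb c1) K x) (vev (comb c2) K x)) =
    (c1 *m weighted_mass f u *m c2^T) 0 0.
  by rewrite weighted_mass_gram gram_form//; exact/tame_pos_part/tame_ev.
set S := psd_sqrt _ in ST SS *; rewrite -SS mulmxA -mulmxA mxE.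
apply: eq_bigr => j _; rewrite !vinner_noise_coef -/S; congr (_ * _).
by rewrite -[S *m _]trmxK trmx_mul trmxK ST mxE.
Qed.

End noise_covariance.

(** * Finiteness of lower integrals *)

Section lower_integral.
Import HBNNSimple.
Context d (Omega : measurableType d) (R : realType) (P : probability Omega R).
Local Open Scope ereal_scope.

(* [s] need not be measurable, and lower integrals are not additive in general. *)
Lemma lower_integral_affine_lty (s : Omega -> \bar R) (a c : R) :
  (0 < a)%R -> (0 <= c)%R -> (forall w, 0 <= s w) ->
  \int[P]_w s w < +oo -> \int[P]_w (a%:E * s w + c%:E) < +oo.
Proof.
move=> a0 c0 s0 sfin.
have I0 : 0 <= \int[P]_w s w by apply: integral_ge0 => w _; exact: s0.
have as0 w : 0 <= a%:E * s w + c%:E.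
  by rewrite adde_ge0// mule_ge0// lee_fin ltW.
apply: (@le_lt_trans _ _ (a%:E * \int[P]_w s w + c%:E)); last first.
  by rewrite lte_add_pinfty ?ltry// lte_mul_pinfty// lee_fin ltW.
rewrite ge0_integralTE//; apply: ge_ereal_sup => _ [h hs <-].
rewrite -integralT_nnsfun.
(* A simple function h below a s + c yields the positive part of h - c divided by a: this measurable
   g lies below s and satisfies h <= a g + c. *)
pose g w : R := (Num.max (h w - c) 0 / a)%R.
have mg : measurable_fun setT g.
  apply: measurable_funM; last exact: measurable_cst.
  apply: measurable_maxr; last exact: measurable_cst.
  by apply: measurable_funB => //; exact: measurable_cst.
have g0 w : (0 <= g w)%R by rewrite divr_ge0 ?(ltW a0)// le_max lexx orbT.
have gs : \int[P]_w (g w)%:E <= \int[P]_w s w.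
  apply: ge0_le_lower_integral => w; first by rewrite lee_fin.
  rewrite /g; have [_|hc] := leP (h w - c)%R 0%R; first by rewrite mul0r.
  move: (hs w) (s0 w); case: (s w) => [r||] h1 h2; [|by rewrite leey|by []].
  move: h1; rewrite -EFinM -EFinD !lee_fin ler_pdivrMr//; lra.
apply: (@le_trans _ _ (\int[P]_w (a * g w + c)%:E)).
  apply: ge0_le_integral => //.
  - by move=> w _; rewrite lee_fin fun_ge0.
  - exact/measurable_EFinP.
  - apply/measurable_EFinP; apply: measurable_funD => //; exact: measurable_funM.
  - move=> w _; rewrite lee_fin /g mulrCA divff ?gt_eqF// mulr1.
    by have [] := leP (h w - c)%R 0%R; lra.
under eq_integral do rewrite EFinD EFinM.
rewrite ge0_integralD//=; last first.
  by apply/measurable_EFinP; apply: measurable_funM => //; exact: measurable_cst.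
- by move=> w _; rewrite mule_ge0// lee_fin// ltW.
rewrite ge0_integralZl_EFin ?(ltW a0)//; last exact/measurable_EFinP.
  rewrite integral_cst// [X in _ + c%:E * X <= _]probability_setT mule1.
  by rewrite leeD2r// lee_wpmul2l// lee_fin ltW.
by move=> w _; rewrite lee_fin.
Qed.

End lower_integral.

Section noise_bound.
Context {R : realType} {d : nat} (M : mesh R d) (p : nat).
Variable f : (n_G M p).-tuple (vdG M p.-1).
Hypothesis hf : basis_of fullv f.

(** One square is at most the sum over all components, which by the covariance identity is the
    integral of |Gv|^2 weighted by the positive part of u. As u^+ g <= u^2 + g^2 with g = |Gv|^2,
    the constant is the integral of |Gv|^4. *)
Lemma noise_energy_bound (v : dG M p) : exists2 C : R, 0 <= C &
  forall (u : dG M p) j,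
    vinner (vev (noise_coef f u j)) (dgrad v) ^+ 2 <= L2norm (ev u) ^+ 2 + C.
Proof.
have [w vw] := dgrad_vev v.
pose g : broken M := fun K x => dot (dgrad v K x) (dgrad v K x).
have tg : tame_broken g.
  by rewrite /g vw; apply: tame_dot; exact: tame_vev.
exists (mesh_int (fun K x => g K x * g K x)).
  by apply: mesh_int_ge0 => K x; rewrite -expr2 sqr_ge0.
move=> u j; have tu := tame_ev u.
have u0 : 0 <= inner (ev u) (ev u).
  by apply: mesh_int_ge0 => K x; rewrite -expr2 sqr_ge0.
rewrite sqr_sqrtr//.
apply: (@le_trans _ _ (inner (pos_part (ev u)) g)).
  rewrite -(noise_covariance hf) (bigD1 j)//= expr2 lerDl.
  by apply: sumr_ge0 => i _; rewrite -expr2 sqr_ge0.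
have -> : inner (ev u) (ev u) = mesh_int (fun K x => ev u K x * ev u K x) by [].
rewrite -mesh_intD; [|exact: tame_brokenM..].
apply: le_mesh_int.
- by apply: tame_brokenM => //; exact: tame_pos_part.
- by move=> K; apply: tameD; exact: tame_brokenM.
- move=> K x; rewrite /pos_part; have [h|h] := leP (ev u K x) 0.
    by rewrite mul0r -!expr2 addr_ge0 ?sqr_ge0.
  nra.
Qed.

End noise_bound.

(** * The martingale and its bracket for the scheme *)

Theorem proposition4p6 (R : realType) (d p : nat)
    (hd : d \in [:: 1; 2; 3]%N) (hp : (1 <= p)%N)
    (I : Type) (Th : I -> mesh R d)
    (hshape : shape_regular Th) (hquasi : quasi_uniform Th)
    (hF : forall h, fct (Th h) -> R) (hhF : facet_length_scale hF)
    (eta : R) (heta : 0 < eta)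
    (h : I)
    (f : (n_G (Th h) p).-tuple (vdG (Th h) p.-1)) (hf : basis_of fullv f)
    (rho0 : dG (Th h) p) (T : R) (hT : 0 < T) (N : nat) (hN : (0 < N)%N)
    (disp : measure_display) (Omega : measurableType disp)
    (P : probability Omega R) (G : R -> set (set Omega))
    (B : 'I_(n_G (Th h) p) -> R -> Omega -> R)
    (rho : R -> Omega -> dG (Th h) p)
    (hsol : weak_solution f P G B rho T N eta (hF h) rho0)
    (hmoments : forall q : R, 2 <= q ->
      (\int[P]_w (ereal_sup [set (L2norm (ev (rho t w)))%:E | t in `[0%R, T]]
                  `^ q) < +oo)%E)
    (W : dG (Th h) p -> R -> Omega -> R)
    (hW : forall v,
      ito_integral_sum P G T B (noise_integrand f rho v) (W v)) :
  (forall v, continuous_square_integrable_martingale P G T (W v)) /\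
  (forall v1 v2, is_bracket P G T (W v1) (W v2) (fun t w =>
     \int[@lebesgue_measure R]_(s in `[0, t])
       inner (pos_part (ev (rho s w)))
             (fun K x => dot (dgrad v1 K x) (dgrad v2 K x)))).
Proof.
have [GP BP _ _ _] := hsol.
(* The random variable of the second moment hypothesis; its measurability in [w] is not asserted. *)
pose s w := (ereal_sup [set (L2norm (ev (rho t w)))%:E | t in `[0%R, T]] `^ 2)%E.
have s0 w : (0 <= s w)%E by exact: poweR_ge0.
have sfin : (\int[P]_w s w < +oo)%E by exact: hmoments.
have norm_le_s t w : 0 <= t <= T -> ((L2norm (ev (rho t w)) ^+ 2)%:E <= s w)%E.
  move=> tT; have n0 : 0 <= L2norm (ev (rho t w)) by exact: sqrtr_ge0.
  have nle : ((L2norm (ev (rho t w)))%:E <=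
      ereal_sup [set (L2norm (ev (rho t w)))%:E | t in `[0%R, T]])%E.
    by apply: ereal_sup_ubound; exists t => //=; rewrite in_itv.
  have -> : (L2norm (ev (rho t w)) ^+ 2)%:E = ((L2norm (ev (rho t w)))%:E `^ 2)%E.
    by rewrite poweR_EFin -powR_mulrn.
  apply: gt0_ler_poweR => //; rewrite in_itv/= ?lee_fin ?n0 ?leey//.
  by rewrite (le_trans _ nle)// lee_fin.
have VA v : exists (S : nat -> 'I_(n_G (Th h) p) -> simple_process G T) Phi,
    vector_approximation B GP (noise_integrand f rho v) (W v) S Phi.
  have [C C0 HC] := noise_energy_bound hf v.
  (* The bound of [noise_energy_bound] integrated over [[0, T]], with the squared norm replaced by
     its supremum in time. *)
  pose q w := (T%:E * s w + (T * C)%:E)%E.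
  apply: (vector_approximation_exists GP hT (q := q) (hW v)).
  - by move=> w; rewrite /q adde_ge0 ?mule_ge0// lee_fin ?mulr_ge0// ltW.
  - by apply: lower_integral_affine_lty => //; rewrite mulr_ge0// ltW.
  - move=> j; apply: aeW => w.
    have -> : q w = (\int[@lebesgue_measure R]_(t in `[0%R, T]) cst (s w + C%:E) t)%E.
      rewrite integral_cst// [X in (_ * X)%E]lebesgue_measure_itv/= lte_fin hT sube0.
      by rewrite muleDl// ?ge0_adde_def// ?inE// ?lee_fin// muleC -EFinM [(C * _)%R]mulrC.
    (* Both integrals are extended by 0 and compared as lower integrals, since measurability in time
       is not at hand for every single [w]. *)
    rewrite integral_mkcond [leRHS]integral_mkcond.
    apply: ge0_le_lower_integral => t.
      by apply: erestrict_ge0 => r _; rewrite lee_fin sqr_ge0.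
    rewrite !patchE; case: ifP => // /set_mem /=; rewrite in_itv/= => tT.
    apply: (@le_trans _ _ ((L2norm (ev (rho t w)) ^+ 2)%:E + C%:E)%E).
      by rewrite -EFinD lee_fin; exact: HC.
    by rewrite leeD2r//; exact: norm_le_s.
split=> [v|v1 v2].
  by have [S [Phi /(ito_sum_martingale BP)]] := VA v.
have [S1 [Phi1 VA1]] := VA v1; have [S2 [Phi2 VA2]] := VA v2.
have := ito_sum_bracket BP hT VA1 VA2.
(* Only the density is rewritten: at each time and sample point the sum over the components is the
   weighted inner product. *)
congr is_bracket; apply/funext => t; apply/funext => w.
by apply: eq_Rintegral => r _; exact: noise_covariance.
Qed.
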